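(* Let $K$ be an algebraically closed field, and let $A$ be the free noncommutative $K$-algebra generated in degree one by elements $x, y$. Let $I$ denote the two-sided ideal generated in $A$ by homogeneous elements $f_{1}, f_{2}, \ldots \in A$ of positive degree. For $n\ge 0$ let $r_{n}$ denote the number of elements among $f_{1}, f_{2}, \ldots $ with degrees larger than $2^{n}$ and not exceeding $2^{n+1}$. Suppose that $r_{i}=0$ for $i<8$. Denote $Y=\{n : r_{n}\neq 0\}$. Suppose that there are no elements among $f_{1}, f_{2}, \ldots $ with degree $k$ if $k\in [2^{n}-2^{n-3},\, 2^{n}+2^{n-2}]$ for some integer $n\ge 0$. Suppose that for all $m,n\in Y\cup \{0\}$ with $m<n$ we have $$2^{3n+4}r_{m}^{33}<r_{n}< 2^{2^{n-m-3}}\quad\text{and}\quad r_{n}<2^{2^{n/2-4}}.$$ Then there is an infinite-dimensional graded $K$-algebra $R$ such that the following holds: 1. The algebra $A/I$ can be homomorphically mapped onto the algebra $R$. 2. If $n$ is a natural number, and $k$ is maximal such that $k\leq 2 \log (n)$ and $k\in Y$, then $\dim R_{n}\leq 8n^{4}r_{k}^{33}$. 3. Moreover, for all $j\in Y$ with $j\leq \log(n)$ we have ${1\over 2} r_{j}^{4}\leq \dim R_{n}$ (for every natural number $n$). Here $R_{n}\subseteq R$ is the $K$-linear space consisting of elements of degrees not exceeding $n$.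
   Context: All logarithms are in base $2$. A graded algebra means an algebra graded by the additive semigroup of natural numbers. $A(k)$ denotes the $K$-span of the monomials (words) of degree $k$ in $x,y$; elements of $A(k)$ are called homogeneous of degree $k$. Some of the $f_i$ are allowed to be zero (a zero element is then listed with a chosen degree), and the list $f_1,f_2,\ldots$ may be infinite. $\dim$ is dimension over $K$. *)

(* Defs.v *)
From HB Require Import structures.
From mathcomp Require Import all_boot all_order all_algebra.
From mathcomp Require Import generic_quotient ring_quotient.
From mathcomp Require Import finmap.
From mathcomp Require Import boolp classical_sets cardinality reals exp.
From mathcomp.multinomials Require Import monalg.

Set Implicit Arguments.
Unset Strict Implicit.
Unset Printing Implicit Defensive.

Import Order.TTheory GRing.Theory Num.Theory.

Local Open Scope ring_scope.
Local Open Scope quotient_scope.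

(* {fmonom 'I_2} is the free monoid of words in two letters, so this is the
   (unital) free noncommutative K-algebra K<x, y>. *)
Notation free_alg K := {malg K[{fmonom 'I_2}]}.

(* The subspace A(k): 0 is homogeneous of every degree. *)
Definition homogeneous (K : fieldType) (k : nat) (a : free_alg K) : Prop :=
  forall w : {fmonom 'I_2}, w \in msupp a -> fdeg w = k.

Section IdealQuotient.
Variables (K : pzRingType) (A : lalgType K) (J : Type) (f : J -> A).

Definition gen_ideal (a : A) : Prop :=
  exists s : seq (A * J * A), a = \sum_(t <- s) t.1.1 * f t.1.2 * t.2.

Lemma gen_ideal0 : gen_ideal 0.
Proof. by exists [::]; rewrite big_nil. Qed.

Lemma gen_idealD a b : gen_ideal a -> gen_ideal b -> gen_ideal (a + b).
Proof. by move=> [s ->] [t ->]; exists (s ++ t); rewrite big_cat. Qed.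

Lemma gen_idealMl c a : gen_ideal a -> gen_ideal (c * a).
Proof.
move=> [s ->]; exists [seq (c * t.1.1, t.1.2, t.2) | t <- s].
by rewrite big_map mulr_sumr; apply: eq_bigr => t _; rewrite !mulrA.
Qed.

Lemma gen_idealMr c a : gen_ideal a -> gen_ideal (a * c).
Proof.
move=> [s ->]; exists [seq (t.1.1, t.1.2, t.2 * c) | t <- s].
by rewrite big_map mulr_suml; apply: eq_bigr => t _; rewrite !mulrA.
Qed.

Definition ideal_pred : {pred A} := fun a => `[< gen_ideal a >].

Lemma ideal_predP a : reflect (gen_ideal a) (a \in ideal_pred).
Proof. exact: asboolP. Qed.

Fact ideal_zmod_closed : zmod_closed ideal_pred.
Proof.
split=> [|a b /ideal_predP Ia /ideal_predP Ib]; apply/ideal_predP.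
  exact: gen_ideal0.
by apply: gen_idealD => //; rewrite -mulN1r; apply: gen_idealMl.
Qed.

HB.instance Definition _ :=
  GRing.isZmodClosed.Build A ideal_pred ideal_zmod_closed.

Definition quot_alg := Quotient.quot ideal_pred.

HB.instance Definition _ := GRing.Zmodule.on quot_alg.
HB.instance Definition _ :
  @isZmodQuotient A (Quotient.equiv ideal_pred) 0 -%R +%R quot_alg :=
  ZmodQuotient.on quot_alg.

Definition quot_proj (a : A) : quot_alg := \pi_quot_alg a.

Lemma quot_projE a b : quot_proj a = quot_proj b <-> gen_ideal (a - b).
Proof.
rewrite /quot_proj; split=> [/eqP|/ideal_predP ab].
  by rewrite -Quotient.idealrBE => /ideal_predP.
by apply/eqP; rewrite -Quotient.idealrBE.
Qed.

Lemma quot_projK x : quot_proj (repr x) = x.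
Proof. exact: reprK. Qed.

Lemma repr_quot_proj a : gen_ideal (repr (quot_proj a) - a).
Proof. by apply/quot_projE; rewrite quot_projK. Qed.

Lemma quot_projD a b : quot_proj (a + b) = quot_proj a + quot_proj b.
Proof. exact: raddfD. Qed.

Definition quot_one : quot_alg := quot_proj 1.
Definition quot_mul (x y : quot_alg) : quot_alg := quot_proj (repr x * repr y).
Definition quot_scale (c : K) (x : quot_alg) : quot_alg :=
  quot_proj (c *: repr x).

Lemma quot_projM a b : quot_proj (a * b) = quot_mul (quot_proj a) (quot_proj b).
Proof.
apply/esym/quot_projE; set a' := repr _; set b' := repr _.
have -> : a' * b' - a * b = (a' - a) * b' + a * (b' - b).
  by rewrite mulrBl mulrBr addrA subrK.
apply: gen_idealD; first by apply: gen_idealMr; apply: repr_quot_proj.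
by apply: gen_idealMl; apply: repr_quot_proj.
Qed.

Lemma quot_projZ c a : quot_proj (c *: a) = quot_scale c (quot_proj a).
Proof.
apply/esym/quot_projE; rewrite -scalerBr -[X in _ *: X]mul1r scalerAl.
by apply: gen_idealMl; apply: repr_quot_proj.
Qed.

Lemma quot_projP x : exists a, x = quot_proj a.
Proof. by exists (repr x); rewrite quot_projK. Qed.

Fact quot_mulA : associative quot_mul.
Proof.
move=> x y z; case: (quot_projP x) (quot_projP y) (quot_projP z).
by move=> a -> [b ->] [c ->]; rewrite -!quot_projM mulrA.
Qed.

Fact quot_mul1l : left_id quot_one quot_mul.
Proof. by move=> x; case: (quot_projP x) => a ->; rewrite -quot_projM mul1r. Qed.

Fact quot_mul1r : right_id quot_one quot_mul.
Proof. by move=> x; case: (quot_projP x) => a ->; rewrite -quot_projM mulr1. Qed.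

Fact quot_mulDl : left_distributive quot_mul +%R.
Proof.
move=> x y z; case: (quot_projP x) (quot_projP y) (quot_projP z).
move=> a -> [b ->] [c ->].
by rewrite -quot_projD -!quot_projM -quot_projD mulrDl.
Qed.

Fact quot_mulDr : right_distributive quot_mul +%R.
Proof.
move=> x y z; case: (quot_projP x) (quot_projP y) (quot_projP z).
move=> a -> [b ->] [c ->].
by rewrite -quot_projD -!quot_projM -quot_projD mulrDr.
Qed.

(* The generated ideal may be the whole algebra, so the quotient is only a
   possibly trivial ring. *)
HB.instance Definition _ := GRing.Zmodule_isPzRing.Build quot_alg
  quot_mulA quot_mul1l quot_mul1r quot_mulDl quot_mulDr.

Fact quot_scaleA a b x :
  quot_scale a (quot_scale b x) = quot_scale (a * b) x.
Proof. by case: (quot_projP x) => c ->; rewrite -!quot_projZ scalerA. Qed.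

Fact quot_scale1 : left_id 1 quot_scale.
Proof. by move=> x; case: (quot_projP x) => c ->; rewrite -quot_projZ scale1r. Qed.

Fact quot_scaleDr : right_distributive quot_scale +%R.
Proof.
move=> a x y; case: (quot_projP x) (quot_projP y) => b -> [c ->].
by rewrite -quot_projD -!quot_projZ -quot_projD scalerDr.
Qed.

Fact quot_scaleDl x : {morph quot_scale^~ x : a b / a + b}.
Proof.
move=> a b; case: (quot_projP x) => c ->.
by rewrite -!quot_projZ -quot_projD scalerDl.
Qed.

HB.instance Definition _ := GRing.Zmodule_isLmodule.Build K quot_alg
  quot_scaleA quot_scale1 quot_scaleDr quot_scaleDl.

Fact quot_proj_is_zmod_morphism : zmod_morphism quot_proj.
Proof. by move=> a b; apply: raddfB. Qed.

HB.instance Definition _ :=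
  GRing.isZmodMorphism.Build A quot_alg quot_proj quot_proj_is_zmod_morphism.

Fact quot_proj_is_monoid_morphism : monoid_morphism quot_proj.
Proof. by split=> // a b; apply: quot_projM. Qed.

HB.instance Definition _ :=
  GRing.isMonoidMorphism.Build A quot_alg quot_proj quot_proj_is_monoid_morphism.

Fact quot_proj_is_scalable : scalable quot_proj.
Proof. by move=> c a; apply: quot_projZ. Qed.

HB.instance Definition _ :=
  GRing.isScalable.Build K A quot_alg *:%R quot_proj quot_proj_is_scalable.

End IdealQuotient.

(* Subspaces are Prop-valued predicates, since mathcomp's {vspace V} requires a
   finite-dimensional ambient space. *)
Definition has_dim (K : fieldType) (V : lmodType K) (W : V -> Prop) (D : nat) :
    Prop :=
  exists b : 'I_D -> V,
    [/\ forall i, W (b i),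
        forall c : 'I_D -> K, \sum_i c i *: b i = 0 -> forall i, c i = 0 &
        forall v, W v -> exists c : 'I_D -> K, v = \sum_i c i *: b i].

Definition infinite_dim (K : fieldType) (V : lmodType K) : Prop :=
  forall D, ~ has_dim (fun _ : V => True) D.

(* R is the direct sum of the subspaces G n, with G m * G n inside G (m + n). *)
Record grading (K : fieldType) (R : algType K) (G : nat -> R -> Prop) : Prop :=
  Grading {
    grading0 : forall n, G n 0;
    gradingP : forall n (a : K) u v, G n u -> G n v -> G n (a *: u + v);
    grading1 : G 0%N 1;
    gradingM : forall m n u v, G m u -> G n v -> G (m + n)%N (u * v);
    grading_sum : forall u, exists (N : nat) (c : nat -> R),
      (forall i, G i (c i)) /\ u = \sum_(i < N) c i;
    grading_direct : forall (N : nat) (c : nat -> R),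
      (forall i, G i (c i)) -> \sum_(i < N) c i = 0 ->
      forall i, (i < N)%N -> c i = 0
  }.

Definition degree_le (K : fieldType) (R : algType K) (G : nat -> R -> Prop)
    (n : nat) (u : R) : Prop :=
  exists c : nat -> R, (forall i, G i (c i)) /\ u = \sum_(i < n.+1) c i.

Definition log2 (F : realType) (x : F) : F := ln x / ln 2.

(* Main.v *)
Require Import Defs.
From HB Require Import structures.
From mathcomp Require Import all_boot all_order all_algebra.
From mathcomp Require Import generic_quotient ring_quotient.
From mathcomp Require Import finmap.
From mathcomp Require Import boolp classical_sets cardinality reals exp.
From mathcomp.multinomials Require Import monalg.
From mathcomp Require Import zify ring lra.

(* The quotient is described dually, by the functionals that vanish on its kernel.
   A state is a finite alphabet whose letters stand for linearly independent
   functionals on words of a fixed length L. Products of letters are functionals on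
   words of length a multiple of L, and the elements annihilated by all translates
   of all products form a graded two-sided ideal. Replacing the letters by
   combinations of words in the letters enlarges this ideal; the kernel is the union
   of the ideals along a sequence of such replacements.

   By the gap hypothesis the relations of level n have degrees between 5 and 7
   times 2 ^ (n - 2). With u = 2 ^ (n - 2) / L, new letters are built from half-blocks
   x ^ (4 u - g) z, with x one fixed letter and z a zone of length g = 2 gam <= u,
   alternately a fixed al and a varying one. Translates of a relation become
   conditions on windows that meet only one or two zones, one of them entirely, and
   linear in that one; there are about r n (u + D ^ gam) of them, D being the size
   of the alphabet, against D ^ (2 gam) unknowns. So al and then many independent
   zones solve all conditions as soon as D ^ gam is about (r n) ^ 2, and about
   (r n) ^ 4 letters remain.

   Between levels the state is only padded with the letter x. The span of the
   windows of length p is then controlled by the ranks of the matrices obtained by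
   cutting a functional in two, which gives the upper bound; the lower bound counts
   the letters of level j, whose right halves are independent of degree 2 ^ j and
   persist, up to scalars, in all later states. *)

Set Implicit Arguments.
Unset Strict Implicit.
Unset Printing Implicit Defensive.

Import Order.TTheory GRing.Theory Num.Theory.

Local Open Scope ring_scope.

(** Two neighbouring unknown zones would make the conditions quadratic; alternating with the fixed
    zone [al] keeps them linear. Their number must not be exponential in the letter length L: at
    each left offset a relation reduces to (prefix rank) times (suffix rank) functionals on words in
    the letters, these being the ranks of the two ways of cutting a letter. So the ranks are carried
    as an invariant from level to level, and the lower bound on [r n] in the growth hypothesis is
    what absorbs them.

    The two doubly exponential bounds on [r n] make the zones fit, [2 gam <= u]. Padding after the
    previous level m brings the letter length to [2 ^ l], where l is the larger of m + 1 and n / 2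
    rounded up. A zone fits if [r n < 2 ^ u] with [u = 2 ^ (n - 2 - l)], and the two values of l
    give the two bounds.

    Padding up to about [2 ^ (n / 2)] is dictated by the upper bound: a window of length p is
    examined at the stage n with [2 ^ n <= p ^ 2 < 2 ^ (n + 1)], where it is no longer than a padded
    letter, while the unpadded letters have length at most [2 p ^ 2], which produces the factor
    [p ^ 4]. *)

Ltac slia := simpl in *; lia.

(** * Lists of conditions and enumeration of words *)

Fixpoint allp (A : Type) (Q : A -> Prop) (l : seq A) : Prop :=
  if l is x :: l' then Q x /\ allp Q l' else True.

Section Allp.
Variable A : Type.
Implicit Types (Q : A -> Prop) (l : seq A).

Lemma allp_cat Q l1 l2 : allp Q (l1 ++ l2) <-> allp Q l1 /\ allp Q l2.
Proof. by elim: l1 => [|x l1 IH] /=; tauto. Qed.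

Lemma allp_sub Q Q' l : (forall x, Q x -> Q' x) -> allp Q l -> allp Q' l.
Proof. by move=> h; elim: l => //= x l IH [/h ? /IH]. Qed.

Lemma allp_map (B : Type) (f : B -> A) Q (l : seq B) :
  allp Q [seq f x | x <- l] <-> allp (fun x => Q (f x)) l.
Proof. by elim: l => //= x l ->. Qed.

Lemma allp_flatten Q (ll : seq (seq A)) :
  allp Q (flatten ll) <-> allp (allp Q) ll.
Proof. by elim: ll => //= l ll IH; rewrite allp_cat IH. Qed.

Lemma allpP Q (x0 : A) l :
  allp Q l <-> forall j, (j < size l)%N -> Q (nth x0 l j).
Proof.
elim: l => [|x l IH] //=; rewrite IH; split.
  by case=> Qx Ql [|j] //= ?; apply: Ql.
by move=> h; split=> [|j ?]; [apply: (h 0%N) | apply: (h j.+1)].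
Qed.

End Allp.

Lemma allp_mem (A : eqType) (Q : A -> Prop) (l : seq A) :
  allp Q l <-> forall x, x \in l -> Q x.
Proof.
elim: l => [|x l IH] //=; rewrite IH; split.
  by case=> Qx Ql y; rewrite inE => /orP[/eqP ->|/Ql].
by move=> h; split=> [|y yl]; apply: h; rewrite inE ?eqxx // yl orbT.
Qed.

Lemma allp_bind (A : Type) (B : eqType) (f : B -> seq A) Q (l : seq B) :
  allp Q (flatten [seq f x | x <- l]) <-> forall x, x \in l -> allp Q (f x).
Proof. by rewrite allp_flatten allp_map allp_mem. Qed.

Lemma size_bind (A B : Type) (f : B -> seq A) (l : seq B) :
  size (flatten [seq f x | x <- l]) = (\sum_(x <- l) size (f x))%N.
Proof. by elim: l => [|x l IH]; rewrite ?big_nil ?big_cons //= size_cat IH. Qed.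

Section Words.
Variable T : finType.

Fixpoint words n : seq (seq T) :=
  if n is n'.+1 then [seq a :: s | a <- enum T, s <- words n'] else [:: [::]].

Lemma mem_words n s : (s \in words n) = (size s == n).
Proof.
elim: n s => [|n IH] [|a s] //=.
  by apply/allpairsP => -[[b t]] [_ _].
rewrite eqSS -IH; apply/allpairsP/idP => [[[b t] /= [_ ? [_ ->]]]//|h].
by exists (a, s); rewrite mem_enum.
Qed.

Lemma size_words n : size (words n) = (#|T| ^ n)%N.
Proof. by elim: n => //= n IH; rewrite size_allpairs IH -cardE expnS. Qed.

Lemma uniq_words n : uniq (words n).
Proof.
elim: n => //= n IH; apply: allpairs_uniq => //; first exact: enum_uniq.
by move=> [a s] [b t] _ _ /= [-> ->].
Qed.

Lemma sum_words_cons (V : nmodType) n (F : seq T -> V) :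
  \sum_(s <- words n.+1) F s = \sum_a \sum_(s <- words n) F (a :: s).
Proof. by rewrite big_allpairs_dep big_enum. Qed.

Lemma sum_words_cat (V : nmodType) m n (F : seq T -> V) :
  \sum_(s <- words (m + n)) F s =
  \sum_(s <- words m) \sum_(t <- words n) F (s ++ t).
Proof.
elim: m F => [|m IH] F; first by rewrite big_seq1.
rewrite addSn !sum_words_cons; apply: eq_bigr => a _; exact: IH.
Qed.

Lemma sum_words1 (V : nmodType) n (F : seq T -> V) s0 :
  size s0 = n -> (forall s, size s = n -> s != s0 -> F s = 0) ->
  \sum_(s <- words n) F s = F s0.
Proof.
move=> sz0 F0; rewrite (big_rem s0) ?mem_words ?sz0 //=.
rewrite big_seq big1 ?addr0 // => s.
rewrite mem_rem_uniq ?uniq_words // !inE mem_words => /andP[ne /eqP sz].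
exact: F0.
Qed.

End Words.

(** * Functionals on words *)

Section Functionals.
Variable K : fieldType.

Definition pairing (T : Type) (f : T -> K) (ws : seq (K * T)) : K :=
  \sum_(p <- ws) p.1 * f p.2.

(* [dspan F phi]: phi vanishes on every formal combination killed by F, which
   for a finite list F says that phi lies in the span of F. *)
Definition dspan (T : Type) (F : seq (T -> K)) (phi : T -> K) : Prop :=
  forall ws, allp (fun f => pairing f ws = 0) F -> pairing phi ws = 0.

Section Dspan.
Variable T : Type.
Implicit Types (F : seq (T -> K)) (phi psi : T -> K).

Lemma dspan_ext F phi psi : phi =1 psi -> dspan F phi -> dspan F psi.
Proof.
move=> e h ws /h <-; apply: eq_bigr => p _; by rewrite e.
Qed.

Lemma dspan0 F : dspan F (fun _ => 0).
Proof. by move=> ws _; rewrite /pairing big1 // => p _; rewrite mulr0. Qed.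

Lemma dspanZ F c phi : dspan F phi -> dspan F (fun w => c * phi w).
Proof.
move=> h ws /h e; rewrite /pairing.
under eq_bigr do rewrite mulrCA.
by rewrite -mulr_sumr -/(pairing phi ws) e mulr0.
Qed.

Lemma dspan_sum (I : Type) (r : seq I) F (phi : I -> T -> K) :
  (forall i, dspan F (phi i)) -> dspan F (fun w => \sum_(i <- r) phi i w).
Proof.
move=> h ws k; rewrite /pairing.
under eq_bigr do rewrite mulr_sumr.
rewrite exchange_big big1 // => i _; exact: h.
Qed.

Lemma dspan_catl F G phi : dspan F phi -> dspan (F ++ G) phi.
Proof. by move=> h ws /allp_cat[/h]. Qed.

Lemma dspan_catr F G phi : dspan G phi -> dspan (F ++ G) phi.
Proof. by move=> h ws /allp_cat[_ /h]. Qed.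

Lemma dspan_map (I : eqType) (l : seq I) (f : I -> T -> K) i :
  i \in l -> dspan [seq f j | j <- l] (f i).
Proof. by move=> il ws /allp_map/allp_mem/(_ _ il). Qed.

Lemma dspan_bind (I : eqType) (l : seq I) (f : I -> seq (T -> K)) phi i :
  i \in l -> dspan (f i) phi -> dspan (flatten [seq f j | j <- l]) phi.
Proof. by move=> il h ws /allp_bind/(_ _ il)/h. Qed.

End Dspan.

Section Tensor.
Variable T : eqType.
Implicit Types (phi psi : seq T -> K) (w : seq T).

Definition supp m phi := forall w, size w != m -> phi w = 0.

Definition tens m phi psi w := phi (take m w) * psi (drop m w).

Lemma tens_cat m phi psi u v : size u = m -> tens m phi psi (u ++ v) = phi u * psi v.
Proof. by move=> um; rewrite /tens take_size_cat // drop_size_cat. Qed.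

Lemma supp_tens m n phi psi :
  supp m phi -> supp n psi -> supp (m + n)%N (tens m phi psi).
Proof.
move=> sp sq w; rewrite /tens => hw.
case: (leqP m (size w)) => h; last first.
  by rewrite sp ?mul0r // take_oversize ?(ltnW h) // neq_ltn h.
by rewrite (sq (drop m w)) ?mulr0 // size_drop; move: hw; lia.
Qed.

(** With one factor fixed, pairing with a tensor is pairing the other factor with a combination
    whose coefficients have been modified. The two hypotheses can therefore be used one after the
    other, without choosing coordinates. *)
Lemma dspan_tens m (F G : seq (seq T -> K)) phi psi :
  dspan F phi -> dspan G psi ->
  dspan (flatten [seq [seq tens m f g | g <- G] | f <- F]) (tens m phi psi).
Proof.
move=> hF hG ws k.
have e f g : pairing (tens m f g) ws =
    pairing g [seq (p.1 * f (take m p.2), drop m p.2) | p <- ws].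
  by rewrite /pairing big_map; apply: eq_bigr => p _ /=; rewrite mulrA.
have e' f g : pairing (tens m f g) ws =
    pairing f [seq (p.1 * g (drop m p.2), take m p.2) | p <- ws].
  rewrite /pairing big_map; apply: eq_bigr => p _ /=.
  by rewrite -mulrA [X in _ * X]mulrC.
rewrite e'; apply: hF.
move/allp_flatten/allp_map: k; apply: allp_sub => f /allp_map kf.
rewrite -e' e; apply: hG; apply: allp_sub kf => g; by rewrite e.
Qed.

Lemma size_tensl m (F G : seq (seq T -> K)) :
  size (flatten [seq [seq tens m f g | g <- G] | f <- F]) = (size F * size G)%N.
Proof.
rewrite size_bind; under eq_bigr do rewrite size_map.
by rewrite big_const_seq count_predT iter_addn_0 mulnC.
Qed.

Definition delta (s w : seq T) : K := (w == s)%:R.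

Lemma supp_delta s : supp (size s) (delta s).
Proof. by move=> w; rewrite /delta; have [->|] := eqVneq w s; rewrite ?eqxx. Qed.

(* Tensor product of a list of functionals supported on words of length L. *)
Fixpoint tev L (Z : seq (seq T -> K)) w : K :=
  if Z is z :: Z' then z (take L w) * tev L Z' (drop L w) else (w == [::])%:R.

Lemma tev_cat L Z1 Z2 w1 w2 : size w1 = (L * size Z1)%N ->
  tev L (Z1 ++ Z2) (w1 ++ w2) = tev L Z1 w1 * tev L Z2 w2.
Proof.
elim: Z1 w1 => [|z Z1 IH] w1 /=.
  by rewrite muln0 => /size0nil ->; rewrite eqxx mul1r.
rewrite mulnS => sz; have lw : (L <= size w1)%N by rewrite sz leq_addr.
have -> : drop L (w1 ++ w2) = drop L w1 ++ w2.
  by rewrite -{1}(cat_take_drop L w1) -catA drop_size_cat // size_takel.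
by rewrite takel_cat // IH ?mulrA // size_drop sz addKn.
Qed.

Lemma tev_supp L Z : allp (supp L) Z -> supp (L * size Z)%N (tev L Z).
Proof.
elim: Z => [_ w /=|z Z IH /=]; first by rewrite muln0 size_eq0 => /negPf ->.
case=> sz /IH sZ; rewrite mulnS; exact: supp_tens.
Qed.

Lemma tev1 L z w : supp L z -> tev L [:: z] w = z w.
Proof.
move=> sz /=; case: (leqP (size w) L) => h.
  by rewrite take_oversize // drop_oversize // eqxx mulr1.
rewrite (sz w); last by rewrite neq_ltn h orbT.
have : drop L w != [::] by rewrite -size_eq0 size_drop; lia.
by move/negPf ->; rewrite mulr0.
Qed.

End Tensor.

(** * Ranks as factorizations, and dimension counts *)

Section Rank.
Variables (I J : Type).

(** Rank at most [n] of a possibly infinite matrix restricted to the rows in [A] and the columns in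
    [B], expressed as a factorization through [K ^ n]. *)
Definition rk (A : I -> Prop) (B : J -> Prop) (M : I -> J -> K) n :=
  exists (H : 'I_n -> I -> K) (k : 'I_n -> J -> K),
    forall i j, A i -> B j -> M i j = \sum_l H l i * k l j.

End Rank.

Lemma rk_tr I J A B M n : @rk I J A B M n -> @rk J I B A (fun j i => M i j) n.
Proof.
move=> [H [k e]]; exists k, H => j i bj ai; rewrite e //.
by apply: eq_bigr => l _; rewrite mulrC.
Qed.

Lemma rk_leq I J A B M n m : (n <= m)%N -> @rk I J A B M n -> rk A B M m.
Proof.
move=> nm [H [k e]].
pose H' (l : 'I_m) i := if (insub (val l) : option 'I_n) is Some l' then H l' i else 0.
pose k' (l : 'I_m) i := if (insub (val l) : option 'I_n) is Some l' then k l' i else 0.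
exists H', k' => i j ai bj; rewrite e //.
rewrite (bigID (fun l : 'I_m => (l < n)%N)) /= [X in _ + X]big1 ?addr0; last first.
  by move=> l hl; rewrite /H' insubN // mul0r.
rewrite -(big_ord_widen _ (fun l => (if (insub l : option 'I_n) is Some l' then H l' i else 0) *
   (if (insub l : option 'I_n) is Some l' then k l' j else 0))) //.
by apply: eq_bigr => l _; rewrite valK.
Qed.

Lemma rk_mem (I : eqType) (J : Type) (A : I -> Prop) (B : J -> Prop) M (W : seq I) :
  (forall i, A i -> i \in W) -> @rk I J A B M (size W).
Proof.
case: W => [|w0 W0] AW.
  exists (fun _ _ => 0), (fun _ _ => 0) => i j /AW; by rewrite in_nil.
set W := w0 :: W0.
exists (fun (l : 'I_(size W)) i => (index i W == val l)%:R), (fun l j => M (nth w0 W (val l)) j) => i j ai _.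
have h : (index i W < size W)%N by rewrite index_mem AW.
rewrite (bigD1 (Ordinal h)) //= eqxx mul1r nth_index ?AW // big1 ?addr0 // => l ne.
case: eqP => [e|_]; last by rewrite mul0r.
by move: ne; rewrite -val_eqE /= -e eqxx.
Qed.

End Functionals.

Section LinearAlgebra.
Variable K : fieldType.

(** Dimension count: the left kernel of the matrix of conditions has dimension at least
    [size W - size cs], and [d] rows of a basis of it are the required solutions. *)
Lemma exists_solutions (T : eqType) (W : seq T) (cs : seq (T -> K)) d :
  uniq W -> (size cs + d <= size W)%N ->
  exists c : 'I_d -> T -> K,
    [/\ forall i, allp (fun x => \sum_(t <- W) c i t * x t = 0) cs,
        forall i t, t \notin W -> c i t = 0 &
        forall e : 'I_d -> K, (forall t, \sum_i e i * c i t = 0) ->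
          forall i, e i = 0].
Proof.
case: d => [|d] uW sz.
  by exists (fun _ _ => 0); split=> // [[]|e _ []].
have [t0 _] : exists t, t \in W.
  case: W uW sz => [|t W] //=; first by lia.
  by exists t; rewrite inE eqxx.
pose N := size W; pose x0 : T -> K := fun _ => 0.
pose M := \matrix_(t < N, j < size cs) nth x0 cs j (nth t0 W t).
have rd : (d.+1 <= \rank (kermx M))%N.
  have h1 : (\rank M <= size cs)%N := rank_leq_col M.
  rewrite mxrank_ker; move: sz h1; rewrite -/N; clear; lia.
have [R fR RM] : exists2 R : 'M_(\rank (kermx M), N), row_free R & R *m M = 0.
  exists (row_base (kermx M)); first exact: row_base_free.
  by apply/sub_kermxP; rewrite eq_row_base.
pose c (i : 'I_d.+1) t : K :=
  if insub (index t W) is Some k then R (widen_ord rd i) k else 0.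
have cE i (k : 'I_N) : c i (nth t0 W k) = R (widen_ord rd i) k.
  by rewrite /c index_uniq // valK.
exists c; split.
- move=> i; apply/(allpP _ x0) => j hj.
  rewrite (big_nth t0) big_mkord.
  transitivity ((R *m M) (widen_ord rd i) (Ordinal hj)); last by rewrite RM mxE.
  rewrite [RHS]mxE; apply: eq_bigr => k _.
  by rewrite cE mxE.
- by move=> i t tW; rewrite /c insubN // -leqNgt leqNgt index_mem.
- move=> e h i.
  pose v : 'rV[K]_(\rank (kermx M)) :=
    \row_l (if insub (val l) is Some l' then e l' else 0).
  have v0 : v *m R = 0.
    apply/rowP => k; rewrite !mxE -[RHS](h (nth t0 W k)).
    rewrite (bigID (fun l : 'I__ => (l < d.+1)%N)) /= [X in _ + X]big1 ?addr0.
      pose F (n : nat) := if (insub n : option 'I_d.+1) is Some l' then e l' * R (widen_ord rd l') k else 0.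
      transitivity (\sum_(l < \rank (kermx M) | (l < d.+1)%N) F l).
        apply: eq_bigr => l hl; rewrite /F !mxE.
        by rewrite insubT; congr (_ * R _ _); apply: val_inj.
      rewrite -(big_ord_widen _ F) //.
      by apply: eq_bigr => l _; rewrite /F valK cE.
    by move=> l hl; rewrite mxE insubN ?mul0r.
  have := row_free_inj fR.
  move=> /(_ _ v 0); rewrite v0 mul0mx => /(_ erefl)/rowP/(_ (widen_ord rd i)).
  by rewrite !mxE /= valK.
Qed.

Lemma exists_dependency m (I : eqType) (W : seq I) (M : I -> 'I_m -> K) :
  (size W < m)%N ->
  exists2 c : 'I_m -> K, (exists l, c l != 0) &
    forall i, i \in W -> \sum_l c l * M i l = 0.
Proof.
move=> h.
have [|c [cK _ ci]] := @exists_solutions 'I_m (enum 'I_m) [seq M i | i <- W] 1%N (enum_uniq _).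
  by rewrite size_map size_enum_ord addn1.
exists (c ord0).
  apply: contrapT => n; have := ci (fun _ => 1) _ ord0.
  have -> : (1 : K) = 0 <-> False by split=> // /eqP; rewrite oner_eq0.
  apply=> t; rewrite big_ord1 mul1r; apply/eqP; apply: contrapT => /negP ht.
  by apply: n; exists t.
move=> i iW; have /allp_map/allp_mem/(_ _ iW) := cK ord0.
by rewrite big_enum.
Qed.

(** A maximal independent family of actual columns spans all the others, and the factorization
    bounds its size. With genuine columns of [M] as one factor, a second rank bound can be applied
    to them; [inner_span] relies on this. *)
Lemma rk_members (I J : Type) (A : I -> Prop) (B : J -> Prop) (M : I -> J -> K) n :
  rk A B M n ->
  exists (m : nat) (js : 'I_m -> J) (k : 'I_m -> J -> K),
    [/\ (m <= n)%N, forall l, B (js l) &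
      forall i j, A i -> B j -> M i j = \sum_l M i (js l) * k l j].
Proof.
move=> [H [k e]].
pose indep m (js : 'I_m -> J) :=
  (forall l, B (js l)) /\
  forall c : 'I_m -> K, (forall i, A i -> \sum_l c l * M i (js l) = 0) ->
    forall l, c l = 0.
pose Q m := `[< exists js : 'I_m -> J, indep m js >].
have Q0 : exists m, Q m.
  exists 0%N; apply/asboolP.
  have f0 (l : 'I_0) : J by case: l.
  by exists f0; split=> [[]|c _ []].
have Qn m : Q m -> (m <= n)%N.
  move=> /asboolP[js [Bjs ind]]; rewrite leqNgt; apply/negP => nm.
  have [|c [l cl] h] := @exists_dependency m 'I_n (enum 'I_n) (fun i l => k i (js l)).
    by rewrite size_enum_ord.
  move/eqP: cl; apply; apply: ind => i ai.
  under eq_bigr => l' _ do rewrite (e _ _ ai (Bjs l')) mulr_sumr.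
  rewrite exchange_big big1 // => l' _.
  under eq_bigr => l'' _ do rewrite mulrCA.
  by rewrite -mulr_sumr h ?mulr0 // mem_enum.
case: (ex_maxnP Q0 Qn) => m /asboolP[js [Bjs ind]] mmax.
have ex j : exists kj : 'I_m -> K, B j -> forall i, A i ->
    M i j = \sum_l M i (js l) * kj l.
  case: (pselect (B j)) => Bj; last by exists (fun _ => 0).
  pose js' (l : 'I_m.+1) := if unlift ord0 l is Some l' then js l' else j.
  have nd : ~ indep m.+1 js'.
    move=> h; have /mmax : Q m.+1 by apply/asboolP; exists js'.
    by rewrite ltnn.
  have js'0 : js' ord0 = j by rewrite /js' unlift_none.
  have js'l l : js' (lift ord0 l) = js l by rewrite /js' liftK.
  have [c [cM [l cl]]] : exists c : 'I_m.+1 -> K,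
      (forall i, A i -> \sum_l c l * M i (js' l) = 0) /\ exists l, c l <> 0.
    apply: contrapT => n0; apply: nd; split.
      by move=> l; rewrite /js'; case: (unlift _ _).
    move=> c cM l; apply: contrapT => cl; apply: n0; exists c; split=> //.
    by exists l.
  have c0 : c ord0 != 0.
    apply/eqP => c0; apply: cl.
    case: (unliftP ord0 l) => [l' ->|->] //.
    apply: (ind (fun l => c (lift ord0 l))) => i ai.
    have := cM i ai; rewrite big_ord_recl c0 mul0r add0r => h.
    by rewrite -[RHS]h; apply: eq_bigr => l'' _; rewrite js'l.
  exists (fun l => - c (lift ord0 l) / c ord0) => _ i ai.
  have := cM i ai; rewrite big_ord_recl js'0 => /eqP.
  rewrite addr_eq0 => /eqP h; apply: (mulfI c0); rewrite h mulr_sumr -sumrN.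
  apply: eq_bigr => l' _; rewrite js'l; field; exact: c0.
have [kk hk] := choice ex.
exists m, js, (fun l j => kk j l); split=> //; first exact/Qn/asboolP/(ex_intro _ js).
by move=> i j ai bj; rewrite (hk j bj i ai).
Qed.

End LinearAlgebra.

Section Peel.
Variables (K : fieldType) (T : finType).

(** Factors lying entirely over the fixed words [U] and [V] contribute only scalars. What remains is
    a product [Z2] whose window misses less than one factor at each end. *)
Lemma tev_peel (A : Type) (f : A -> seq T -> K) L (Z : seq A) (U V : seq T) k :
  (0 < L)%N -> (size U + k + size V)%N = (L * size Z)%N ->
  exists Z1 Z2 Z3 U1 u v V3,
    [/\ [/\ Z = Z1 ++ Z2 ++ Z3, U = U1 ++ u & V = v ++ V3],
        (size u < L)%N, (size v < L)%N,
        (size u + k + size v)%N = (L * size Z2)%N &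
        forall w, size w = k ->
          tev L (map f Z) (U ++ w ++ V) =
          tev L (map f Z1) U1 * tev L (map f Z2) (u ++ w ++ v) *
          tev L (map f Z3) V3].
Proof.
move=> L0 e.
set m := (size U %/ L)%N; set n := (size V %/ L)%N.
have eU := divn_eq (size U) L; have eV := divn_eq (size V) L.
rewrite -/m in eU; rewrite -/n in eV.
have lU := ltn_pmod (size U) L0; have lV := ltn_pmod (size V) L0.
have mn : (m + n <= size Z)%N.
  rewrite -(leq_pmul2l L0) -e mulnDr ![(L * _)%N]mulnC; lia.
pose Z1 := take m Z; pose Z' := drop m Z.
pose Z2 := take (size Z' - n) Z'; pose Z3 := drop (size Z' - n) Z'.
have sZ1 : size Z1 = m by rewrite size_takel //; lia.
have sZ' : size Z' = (size Z - m)%N by rewrite size_drop.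
have sZ2 : size Z2 = (size Z - m - n)%N by rewrite size_takel sZ' //; lia.
have sZ3 : size Z3 = n by rewrite size_drop sZ'; lia.
pose U1 := take (m * L) U; pose u := drop (m * L) U.
pose v := take (size V %% L) V; pose V3 := drop (size V %% L) V.
have sU1 : size U1 = (L * m)%N by rewrite size_takel; lia.
have su : size u = (size U %% L)%N by rewrite size_drop; lia.
have sv : size v = (size V %% L)%N by rewrite size_takel; lia.
have sV3 : size V3 = (L * n)%N by rewrite size_drop; lia.
exists Z1, Z2, Z3, U1, u, v, V3; split.
- by rewrite !cat_take_drop.
- by rewrite su.
- by rewrite sv.
- rewrite su sv sZ2 !mulnBr -e; lia.
move=> w sw.
have -> : Z = Z1 ++ Z2 ++ Z3 by rewrite !cat_take_drop.
have -> : U ++ w ++ V = U1 ++ (u ++ w ++ v) ++ V3.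
  by rewrite -{1}(cat_take_drop (m * L) U) -{1}(cat_take_drop (size V %% L) V) !catA.
rewrite !map_cat tev_cat ?sU1 ?size_map ?sZ1 // tev_cat ?mulrA //.
rewrite !size_cat su sv sw size_map sZ2 !mulnBr -e; lia.
Qed.

End Peel.

(** * Zones killing a family of relations *)

Section HalfBlocks.
Variables (K : fieldType) (T : finType) (x : T) (s0 g : nat).
Let s := (s0 + g)%N.
Local Notation X i := (nseq i x).

Definition half_block (z : seq T -> K) : seq T -> K := tens s0 (delta K (X s0)) z.

Lemma half_block_supp z : supp g z -> supp s (half_block z).
Proof. by move=> h; apply: supp_tens => //; have := @supp_delta K _ (X s0); rewrite size_nseq. Qed.

(** A window starting in the run of letters [x] forces the missing part of the run to consist of
    [x], and then sees the whole zone. *)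
Lemma half_block_left z (F : seq T -> K) U : (size U <= s0)%N ->
  \sum_(w <- words T (s - size U)) half_block z (U ++ w) * F w =
  (U == X (size U))%:R *
    \sum_(t <- words T g) z t * F (X (s0 - size U) ++ t).
Proof.
move=> h; have -> : (s - size U)%N = (s0 - size U + g)%N by rewrite /s; slia.
rewrite sum_words_cat (@sum_words1 _ _ _ _ (X (s0 - size U))) ?size_nseq //.
  rewrite mulr_sumr; apply: eq_bigr => t _.
  rewrite catA /half_block tens_cat; last by rewrite size_cat size_nseq; slia.
  rewrite -mulrA; congr (_ * _); rewrite /delta.
  have -> : X s0 = X (size U) ++ X (s0 - size U) by rewrite -nseqD; congr nseq; slia.
  by rewrite eqseq_cat ?size_nseq // eqxx andbT.
move=> y sy ny; rewrite big1 // => t _.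
rewrite catA /half_block tens_cat; last by rewrite size_cat sy; slia.
rewrite /delta (_ : _ == _ = false) ?mul0r //; apply: contra_neqF ny => /eqP e.
have := congr1 (drop (size U)) e; rewrite drop_size_cat // drop_nseq => ->.
by [].
Qed.

Lemma half_block_left_cut z U w : (s0 < size U)%N ->
  half_block z (U ++ w) = (take s0 U == X s0)%:R * z (drop s0 U ++ w).
Proof.
by move=> h; rewrite -{1}(cat_take_drop s0 U) -catA /half_block tens_cat // size_takel // ltnW.
Qed.

Lemma half_block_right z (F : seq T -> K) V : (size V < g)%N ->
  \sum_(w <- words T (s - size V)) half_block z (w ++ V) * F w =
  \sum_(y <- words T (g - size V)) z (y ++ V) * F (X s0 ++ y).
Proof.
move=> h; have -> : (s - size V)%N = (s0 + (g - size V))%N by rewrite /s; slia.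
rewrite sum_words_cat (@sum_words1 _ _ _ _ (X s0)) ?size_nseq //.
  apply: eq_bigr => y _.
  by rewrite -catA /half_block tens_cat ?size_nseq // /delta eqxx mul1r.
move=> w sw nw; rewrite big1 // => y _.
by rewrite -catA /half_block tens_cat // /delta (negPf nw) !mul0r.
Qed.

(** A window ending inside the run sees nothing of the zone: only one word contributes, so the
    half-block acts as a scalar followed by letters [x]. *)
Lemma half_block_right_cut z V : (g <= size V)%N -> (size V < s)%N ->
  exists c : K, forall F : seq T -> K,
    \sum_(w <- words T (s - size V)) half_block z (w ++ V) * F w =
    c * F (X (s - size V)).
Proof.
move=> h1 h2; set j := (size V - g)%N.
exists (half_block z (X (s - size V) ++ V)) => F.
rewrite (@sum_words1 _ _ _ _ (X (s - size V))) ?size_nseq //.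
move=> w sw nw; rewrite -{1}(cat_take_drop j V) catA /half_block tens_cat; last first.
  rewrite size_cat sw size_takel /j; move: h1 h2; rewrite /s; slia.
rewrite /delta (_ : _ == _ = false) ?mul0r //; apply: contra_neqF nw => /eqP e.
have := congr1 (take (size w)) e; rewrite take_size_cat // => ->.
rewrite take_nseq ?sw //; move: h1 h2; rewrite /s; slia.
Qed.

(* [kills1]: the window contains a whole zone and meets no other; [kills2]: it
   meets two consecutive zones, one of them whole. *)
Definition kills1 k (rho z : seq T -> K) :=
  forall i i', (i + g + i')%N = k ->
    \sum_(t <- words T g) z t * rho (X i ++ t ++ X i') = 0.

Definition kills2 k (rho z1 z2 : seq T -> K) :=
  [/\ forall i i', (i + g + s0 + g + i')%N = k ->
        \sum_(t <- words T g) z1 t *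
          \sum_(y <- words T g) z2 y * rho (X i ++ t ++ X s0 ++ y ++ X i') = 0,
      forall i j v, (0 < j < g)%N -> (j + size v)%N = g -> (i + g + s0 + j)%N = k ->
        \sum_(t <- words T g) z1 t *
          \sum_(y <- words T j) z2 (y ++ v) * rho (X i ++ t ++ X s0 ++ y) = 0 &
      forall u j i', (0 < j < g)%N -> (j + size u)%N = g -> (j + s0 + g + i')%N = k ->
        \sum_(y <- words T j) z1 (u ++ y) *
          \sum_(t <- words T g) z2 t * rho (y ++ X s0 ++ t ++ X i') = 0].

End HalfBlocks.

Lemma tev_supp_map (K : fieldType) (T : eqType) (A : Type) (f : A -> seq T -> K) L :
  (forall a, supp L (f a)) -> forall Z : seq A, supp (L * size Z)%N (tev L (map f Z)).
Proof.
move=> h Z w sw; rewrite (@tev_supp _ _ L (map f Z)) ?size_map //.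
by apply/allp_map; elim: Z {sw} => //= a Z IH; split.
Qed.

Section Windows.
Variables (K : fieldType) (T : finType) (x : T) (s0 g u : nat).
Hypotheses (e4 : (s0 + g)%N = (4 * u)%N) (gu : (g <= u)%N) (g0 : (0 < g)%N).
Local Notation X i := (nseq i x).
Local Notation s := (s0 + g)%N.
Local Notation half_block := (@half_block K T x s0).

Variables (A : Type) (f : A -> seq T -> K).
Hypothesis fs : forall a, supp g (f a).
Let F a := half_block (f a).

(** Consecutive zones start 4 u apart and are at most u long. Hence a window of length at least 5 u
    contains a whole zone, and one meeting three zones would have length at least
    [g + 2 s0 + 2 = 8 u - g + 2], more than 7 u + 1. *)
Lemma windows_killed (k : nat) (rho : seq T -> K) (Z : seq A) :
  (5 * u <= k <= 7 * u + 1)%N ->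
  (forall a, kills1 x g k rho (f a)) ->
  (forall Z1 a b Z3, Z = Z1 ++ a :: b :: Z3 -> kills2 x s0 g k rho (f a) (f b)) ->
  forall U V, \sum_(w <- words T k) rho w * tev s (map F Z) (U ++ w ++ V) = 0.
Proof.
move=> /andP[k5 k7] K1 K2 U V.
have Fs a : supp s (F a) by apply: half_block_supp.
case: (eqVneq (size U + k + size V)%N (s * size Z)%N) => e; last first.
  rewrite big1_seq // => w /andP[_]; rewrite mem_words => /eqP sw.
  rewrite (tev_supp_map Fs) ?mulr0 // !size_cat sw; move: e; clear; rewrite addnA; done.
have s_gt0 : (0 < s)%N by slia.
have [Z1 [Z2 [Z3 [U1 [uu [v [V3 [[eZ eU eV] su sv suv h]]]]]]]] := tev_peel F s_gt0 e.
suff: \sum_(w <- words T k) rho w * tev s (map F Z2) (uu ++ w ++ v) = 0.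
  move=> h0; transitivity (\sum_(w <- words T k) (tev s (map F Z1) U1 * tev s (map F Z3) V3) *
    (rho w * tev s (map F Z2) (uu ++ w ++ v))).
    rewrite big_seq [RHS]big_seq; apply: eq_bigr => w; rewrite mem_words => /eqP sw.
    rewrite h //; ring.
  by rewrite -mulr_sumr h0 mulr0.
have K2' Za a b Zb : Z2 = Za ++ a :: b :: Zb -> kills2 x s0 g k rho (f a) (f b).
  by move=> e2; apply: (K2 (Z1 ++ Za) a b (Zb ++ Z3)); rewrite eZ e2 -!catA.
clear h e eU eV U V Z1 U1 V3 Z3 eZ K2.
have su' : (size uu < 4 * u)%N by slia.
have sv' : (size v < 4 * u)%N by slia.
(* Only two or three half-blocks are possible: one covers at most 4 u < k letters, and four would
   need 16 u <= (7 u + 1) + 2 (4 u - 1). *)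
case: Z2 suv K2' => [|a [|b [|c [|d Z2]]]] suv K2'; try by exfalso; move: suv; rewrite /= e4; slia.
(* With two half-blocks at most 8 u - 5 u = 3 u <= s0 letters are missing on the left, so the first
   zone is whole. *)
- have eo : (size uu <= s0)%N by move: suv; rewrite /= e4; slia.
  have ek : k = (s - size uu + (s - size v))%N by move: suv; rewrite /= e4; slia.
  pose G w1 := \sum_(w2 <- words T (s - size v)) F b (w2 ++ v) * rho (w1 ++ w2).
  have -> : \sum_(w <- words T k) rho w * tev s (map F [:: a; b]) (uu ++ w ++ v) =
      \sum_(w1 <- words T (s - size uu)) F a (uu ++ w1) * G w1.
    rewrite ek sum_words_cat big_seq [RHS]big_seq; apply: eq_bigr => w1.
    rewrite mem_words => /eqP sw1; rewrite mulr_sumr; apply: eq_bigr => w2 _.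
    rewrite (_ : uu ++ _ = (uu ++ w1) ++ (w2 ++ v)); last by rewrite !catA.
    rewrite -[map F _]/([:: F a] ++ [:: F b]) tev_cat; last by rewrite size_cat sw1 /= e4; slia.
    rewrite !(tev1 _ (Fs _)); ring.
  rewrite /F half_block_left // -/F; case: eqP => [_|]; last by rewrite mul0r.
  rewrite mul1r; case: (ltnP (size v) g) => vg; last first.
    have [c hc] := @half_block_right_cut K T x s0 g (f b) v vg sv.
    under eq_bigr => t _ do rewrite /G hc mulrCA -catA.
    rewrite -mulr_sumr K1 ?mulr0 //.
    by move: suv; rewrite /= e4; slia.
  under eq_bigr => t _ do rewrite /G half_block_right //.
  have [K2a K2b _] := K2' [::] a b [::] erefl.
  case: (posnP (size v)) => v0.
    rewrite (size0nil v0); rewrite -[RHS](K2a (s0 - size uu)%N 0%N); last by slia.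
    apply: eq_bigr => t _; congr (_ * _); rewrite subn0; apply: eq_bigr => y _.
    by rewrite !cats0 -!catA.
  rewrite -[RHS](K2b (s0 - size uu)%N (g - size v)%N v); try by slia.
  apply: eq_bigr => t _; congr (_ * _); apply: eq_bigr => y _.
  by rewrite -!catA.
- have ek : k = (s - size uu + (s + (s - size v)))%N by move: suv; rewrite /= e4; slia.
  (* With three half-blocks at least 12 u - (7 u + 1) - (4 u - 1) = u >= g letters are missing on
     the right: the third zone is not met, and the middle one is whole. *)
  have vg : (g <= size v)%N by move: suv; rewrite /= e4; slia.
  have [cc hc] := @half_block_right_cut K T x s0 g (f c) v vg sv.
  pose i' := (s - size v)%N.
  pose G w1 := \sum_(t <- words T g) f b t * rho (w1 ++ X s0 ++ t ++ X i').
  have -> : \sum_(w <- words T k) rho w * tev s (map F [:: a; b; c]) (uu ++ w ++ v) =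
      cc * \sum_(w1 <- words T (s - size uu)) F a (uu ++ w1) * G w1.
    rewrite ek sum_words_cat big_seq mulr_sumr [RHS]big_seq; apply: eq_bigr => w1.
    rewrite mem_words => /eqP sw1; rewrite sum_words_cat.
    transitivity (F a (uu ++ w1) * \sum_(w2 <- words T s) F b w2 *
       (\sum_(w3 <- words T (s - size v)) F c (w3 ++ v) * rho (w1 ++ w2 ++ w3))).
      rewrite mulr_sumr big_seq [RHS]big_seq; apply: eq_bigr => w2.
      rewrite mem_words => /eqP sw2; rewrite mulrA mulr_sumr; apply: eq_bigr => w3 _.
      rewrite (_ : uu ++ _ = (uu ++ w1) ++ (w2 ++ (w3 ++ v))); last by rewrite !catA.
      rewrite -[map F _]/([:: F a] ++ [:: F b] ++ [:: F c]).
      rewrite tev_cat; last by rewrite size_cat sw1 /= e4; slia.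
      rewrite tev_cat; last by rewrite sw2 /= e4; slia.
      rewrite !(tev1 _ (Fs _)); ring.
    rewrite mulrCA; congr (_ * _).
    transitivity (cc * \sum_(w2 <- words T s) F b w2 * rho (w1 ++ w2 ++ X i')).
      rewrite mulr_sumr; apply: eq_bigr => w2 _.
      rewrite mulrCA; congr (_ * _); rewrite -[RHS](hc (fun w3 => rho (w1 ++ w2 ++ w3))).
      by [].
    congr (_ * _).
    have := @half_block_left K T x s0 g (f b) (fun w2 => rho (w1 ++ w2 ++ X i')) [::] (leq0n _).
    rewrite /= subn0 mul1r => ->.
    by apply: eq_bigr => t _; rewrite subn0 -!catA.
  case: (leqP (size uu) s0) => us.
    rewrite /F half_block_left // -/F; case: eqP => [_|]; last by rewrite mul0r mulr0.
    have [K2a _ _] := K2' [::] a b [:: c] erefl.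
    rewrite mul1r (_ : \sum_(t <- words T g) _ = 0) ?mulr0 //.
    rewrite -[RHS](K2a (s0 - size uu)%N i'); last by rewrite /i'; move: suv; rewrite /= e4; slia.
    apply: eq_bigr => t _; congr (_ * _); apply: eq_bigr => y _.
    by rewrite -!catA.
  under eq_bigr => w1 _ do rewrite /F half_block_left_cut // -mulrA.
  rewrite -mulr_sumr.
  have [_ _ K2c] := K2' [::] a b [:: c] erefl.
  rewrite K2c ?mulr0 //; rewrite ?size_drop /i'; move: suv; rewrite /= e4; slia.
Qed.

End Windows.

Lemma sum_pow_lt D n : (1 < D)%N -> (\sum_(j <- iota 0 n) D ^ j <= D ^ n)%N.
Proof.
move=> D1; have -> : iota 0 n = index_iota 0 n by rewrite /index_iota subn0.
elim: n => [|n IH]; first by rewrite big_geq.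
rewrite big_nat_recr //= expnS.
have := leq_mul D1 (leqnn (D ^ n)); lia.
Qed.

Lemma sum_pow_rev D n : (1 < D)%N ->
  (\sum_(j <- iota n n) D ^ (2 * n - j) <= 2 * D ^ n)%N.
Proof.
move=> D1.
have -> : (\sum_(j <- iota n n) D ^ (2 * n - j) = \sum_(0 <= i < n) D ^ (n - i))%N.
  rewrite -[X in iota X]addn0 iotaDl big_map /index_iota subn0.
  by apply: eq_bigr => i _; congr (_ ^ _)%N; lia.
elim: n => [|n IH]; first by rewrite big_geq.
rewrite big_nat_recl // subn0 expnS.
have -> : (\sum_(0 <= i < n) D ^ (n.+1 - i.+1) = \sum_(0 <= i < n) D ^ (n - i))%N.
  by apply: eq_bigr => i _; rewrite subSS.
have := leq_mul D1 (leqnn (D ^ n)); lia.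
Qed.

Lemma sum_exch (K : fieldType) (A B : Type) (W1 : seq A) (W2 : seq B)
    (a : A -> K) (b : B -> K) (F : A -> B -> K) :
  \sum_(s <- W1) a s * (\sum_(t <- W2) b t * F s t) =
  \sum_(t <- W2) b t * (\sum_(s <- W1) a s * F s t).
Proof.
under eq_bigr do rewrite mulr_sumr; rewrite exchange_big /=.
by apply: eq_bigr => t _; rewrite mulr_sumr; apply: eq_bigr => s _; ring.
Qed.

Section Killers.
Variables (K : fieldType) (T : finType) (x : T) (u gam : nat).
Local Notation X i := (nseq i x).
Local Notation g := (2 * gam)%N.
Local Notation s0 := (4 * u - g)%N.
Hypotheses (gam0 : (0 < gam)%N) (gu : (g <= u)%N) (D1 : (1 < #|T|)%N).

Definition sat (z c : seq T -> K) := \sum_(t <- words T g) z t * c t = 0.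

(* A cut of length j < gam is left free, so that these conditions only involve
   the zone al; cuts of length at least gam are left to [be_conds]. *)
Definition al_conds (r : nat * (seq T -> K)) : seq (seq T -> K) :=
  [seq (fun t => r.2 (X i ++ t ++ X (r.1 - g - i))) | i <- iota 0 (8 * u)] ++
  flatten [seq [seq (fun t => r.2 (X (r.1 - g - s0 - j) ++ t ++ X s0 ++ y)) |
    y <- words T j] | j <- iota 0 gam] ++
  flatten [seq [seq (fun t => r.2 (y ++ X s0 ++ t ++ X (r.1 - g - s0 - j))) |
    y <- words T j] | j <- iota 0 gam].

(* Once al is fixed, the remaining conditions are linear in the other zones. *)
Definition be_conds (al : seq T -> K) (r : nat * (seq T -> K)) : seq (seq T -> K) :=
  [seq (fun t => \sum_(a <- words T g) al a *
     r.2 (X i ++ a ++ X s0 ++ t ++ X (r.1 - g - s0 - g - i))) | i <- iota 0 (8 * u)] ++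
  [seq (fun t => \sum_(a <- words T g) al a *
     r.2 (X i ++ t ++ X s0 ++ a ++ X (r.1 - g - s0 - g - i))) | i <- iota 0 (8 * u)] ++
  flatten [seq [seq (fun t => \sum_(y <- words T j) al (y ++ v) *
     r.2 (X (r.1 - g - s0 - j) ++ t ++ X s0 ++ y)) | v <- words T (g - j)] |
     j <- iota gam gam] ++
  flatten [seq [seq (fun t => \sum_(y <- words T j) al (v ++ y) *
     r.2 (y ++ X s0 ++ t ++ X (r.1 - g - s0 - j))) | v <- words T (g - j)] |
     j <- iota gam gam] ++
  flatten [seq [seq (fun t => (drop j t == v)%:R * \sum_(a <- words T g) al a *
     r.2 (X (r.1 - g - s0 - j) ++ a ++ X s0 ++ take j t)) | v <- words T (g - j)] |
     j <- iota gam gam] ++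
  flatten [seq [seq (fun t => (take (g - j) t == v)%:R * \sum_(a <- words T g) al a *
     r.2 (drop (g - j) t ++ X s0 ++ a ++ X (r.1 - g - s0 - j))) | v <- words T (g - j)] |
     j <- iota gam gam].

Lemma size_al_conds r : (size (al_conds r) <= 8 * u + 2 * #|T| ^ gam)%N.
Proof.
rewrite /al_conds !size_cat size_map size_iota !size_bind.
have h (F : nat -> seq (seq T -> K)) : (forall j, size (F j) = #|T| ^ j)%N ->
    (\sum_(j <- iota 0 gam) size (F j) <= #|T| ^ gam)%N.
  by move=> e; under eq_bigr do rewrite e; apply: sum_pow_lt.
have -> : (2 * #|T| ^ gam = #|T| ^ gam + #|T| ^ gam)%N by lia.
by rewrite leq_add2l; apply: leq_add; apply: h => j; rewrite size_map size_words.
Qed.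

Lemma size_be_conds al r : (size (be_conds al r) <= 16 * u + 8 * #|T| ^ gam)%N.
Proof.
rewrite /be_conds !size_cat !size_map !size_iota !size_bind.
have h (F : nat -> seq (seq T -> K)) : (forall j, size (F j) = #|T| ^ (g - j))%N ->
    (\sum_(j <- iota gam gam) size (F j) <= 2 * #|T| ^ gam)%N.
  by move=> e; under eq_bigr do rewrite e; apply: sum_pow_rev.
have -> : (16 * u + 8 * #|T| ^ gam = 8 * u + (8 * u + (2 * #|T| ^ gam +
  (2 * #|T| ^ gam + (2 * #|T| ^ gam + 2 * #|T| ^ gam)))))%N by lia.
by rewrite !leq_add2l; do 3?[apply: leq_add]; apply: h => j; rewrite size_map size_words.
Qed.

Section OneRelation.
Variables (k : nat) (rho : seq T -> K) (al z : seq T -> K).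
Hypotheses (k5 : (5 * u <= k)%N) (k7 : (k <= 7 * u + 1)%N).

Lemma al_condsP y : allp (sat y) (al_conds (k, rho)) <->
  [/\ forall i, (i < 8 * u)%N ->
        \sum_(t <- words T g) y t * rho (X i ++ t ++ X (k - g - i)) = 0,
      forall j w, (j < gam)%N -> size w = j ->
        \sum_(t <- words T g) y t * rho (X (k - g - s0 - j) ++ t ++ X s0 ++ w) = 0 &
      forall j w, (j < gam)%N -> size w = j ->
        \sum_(t <- words T g) y t * rho (w ++ X s0 ++ t ++ X (k - g - s0 - j)) = 0].
Proof.
rewrite /al_conds !allp_cat !allp_bind allp_map allp_mem; split.
  case=> h1 [h2 h3]; split.
  - by move=> i hi; apply: h1; rewrite mem_iota.
  - move=> j w hj sw; have /h2 : j \in iota 0 gam by rewrite mem_iota.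
    by move/allp_map/allp_mem/(_ w); apply; rewrite mem_words sw.
  - move=> j w hj sw; have /h3 : j \in iota 0 gam by rewrite mem_iota.
    by move/allp_map/allp_mem/(_ w); apply; rewrite mem_words sw.
case=> h1 h2 h3; split; [|split].
- by move=> i; rewrite mem_iota => hi; apply: h1.
- move=> j; rewrite mem_iota => hj; apply/allp_map/allp_mem => w.
  by rewrite mem_words => /eqP; apply: h2.
- move=> j; rewrite mem_iota => hj; apply/allp_map/allp_mem => w.
  by rewrite mem_words => /eqP; apply: h3.
Qed.

Lemma al_conds_kills1 y : allp (sat y) (al_conds (k, rho)) -> kills1 x g k rho y.
Proof.
case/al_condsP => h _ _ i i' e.
have -> : i' = (k - g - i)%N by slia.
apply: h; slia.
Qed.

(** If the cut zone shows [j < gam] letters, the whole zone already kills every choice of these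
    letters separately. If [j >= gam], the at most gam missing letters [v] are fixed and the
    condition is one of [be_conds]; when the cut zone is the varying one, an indicator such as
    [drop j t == v] makes its restriction a linear condition on all of [z]. *)
Lemma conds_kills2 :
  allp (sat al) (al_conds (k, rho)) -> allp (sat z) (al_conds (k, rho)) ->
  allp (sat z) (be_conds al (k, rho)) ->
  kills2 x s0 g k rho al z /\ kills2 x s0 g k rho z al.
Proof.
move=> /al_condsP[_ a2 a3] /al_condsP[_ z2 z3].
rewrite /be_conds !allp_cat !allp_bind !allp_map !allp_mem /= => -[b2 [b3 [b4 [b5 [b6 b7]]]]].
have jg j : (gam <= j < g)%N -> j \in iota gam gam by rewrite mem_iota; slia.
have mw (j : nat) (v : seq T) : (j + size v)%N = g -> v \in words T (g - j).
  by move=> e; rewrite mem_words; apply/eqP; slia.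
split; split.
- move=> i i' e; rewrite sum_exch.
  have -> : i' = (k - g - s0 - g - i)%N by slia.
  by apply: b2; rewrite mem_iota; slia.
- move=> i j v jh ev e; have -> : i = (k - g - s0 - j)%N by slia.
  case: (ltnP j gam) => hj.
    rewrite sum_exch big1_seq // => y /andP[_]; rewrite mem_words => /eqP sy.
    by rewrite a2 ?mulr0.
  have /jg/b6/allp_map/allp_mem/(_ v (mw _ _ ev)) : (gam <= j < g)%N by slia.
  rewrite /sat => h.
  have eg : words T g = words T (j + (g - j)) by congr words; slia.
  transitivity (\sum_(y <- words T j) z (y ++ v) * \sum_(a <- words T g) al a *
     rho (X (k - g - s0 - j) ++ a ++ X s0 ++ y)); first by rewrite sum_exch.
  rewrite {1}eg sum_words_cat in h; rewrite -[RHS]h big_seq [RHS]big_seq; apply: eq_bigr => y.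
  rewrite mem_words => /eqP sy.
  rewrite (@sum_words1 _ _ _ _ v); last 2 first; first by slia.
    by move=> v' _ nv; rewrite drop_size_cat // (negPf nv) mul0r mulr0.
  by rewrite drop_size_cat // take_size_cat // eqxx mul1r.
- move=> w j i' jh ew e; have -> : i' = (k - g - s0 - j)%N by slia.
  case: (ltnP j gam) => hj.
    rewrite big1_seq // => y /andP[_]; rewrite mem_words => /eqP sy.
    by rewrite z3 ?mulr0.
  have /jg/b5/allp_map/allp_mem/(_ w (mw _ _ ew)) : (gam <= j < g)%N by slia.
  by rewrite /sat => h; rewrite sum_exch.
- move=> i i' e.
  have -> : i' = (k - g - s0 - g - i)%N by slia.
  by apply: b3; rewrite mem_iota; slia.
- move=> i j v jh ev e; have -> : i = (k - g - s0 - j)%N by slia.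
  case: (ltnP j gam) => hj.
    rewrite sum_exch big1_seq // => y /andP[_]; rewrite mem_words => /eqP sy.
    by rewrite z2 ?mulr0.
  have /jg/b4/allp_map/allp_mem/(_ v (mw _ _ ev)) : (gam <= j < g)%N by slia.
  by [].
- move=> w j i' jh ew e; have -> : i' = (k - g - s0 - j)%N by slia.
  case: (ltnP j gam) => hj.
    rewrite big1_seq // => y /andP[_]; rewrite mem_words => /eqP sy.
    by rewrite a3 ?mulr0.
  have /jg/b7/allp_map/allp_mem/(_ w (mw _ _ ew)) : (gam <= j < g)%N by slia.
  have eg : words T g = words T ((g - j) + j) by congr words; slia.
  rewrite /sat {1}eg sum_words_cat => h; rewrite -[RHS]h.
  rewrite (@sum_words1 _ _ (g - j) _ w); last 2 first; first by slia.
    move=> v' sv nv; rewrite big1 // => y _.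
    by rewrite take_size_cat // (negPf nv) mul0r mulr0.
  by apply: eq_bigr => y _; rewrite take_size_cat ?drop_size_cat ?eqxx ?mul1r //; slia.
Qed.

End OneRelation.

Lemma sat_tens1 be v c : sat (tens (g - 1)%N be (delta K [:: v])) c <->
  \sum_(s <- words T (g - 1)) be s * c (s ++ [:: v]) = 0.
Proof.
rewrite /sat (_ : words T g = words T ((g - 1) + 1)); last by congr words; slia.
rewrite sum_words_cat.
rewrite (_ : \sum_(s <- words T (g - 1)) _ =
  \sum_(s <- words T (g - 1)) be s * c (s ++ [:: v])) // big_seq [RHS]big_seq.
apply: eq_bigr => s; rewrite mem_words => /eqP ss.
rewrite (@sum_words1 _ _ 1 _ [:: v]) //.
  by rewrite tens_cat // /delta eqxx mulr1.
by move=> t _ tv; rewrite tens_cat // /delta (negPf tv) mulr0 mul0r.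
Qed.

Lemma size_flat_le (A B : Type) (f : A -> seq B) (l : seq A) m :
  (forall a, size (f a) <= m)%N -> (size (flatten [seq f a | a <- l]) <= size l * m)%N.
Proof.
move=> h; elim: l => //= a l IH; rewrite size_cat mulSn leq_add //.
Qed.

(** First [al] is found by a dimension count, then the varying zones. These are sought in the form
    [be c] followed by an arbitrary last letter [v], so each condition is imposed once for every
    [v]; this is the factor [#|T|]. The free last letter is what lets every old letter survive
    inside a new one. The number 24 u + 10 D ^ gam is the sum of the sizes of [al_conds] and
    [be_conds]. *)
Lemma exists_killers (rels : seq (nat * (seq T -> K))) d :
  allp (fun r => (5 * u <= r.1 <= 7 * u + 1)%N) rels ->
  (size rels * (8 * u + 2 * #|T| ^ gam) < #|T| ^ g)%N ->
  (size rels * #|T| * (24 * u + 10 * #|T| ^ gam) + d <= #|T| ^ (g - 1))%N ->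
  exists (al : seq T -> K) (be : 'I_d -> seq T -> K),
    let z c v := tens (g - 1)%N (be c) (delta K [:: v]) in
    [/\ supp g al, exists t, al t != 0, forall c, supp (g - 1)%N (be c),
        forall e : 'I_d -> K, (forall t, \sum_c e c * be c t = 0) ->
          forall c, e c = 0 &
        allp (fun r : nat * (seq T -> K) => [/\ kills1 x g r.1 r.2 al,
          forall c v, kills1 x g r.1 r.2 (z c v) &
          forall c v, kills2 x s0 g r.1 r.2 al (z c v) /\
                      kills2 x s0 g r.1 r.2 (z c v) al]) rels].
Proof.
move=> rk Xa Xb.
have [|a [aK a0 ai]] := @exists_solutions K _ (words T g)
    (flatten [seq al_conds r | r <- rels]) 1 (uniq_words T g).
  rewrite addn1 size_words; apply: leq_ltn_trans Xa.
  by apply: size_flat_le => r; apply: size_al_conds.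
pose al := a ord0.
pose cs r := al_conds r ++ be_conds al r.
pose ext v (c : seq T -> K) := fun s : seq T => c (s ++ [:: v]).
have [|be [bK b0 bi]] := @exists_solutions K _ (words T (g - 1))
    (flatten [seq flatten [seq [seq ext v c | v <- enum T] | c <- cs r] | r <- rels])
    d (uniq_words T (g - 1)).
  rewrite size_words; apply: leq_trans Xb; rewrite leq_add2r.
  rewrite -mulnA; apply: size_flat_le => r; rewrite mulnC.
  apply: leq_trans (_ : size (cs r) * #|T| <= _)%N.
    by apply: size_flat_le => c; rewrite size_map -cardE.
  rewrite leq_mul2r; apply/orP; right; rewrite size_cat.
  have := size_al_conds r; have := size_be_conds al r; lia.
exists al, be => z; split.
- by move=> w; rewrite -mem_words; apply: a0.
- apply: contrapT => n; have := ai (fun _ => 1) _ ord0; move=> h.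
  suff /eqP : (1 : K) = 0 by rewrite oner_eq0.
  apply: h => t; rewrite big_ord1 mul1r; apply/eqP; apply: contrapT => /negP ht.
  by apply: n; exists t.
- by move=> c w; rewrite -mem_words; apply: b0.
- exact: bi.
move: aK => /(_ ord0)/allp_flatten/allp_map aK.
have bK' c v : allp (fun r => allp (sat (z c v)) (cs r)) rels.
  move: bK => /(_ c)/allp_flatten/allp_map; apply: allp_sub => r.
  move/allp_flatten/allp_map; apply: allp_sub => y /allp_map/allp_mem h.
  by apply/sat_tens1; apply: h; rewrite mem_enum.
have {}bK' : allp (fun r => forall c v, allp (sat (z c v)) (cs r)) rels.
  elim: (rels) bK' => //= r l IH h; split; first by move=> c v; case: (h c v).
  by apply: IH => c v; case: (h c v).
elim: (rels) rk aK bK' => //= -[k rho] l IH [/andP[/= k5 k7] rk] [aK aKl] [bK' bKl].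
split; last exact: IH.
have bk0 c v : allp (sat (z c v)) (al_conds (k, rho)) by case/allp_cat: (bK' c v).
have bk1 c v : allp (sat (z c v)) (be_conds al (k, rho)) by case/allp_cat: (bK' c v).
split.
- exact: al_conds_kills1.
- by move=> c v; apply: al_conds_kills1.
- by move=> c v; apply: conds_kills2.
Qed.
End Killers.

(** * States, replacement of letters, and embeddings *)

Lemma tev_cat_take (K : fieldType) (T : eqType) L (Z1 Z2 : seq (seq T -> K)) w :
  tev L (Z1 ++ Z2) w =
  tev L Z1 (take (L * size Z1) w) * tev L Z2 (drop (L * size Z1) w).
Proof.
elim: Z1 w => [|z Z1 IH] w /=; first by rewrite muln0 take0 eqxx mul1r drop0.
rewrite IH mulnS mulrA take_takel ?leq_addr //.
by rewrite addnC -take_drop drop_drop.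
Qed.

Lemma pairing_sum (K : fieldType) (T I : Type) (r : seq I) (c : I -> K)
    (f : I -> T -> K) ws :
  pairing (fun w => \sum_(i <- r) c i * f i w) ws = \sum_(i <- r) c i * pairing (f i) ws.
Proof.
rewrite /pairing; under eq_bigr do rewrite mulr_sumr.
rewrite exchange_big; apply: eq_bigr => i _; rewrite mulr_sumr.
by apply: eq_bigr => p _; ring.
Qed.

Lemma pairingZ (K : fieldType) (T : Type) (c : K) (f : T -> K) ws :
  pairing (fun w => c * f w) ws = c * pairing f ws.
Proof. by rewrite /pairing mulr_sumr; apply: eq_bigr => p _; rewrite mulrCA. Qed.

Lemma eq_pairing (K : fieldType) (T : eqType) (f f' : T -> K) ws :
  (forall p, p \in ws -> f p.2 = f' p.2) -> pairing f ws = pairing f' ws.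
Proof.
move=> h; rewrite /pairing big_seq [RHS]big_seq; apply: eq_bigr => p hp.
by rewrite h.
Qed.

Lemma rk_fin (K : fieldType) (I J : Type) (L : finType) A B (M : I -> J -> K)
    (H : L -> I -> K) (k : L -> J -> K) :
  (forall i j, A i -> B j -> M i j = \sum_l H l i * k l j) -> rk A B M #|L|.
Proof.
move=> e; exists (fun l => H (enum_val l)), (fun l => k (enum_val l)) => i j ai bj.
rewrite e // (reindex (@enum_val L predT)) //.
exact/onW_bij/enum_val_bij.
Qed.

(* For every o < L, the matrix with rows u of length o, columns (b, v) and entries
   f b (u ++ v) has rank at most n. *)
Definition pre_rk (K : fieldType) (B T : Type) L (f : B -> seq T -> K) n :=
  forall o, (o < L)%N -> rk (fun u : seq T => size u = o) (fun _ : B * seq T => True)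
    (fun u j => f j.1 (u ++ j.2)) n.

Definition suf_rk (K : fieldType) (B T : Type) L (f : B -> seq T -> K) n :=
  forall o, (o < L)%N -> rk (fun v : seq T => size v = o) (fun _ : B * seq T => True)
    (fun v j => f j.1 (j.2 ++ v)) n.

(* Each letter stands for a functional on the words of length len. *)
Record state (K : fieldType) := State {
  letters : finType;
  letter0 : letters;
  len : nat;
  word_of : letters -> seq 'I_2 -> K
}.

Section States.
Variable K : fieldType.
Implicit Types st : state K.

Definition ev st (s : seq (letters st)) := tev (len st) (map (@word_of K st) s).

Record valid st := Valid {
  len_gt0 : (0 < len st)%N;
  word_supp : forall a : letters st, supp (len st) (word_of a);
  word_indep : forall e : letters st -> K,
    (forall w, \sum_a e a * word_of a w = 0) -> forall a, e a = 0
}.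

(* For an element with coefficients ws: annihilation by all translates of all
   ev s, so that the elements killed by a state form a two-sided ideal. *)
Definition killed st (ws : seq (K * seq 'I_2)) :=
  forall (s : seq (letters st)) u v, pairing (fun w => ev s (u ++ w ++ v)) ws = 0.

Lemma ev_cat_take st (s t : seq (letters st)) w :
  ev (s ++ t) w = ev s (take (len st * size s) w) * ev t (drop (len st * size s) w).
Proof. by rewrite /ev map_cat tev_cat_take size_map. Qed.

Lemma ev_cat st (s t : seq (letters st)) w1 w2 : size w1 = (len st * size s)%N ->
  ev (s ++ t) (w1 ++ w2) = ev s w1 * ev t w2.
Proof. by move=> e; rewrite ev_cat_take take_size_cat // drop_size_cat. Qed.

Lemma ev1 st (a : letters st) w : valid st -> ev [:: a] w = word_of a w.
Proof. move=> v; exact/tev1/word_supp. Qed.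

Lemma ev_supp st (s : seq (letters st)) : valid st -> supp (len st * size s)%N (ev s).
Proof.
move=> v; elim: s => [|a s IH] w; first by rewrite muln0 size_eq0 /ev /= => /negPf ->.
rewrite /= mulnS; exact: (supp_tens (word_supp v a) IH).
Qed.

(** Tensor powers of independent functionals are independent: with the rest of the word fixed,
    independence of the letters isolates the first factor, and induction treats the remaining
    ones. *)
Lemma ev_indep st n (c : seq (letters st) -> K) : valid st ->
  (forall w, \sum_(s <- words (letters st) n) c s * ev s w = 0) ->
  forall s, size s = n -> c s = 0.
Proof.
move=> v; elim: n c => [|n IH] c h s.
  move/size0nil => ->; have := h [::]; rewrite big_seq1 /ev /= mulr1; exact.
case: s => // a s [sz].
apply: (IH (fun s => c (a :: s))) => // w2.
pose e b := \sum_(s <- words (letters st) n) c (b :: s) * ev s w2.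
apply: (word_indep v (e := e)) => w1.
case: (eqVneq (size w1) (len st)) => sw; last first.
  by rewrite big1 // => b _; rewrite (word_supp v) ?mulr0.
rewrite -[RHS](h (w1 ++ w2)) sum_words_cons.
apply: eq_bigr => b _; rewrite /e mulr_suml; apply: eq_bigr => t _.
by rewrite -[b :: t]cat1s ev_cat ?muln1 // ev1 // mulrAC mulrA.
Qed.

Section Composition.
Variables (st : state K) (B : finType) (b0 : B) (q : nat)
  (C : B -> seq (letters st) -> K).
Hypotheses (vst : valid st) (q0 : (0 < q)%N).

(* Each new letter is a combination of words of length q in the old letters;
   what the old state kills, the new one kills too. *)
Definition comp : state K :=
  State b0 (len st * q) (fun b w => \sum_(s <- words (letters st) q) C b s * ev s w).

Lemma comp_ev (S : seq B) w :
  @ev comp S w =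
  \sum_(s <- words (letters st) (q * size S)) tev q (map C S) s * ev s w.
Proof.
elim: S w => [|b S IH] w; first by rewrite muln0 big_seq1 /ev /= mul1r.
rewrite /= mulnS sum_words_cat.
have := @ev_cat_take comp [:: b] S w; rewrite cat1s muln1 => ->.
rewrite {1}/ev /= IH take_takel // [drop _ (take _ _)]drop_oversize; last first.
  by rewrite size_take; case: ltnP.
rewrite mulr1 mulr_suml big_seq [RHS]big_seq.
apply: eq_bigr => s; rewrite mem_words => /eqP ss.
rewrite mulr_sumr; apply: eq_bigr => t _.
rewrite take_size_cat // drop_size_cat // ev_cat_take ss; ring.
Qed.

Lemma comp_killed ws : killed st ws -> killed comp ws.
Proof.
move=> k S u v.
rewrite (eq_pairing (f' := fun w => \sum_(s <- words (letters st) (q * size S))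
   tev q (map C S) s * ev s (u ++ w ++ v))); last by move=> p _; rewrite comp_ev.
by rewrite pairing_sum big1 // => s _; rewrite k mulr0.
Qed.

Lemma comp_valid :
  (forall e : B -> K, (forall s, size s = q -> \sum_b e b * C b s = 0) ->
    forall b, e b = 0) -> valid comp.
Proof.
move=> Ci; split=> /=; first by rewrite muln_gt0 (len_gt0 vst).
  move=> b w sw; rewrite big1_seq // => s /andP[_]; rewrite mem_words => /eqP ss.
  by rewrite (ev_supp vst) ?mulr0 // ss.
move=> e he; apply: Ci => s ss.
apply: (ev_indep (c := fun s => \sum_b e b * C b s) vst _ ss) => w.
rewrite -[RHS](he w) /=; under eq_bigr do rewrite mulr_suml.
rewrite exchange_big /=; apply: eq_bigr => b _; rewrite mulr_sumr.
by apply: eq_bigr => t _; rewrite mulrA.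
Qed.

(** A cut at [o = len st * i + o0] falls within one inner letter, preceded by [i] others. Cutting
    the combination [C] after [i] letters costs the rank [n], and cutting the straddling letter
    costs the rank [m]. *)
Lemma comp_pre m n : pre_rk (len st) (@word_of K st) m -> pre_rk q C n ->
  pre_rk (len comp) (@word_of K comp) (n * m).
Proof.
move=> hP hC o /= ho.
have L0 := len_gt0 vst.
set i := (o %/ len st)%N; set o0 := (o %% len st)%N.
have oE : o = (len st * i + o0)%N by rewrite mulnC; exact: divn_eq.
have iq : (i < q)%N by rewrite ltn_divLR // mulnC.
have o0L : (o0 < len st)%N by apply: ltn_pmod.
have [h [k e]] := hC i iq; have [H [kap e']] := hP o0 o0L.
rewrite -[(n * m)%N](_ : #|{: 'I_n * 'I_m}| = _); last by rewrite card_prod !card_ord.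
pose HH (l : 'I_n * 'I_m) (u : seq 'I_2) :=
  (\sum_(s1 <- words (letters st) i) h l.1 s1 * ev s1 (take (len st * i) u)) *
  H l.2 (drop (len st * i) u).
pose KK (l : 'I_n * 'I_m) (j : B * seq 'I_2) :=
  \sum_a \sum_(s2 <- words (letters st) (q - i - 1))
    k l.1 (j.1, a :: s2) * kap l.2 (a, take (len st - o0) j.2) *
    ev s2 (drop (len st - o0) j.2).
apply: (@rk_fin _ _ _ _ _ _ _ HH KK) => u [b v] su _ /=.
have -> : words (letters st) q = words (letters st) (i + (q - i - 1).+1).
  by congr words; lia.
rewrite sum_words_cat big_seq.
have lu : (len st * i <= size u)%N by lia.
transitivity (\sum_(s1 <- words (letters st) i) ev s1 (take (len st * i) u) *
  \sum_(l : 'I_n * 'I_m) h l.1 s1 * H l.2 (drop (len st * i) u) * KK l (b, v)).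
  rewrite [RHS]big_seq; apply: eq_bigr => s1; rewrite mem_words => /eqP ss1.
  rewrite sum_words_cons mulr_sumr /KK /=.
  under [RHS]eq_bigr do rewrite mulr_sumr mulr_sumr.
  rewrite [RHS]exchange_big; apply: eq_bigr => a _ /=.
  under [RHS]eq_bigr do rewrite mulr_sumr mulr_sumr.
  rewrite [RHS]exchange_big; apply: eq_bigr => s2 _ /=.
  rewrite ev_cat_take ss1 -cat1s ev_cat_take muln1 ev1 //.
  rewrite takel_cat // drop_cat.
  have -> : (if (len st * i < size u)%N then drop (len st * i) u ++ v
     else drop (len st * i - size u) v) = drop (len st * i) u ++ v.
    case: ltnP => // h1; rewrite [drop _ u]drop_oversize //.
    by rewrite (_ : (_ - _)%N = 0%N) ?drop0 //; slia.
  set u0 := drop (len st * i) u; have su0 : size u0 = o0 by rewrite size_drop; lia.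
  rewrite take_cat drop_cat su0 ltnNge ltnW //=.
  rewrite (e s1 (b, a :: s2)) // (e' u0 (a, take (len st - o0) v)) //.
  rewrite mulrCA [X in _ * X]mulrA big_distrlr pair_big mulr_suml mulr_sumr; apply: eq_bigr => l _ /=; ring.
under [LHS]eq_bigr do rewrite mulr_sumr.
rewrite exchange_big; apply: eq_bigr => l _; rewrite /HH /=.
rewrite !mulr_suml; apply: eq_bigr => s1 _; ring.
Qed.

Lemma comp_suf m n : suf_rk (len st) (@word_of K st) m -> suf_rk q C n ->
  suf_rk (len comp) (@word_of K comp) (n * m).
Proof.
move=> hP hC o /= ho.
have L0 := len_gt0 vst.
set i := (o %/ len st)%N; set o0 := (o %% len st)%N.
have oE : o = (len st * i + o0)%N by rewrite mulnC; exact: divn_eq.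
have iq : (i < q)%N by rewrite ltn_divLR // mulnC.
have o0L : (o0 < len st)%N by apply: ltn_pmod.
have [h [k e]] := hC i iq; have [H [kap e']] := hP o0 o0L.
rewrite -[(n * m)%N](_ : #|{: 'I_n * 'I_m}| = _); last by rewrite card_prod !card_ord.
set r := (q - i - 1)%N.
have Lq : (len st * q = len st * r + (len st + len st * i))%N.
  by rewrite -mulnS -mulnDr; congr (_ * _)%N; rewrite /r; lia.
pose HH (l : 'I_n * 'I_m) (v : seq 'I_2) := H l.2 (take o0 v) *
  (\sum_(s2 <- words (letters st) i) h l.1 s2 * ev s2 (drop o0 v)).
(* The position of the cut is measured from the right, so the left part can be split into letters
   only when it has the complementary length; otherwise the matrix entry is 0. *)
pose KK (l : 'I_n * 'I_m) (j : B * seq 'I_2) :=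
  if size j.2 == (len st * q - o)%N then
  \sum_(s1 <- words (letters st) r) \sum_a
    k l.1 (j.1, s1 ++ [:: a]) * kap l.2 (a, drop (len st * r) j.2) *
    ev s1 (take (len st * r) j.2) else 0.
apply: (@rk_fin _ _ _ _ _ _ _ HH KK) => v [b u] sv _ /=.
case: (eqVneq (size u) (len st * q - o)%N) => su; last first.
  rewrite big1_seq ?big1 // => [l _|s /andP[_]].
    by rewrite /KK /= (negPf su) mulr0.
  rewrite mem_words => /eqP ss; rewrite (ev_supp vst) ?mulr0 // size_cat ss sv.
  by apply: contraNneq su => es; apply/eqP; slia.
have -> : words (letters st) q = words (letters st) (r + i.+1).
  by congr words; rewrite /r; lia.
set u1 := take (len st * r) u; set u0 := drop (len st * r) u.
set v0 := take o0 v; set v1 := drop o0 v.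
have su1 : size u1 = (len st * r)%N by rewrite size_takel; lia.
have su0 : size u0 = (len st - o0)%N by rewrite size_drop; lia.
have sv0 : size v0 = o0 by rewrite size_takel; lia.
rewrite sum_words_cat big_seq.
transitivity (\sum_(s1 <- words (letters st) r) \sum_a
   \sum_(s2 <- words (letters st) i) \sum_(l : 'I_n * 'I_m)
     (H l.2 v0 * (h l.1 s2 * ev s2 v1)) *
     (k l.1 (b, s1 ++ [:: a]) * kap l.2 (a, u0) * ev s1 u1)).
  rewrite [RHS]big_seq; apply: eq_bigr => s1; rewrite mem_words => /eqP ss1.
  rewrite sum_words_cons; apply: eq_bigr => a _.
  rewrite big_seq [RHS]big_seq; apply: eq_bigr => s2; rewrite mem_words => /eqP ss2.
  have -> : u ++ v = u1 ++ ((u0 ++ v0) ++ v1).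
    by rewrite -!catA (catA u1) !cat_take_drop.
  rewrite ev_cat ?su1 ?ss1 // -[a :: s2]cat1s ev_cat ?muln1 ?size_cat ?su0 ?sv0; last by lia.
  rewrite ev1 // catA (e s2 (b, s1 ++ [:: a])) // (e' v0 (a, u0)) //.
  transitivity ((\sum_l h l s2 * k l (b, s1 ++ [:: a])) *
    (\sum_l H l v0 * kap l (a, u0)) * (ev s1 u1 * ev s2 v1)); first by ring.
  rewrite big_distrlr pair_big mulr_suml; apply: eq_bigr => l _ /=; ring.
transitivity (\sum_(l : 'I_n * 'I_m) \sum_(s1 <- words (letters st) r) \sum_a
   \sum_(s2 <- words (letters st) i)
     (H l.2 v0 * (h l.1 s2 * ev s2 v1)) *
     (k l.1 (b, s1 ++ [:: a]) * kap l.2 (a, u0) * ev s1 u1)).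
  rewrite [RHS]exchange_big; apply: eq_bigr => s1 _ /=.
  rewrite [RHS]exchange_big; apply: eq_bigr => a _ /=.
  by rewrite [RHS]exchange_big.
apply: eq_bigr => l _; rewrite /KK /= su eqxx mulr_sumr; apply: eq_bigr => s1 _.
rewrite mulr_sumr; apply: eq_bigr => a _.
by rewrite -mulr_suml -mulr_sumr.
Qed.

End Composition.
End States.

Definition homog (K : fieldType) (T : eqType) (d : nat) (ws : seq (K * seq T)) :=
  forall p, p \in ws -> size p.2 = d.

Section Kills.
Variables (K : fieldType) (st : state K) (B : finType) (b0 : B) (q : nat)
  (C : B -> seq (letters st) -> K).
Hypotheses (vst : valid st) (q0 : (0 < q)%N).

(** Letters wholly covered by the translating words contribute scalars. Only translates shorter than
    one letter at each end matter, and for these the relation becomes a functional on words of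
    length [k] in the letters. *)
Lemma comp_kills d ws : homog d ws ->
  (forall k u v, (size u < len st)%N -> (size v < len st)%N ->
    (size u + d + size v)%N = (len st * k)%N ->
    forall (S : seq B) U V, \sum_(s <- words (letters st) k)
      pairing (fun w => ev s (u ++ w ++ v)) ws * tev q (map C S) (U ++ s ++ V) = 0) ->
  killed (comp b0 q C) ws.
Proof.
move=> hd hk S U V; have L0 := len_gt0 vst.
set N := (q * size S)%N.
rewrite (eq_pairing (f' := fun w => \sum_(s <- words (letters st) N)
   tev q (map C S) s * ev s (U ++ w ++ V))); last by move=> p _; rewrite comp_ev.
rewrite pairing_sum.
case: (eqVneq (size U + d + size V)%N (len st * N)%N) => e; last first.
  rewrite big1_seq // => s /andP[_]; rewrite mem_words => /eqP ss.
  rewrite /pairing big1_seq ?mulr0 // => p /andP[_ hp].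
  rewrite (ev_supp vst) ?mulr0 // !size_cat (hd p hp) ss addnA //.
set i := (size U %/ len st)%N; set i' := (size V %/ len st)%N.
have eU := divn_eq (size U) (len st); have eV := divn_eq (size V) (len st).
rewrite -/i mulnC in eU; rewrite -/i' mulnC in eV.
have lU := ltn_pmod (size U) L0; have lV := ltn_pmod (size V) L0.
have ii : (i + i' <= N)%N.
  by rewrite -(leq_pmul2l L0) -e mulnDr; lia.
pose k := (N - i - i')%N.
have -> : words (letters st) N = words (letters st) (i + (k + i')).
  by congr words; rewrite /k; lia.
pose U1 := take (len st * i) U; pose u := drop (len st * i) U.
pose v := take (size V %% len st) V; pose V1 := drop (size V %% len st) V.
have sU1 : size U1 = (len st * i)%N by rewrite size_takel; slia.
have su : size u = (size U %% len st)%N by rewrite size_drop; slia.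
have sv : size v = (size V %% len st)%N by rewrite size_takel; slia.
have sV1 : size V1 = (len st * i')%N by rewrite size_drop; slia.
have ek : (size u + d + size v)%N = (len st * k)%N.
  by rewrite su sv /k !mulnBr -e; slia.
rewrite sum_words_cat big1_seq // => s1 /andP[_]; rewrite mem_words => /eqP ss1.
rewrite sum_words_cat exchange_big big1 // => s3 _ /=.
transitivity (\sum_(s <- words (letters st) k) (ev s1 U1 * ev s3 V1) *
    (pairing (fun w => ev s (u ++ w ++ v)) ws * tev q (map C S) (s1 ++ s ++ s3))).
  rewrite big_seq [RHS]big_seq; apply: eq_bigr => s2; rewrite mem_words => /eqP ss2.
  rewrite mulrA mulrC; congr (_ * _).
  rewrite -pairingZ; apply: eq_pairing => p hp.
  rewrite -{1}(cat_take_drop (len st * i) U) -{1}(cat_take_drop (size V %% len st) V).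
  rewrite (_ : (take _ U ++ _) ++ _ = U1 ++ ((u ++ p.2 ++ v) ++ V1)); last by rewrite -!catA.
  rewrite ev_cat ?sU1 ?ss1 // ev_cat; first by ring.
  by rewrite !size_cat (hd p hp) su sv ss2 -ek su sv addnA.
by rewrite -mulr_sumr hk ?mulr0 // ?su ?sv.
Qed.

End Kills.

Section RelationRank.
Variables (K : fieldType) (st : state K).
Hypothesis vst : valid st.

(** Only the first and the last letter of [s] meet the translating words, and [1 < k] makes them
    distinct; factoring both cut letters leaves [m * n] functionals of [s]. Thus the conditions are
    counted by ranks and not by the number of translates. *)
Lemma relation_rk d ws m n k o o' : homog d ws ->
  pre_rk (len st) (@word_of K st) m -> suf_rk (len st) (@word_of K st) n ->
  (o < len st)%N -> (o' < len st)%N -> (1 < k)%N -> (o + d + o')%N = (len st * k)%N ->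
  rk (fun uv : seq 'I_2 * seq 'I_2 => size uv.1 = o /\ size uv.2 = o')
     (fun s : seq (letters st) => size s = k)
     (fun uv s => pairing (fun w => ev s (uv.1 ++ w ++ uv.2)) ws) (m * n).
Proof.
move=> hd hm hn lo lo' k1 e; have L0 := len_gt0 vst.
have [H [kap eH]] := hm o lo; have [H' [kap' eH']] := hn o' lo'.
rewrite -[(m * n)%N](_ : #|{: 'I_m * 'I_n}| = _); last by rewrite card_prod !card_ord.
set L := len st in lo lo' e *.
have eL : (L * k = L + (L * (k - 2) + L))%N.
  have {1}-> : k = (k - 2).+2 by lia.
  rewrite !mulnS; lia.
have {}e : (o + d + o')%N = (L + (L * (k - 2) + L))%N by rewrite e eL.
clear eL; set X := (L * (k - 2))%N in e *.
pose HH (l : 'I_m * 'I_n) (uv : seq 'I_2 * seq 'I_2) := H l.1 uv.1 * H' l.2 uv.2.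
pose KK (l : 'I_m * 'I_n) (s : seq (letters st)) := pairing (fun w : seq 'I_2 =>
  kap l.1 (head (letter0 st) s, take (L - o) w) *
  ev (take (k - 2) (behead s)) (take X (drop (L - o) w)) *
  kap' l.2 (last (letter0 st) s, drop X (drop (L - o) w))) ws.
apply: (@rk_fin _ _ _ _ _ _ _ HH KK) => -[u v] s /= [su sv] ss.
rewrite /KK -pairing_sum; apply: eq_pairing => p hp.
have sp := hd p hp; set w := p.2 in sp *.
case: s ss => [|a s]; first by slia.
case/lastP: s => [|s b]; first by slia.
rewrite /= size_rcons => ss.
set w1 := take (L - o) w; set w' := drop (L - o) w.
set wm := take X w'; set w2 := drop X w'.
have sw1 : size w1 = (L - o)%N by rewrite size_takel; slia.
have sw' : size w' = (X + (L - o'))%N by rewrite size_drop; slia.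
have swm : size wm = X by rewrite size_takel //; slia.
have sw2 : size w2 = (L - o')%N by rewrite size_drop; slia.
have es : size s = (k - 2)%N by lia.
rewrite last_rcons -cats1 take_size_cat //.
have -> : u ++ w ++ v = (u ++ w1) ++ (wm ++ (w2 ++ v)).
  by rewrite -{1}(cat_take_drop (L - o) w) -/w1 -/w' -{1}(cat_take_drop X w') -!catA.
rewrite -cat1s ev_cat ?muln1 ?size_cat; last by rewrite su sw1; slia.
rewrite ev_cat; last by rewrite swm es.
rewrite !ev1 // (eH u (a, w1)) // (eH' v (b, w2)) //.
transitivity ((\sum_l H l u * kap l (a, w1)) * (\sum_l H' l v * kap' l (b, w2)) *
  ev s wm); first by ring.
rewrite big_distrlr pair_big mulr_suml; apply: eq_bigr => l _ /=; rewrite /HH /=; ring.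
Qed.

End RelationRank.

Section Embeddings.
Variables (K : fieldType).
Implicit Types st : state K.

(* Makes the functionals of st1 vanish on whatever st2 kills; the lower bounds
   on dimensions rest on this. *)
Definition emb (st1 st2 : state K) :=
  (len st1 <= len st2)%N /\
  exists2 z : seq 'I_2 -> K,
    (exists2 u, size u = (len st2 - len st1)%N & z u != 0) &
    forall a : letters st1, exists b : letters st2, forall u w,
      size u = (len st2 - len st1)%N -> size w = len st1 ->
      word_of b (u ++ w) = z u * word_of a w.

Lemma emb_refl st1 : emb st1 st1.
Proof.
split=> //; exists (fun _ => 1); first by exists [::]; rewrite ?subnn ?oner_neq0.
by move=> a; exists a => u w; rewrite subnn => /size0nil ->; rewrite mul1r.
Qed.

Lemma emb_trans st1 st2 st3 : emb st1 st2 -> emb st2 st3 -> emb st1 st3.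
Proof.
case=> l12 [z [u su zu] hz] [l23 [z' [u' su' zu'] hz']].
split; first exact: leq_trans l23.
set n := (len st3 - len st2)%N in su' hz'.
exists (fun w => z' (take n w) * z (drop n w)).
  exists (u' ++ u); first by rewrite size_cat su su' /n; lia.
  by rewrite take_size_cat // drop_size_cat // mulf_neq0.
move=> a; have [b hb] := hz a; have [c hc] := hz' b; exists c => v w sv sw.
rewrite -{1}(cat_take_drop n v) -catA hc.
- by rewrite hb ?mulrA // size_drop sv /n; lia.
- by rewrite size_takel // sv /n; lia.
- by rewrite size_cat sw size_drop sv /n; lia.
Qed.

Section CompEmb.
Variables (st : state K) (B : finType) (b0 : B) (q : nat)
  (C : B -> seq (letters st) -> K).
Hypotheses (vst : valid st) (q0 : (0 < q)%N).

Lemma comp_emb : (exists2 z : seq (letters st) -> K,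
    (exists2 s, size s = (q - 1)%N & z s != 0) &
    forall a, exists b, forall s t, size s = (q - 1)%N ->
      C b (s ++ [:: t]) = z s * (t == a)%:R) ->
  emb st (comp b0 q C).
Proof.
case=> z [s0 ss0 zs0] hz; have L0 := len_gt0 vst.
have eL : (len st * q - len st = len st * (q - 1))%N by rewrite mulnBr muln1.
split; first by rewrite /= leq_pmulr.
rewrite /= eL.
exists (fun u => \sum_(s <- words (letters st) (q - 1)) z s * ev s u).
  apply: contrapT => n; move/eqP: zs0; apply; apply: (ev_indep vst _ ss0) => w.
  case: (eqVneq (size w) (len st * (q - 1))%N) => sw; last first.
    rewrite big1_seq // => s /andP[_]; rewrite mem_words => /eqP ss.
    by rewrite (ev_supp vst) ?mulr0 // ss.
  by apply/eqP; apply: contrapT => /negP h; apply: n; exists w.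
move=> a; have [b hb] := hz a; exists b => u w su sw.
have -> : words (letters st) q = words (letters st) ((q - 1) + 1) by congr words; lia.
rewrite sum_words_cat mulr_suml big_seq [RHS]big_seq.
apply: eq_bigr => s; rewrite mem_words => /eqP ss.
rewrite sum_words_cons (bigD1 a) //= big_seq1 big1 ?addr0.
  by rewrite hb // eqxx mulr1 ev_cat ?ss // ev1 // mulrA.
by move=> t ta; rewrite big_seq1 hb // (negPf ta) mulr0 mul0r.
Qed.

End CompEmb.
End Embeddings.

(** * Cut ranks of zones and of tensor products *)

Section CutRank.
Variables (K : fieldType) (T : finType).

Definition prk (B : Type) (f : B -> seq T -> K) o n :=
  rk (fun u : seq T => size u = o) (fun _ : B * seq T => True)
     (fun u j => f j.1 (u ++ j.2)) n.

Definition srk (B : Type) (f : B -> seq T -> K) o n :=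
  rk (fun v : seq T => size v = o) (fun _ : B * seq T => True)
     (fun v j => f j.1 (j.2 ++ v)) n.

Lemma rk_supp (I J : Type) (A : I -> Prop) (B : J -> Prop) (M : I -> J -> K) n :
  (forall i j, A i -> ~ B j -> M i j = 0) -> rk A B M n -> rk A (fun _ => True) M n.
Proof.
move=> M0 [H [k e]].
exists H, (fun l j => if `[< B j >] then k l j else 0) => i j ai _.
case: asboolP => bj; first exact: e.
by rewrite M0 // big1 // => l _; rewrite mulr0.
Qed.

(** The side of the cut with at most [gam] letters is enumerated: as rows if [o <= gam], and
    otherwise as columns, together with the index in [B]. *)
Lemma zone_rk (B : finType) (f : B -> seq T -> K) gam o (b : B) :
  (0 < #|T|)%N -> (forall b, supp (2 * gam)%N (f b)) ->
  prk f o (#|B| * #|T| ^ gam) /\ srk f o (#|B| * #|T| ^ gam).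
Proof.
move=> T0 fs; have B0 : (0 < #|B|)%N by apply/card_gt0P; exists b.
case: (leqP o gam) => ho.
  have h : (#|T| ^ o <= #|B| * #|T| ^ gam)%N.
    by apply: leq_trans (leq_pmull _ B0); rewrite leq_pexp2l.
  split; apply: (rk_leq h); rewrite -size_words; apply: rk_mem => w /eqP;
    by rewrite mem_words.
set n := (2 * gam - o)%N.
have h : (#|B| * #|T| ^ n <= #|B| * #|T| ^ gam)%N.
  by rewrite leq_mul2l leq_pexp2l ?orbT // /n; lia.
pose W := [seq (c, s) | c <- enum B, s <- words T n].
have sW : size W = (#|B| * #|T| ^ n)%N by rewrite size_allpairs size_words -cardE.
have key (M : seq T -> B * seq T -> K) :
    (forall w j, size w = o -> size j.2 != n -> M w j = 0) ->
    rk (fun w => size w = o) (fun _ => True) M (#|B| * #|T| ^ gam).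
  move=> M0; apply: (rk_leq h); rewrite -sW.
  apply: (@rk_supp _ _ _ (fun j : B * seq T => size j.2 = n)).
    by move=> w j sw /eqP; apply: M0.
  apply/rk_tr/rk_mem => -[c s] /= ss.
  by apply/allpairsP; exists (c, s); rewrite /= mem_enum mem_words ss eqxx.
split; apply: key => w [c s] sw /= ss; apply: fs; rewrite size_cat sw;
  by apply: contraNneq ss => e; apply/eqP; rewrite /n; slia.
Qed.

Lemma delta_rk (B : Type) (w0 : seq T) o :
  prk (fun _ : B => delta K w0) o 1 /\ srk (fun _ : B => delta K w0) o 1.
Proof.
split.
  exists (fun _ u => if (o <= size w0)%N then (u == take o w0)%:R else 0),
         (fun _ j => (j.2 == drop o w0)%:R) => u [b v] /= su _.
  rewrite big_ord1 /delta; case: leqP => h.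
    rewrite -{1}(cat_take_drop o w0) eqseq_cat ?size_takel //.
    by rewrite -natrM mulnb.
  by rewrite mul0r; case: eqP => // e; move: h; rewrite -e size_cat su ltnNge leq_addr.
exists (fun _ v => if (o <= size w0)%N then (v == drop (size w0 - o) w0)%:R else 0),
       (fun _ j => (j.2 == take (size w0 - o) w0)%:R) => v [b u] /= sv _.
rewrite big_ord1 /delta; case: leqP => h; last first.
  by rewrite mul0r; case: eqP => // e; move: h; rewrite -e size_cat sv ltnNge leq_addl.
case: (eqVneq (size u) (size w0 - o)%N) => su.
  rewrite -{1}(cat_take_drop (size w0 - o) w0) eqseq_cat ?size_takel ?leq_subr //.
  by rewrite mulrC -natrM mulnb.
case: eqP => [e|_].
  by exfalso; move/eqP: su; apply; rewrite -e size_cat sv addnK.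
have -> : (u == take (size w0 - o) w0) = false; last by rewrite mulr0.
by apply: contraNF su => /eqP ->; rewrite size_takel // leq_subr.
Qed.

Section TensRank.
Variables (B : finType) (b0 : B) (phi : seq T -> K) (psi : B -> seq T -> K) (m : nat).

Lemma tens_prk1 o n : (o <= m)%N -> prk (fun _ : unit => phi) o n ->
  prk (fun b => tens m phi (psi b)) o n.
Proof.
move=> om [H [k e]].
exists H, (fun l j => k l (tt, take (m - o) j.2) * psi j.1 (drop (m - o) j.2)).
move=> u [b v] su _ /=; rewrite /tens take_cat drop_cat su ltnNge om /=.
rewrite -[phi _]/(_) (e u (tt, take (m - o) v)) // mulr_suml.
by apply: eq_bigr => l _; rewrite mulrA.
Qed.

Lemma tens_prk2 o n : (m < o)%N -> prk psi (o - m) n ->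
  prk (fun b => tens m phi (psi b)) o n.
Proof.
move=> om [H [k e]].
exists (fun l u => phi (take m u) * H l (drop m u)), k => u [b v] su _ /=.
rewrite /tens takel_cat ?su ?(ltnW om) // drop_cat su om.
rewrite (e (drop m u) (b, v)) //; last by rewrite size_drop su.
by rewrite mulr_sumr; apply: eq_bigr => l _; rewrite mulrA.
Qed.

Variable p : nat.
Hypotheses (sphi : supp m phi) (spsi : forall b, supp p (psi b)).

Lemma tens_srk0 o n :
  rk (fun v : seq T => size v = o) (fun j : B * seq T => size j.2 = (m + p - o)%N)
     (fun v j => tens m phi (psi j.1) (j.2 ++ v)) n ->
  srk (fun b => tens m phi (psi b)) o n.
Proof.
apply: rk_supp => v [b u] sv su; apply: (supp_tens sphi (spsi b)).
by rewrite size_cat sv; apply/eqP => e; apply: su; slia.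
Qed.

Lemma tens_srk1 o n : (o <= p)%N -> srk psi o n ->
  srk (fun b => tens m phi (psi b)) o n.
Proof.
move=> op [H [k e]]; apply: tens_srk0.
exists H, (fun l j => phi (take m j.2) * k l (j.1, drop m j.2)) => v [b u] /= sv su.
rewrite /tens takel_cat; last by slia.
have -> : drop m (u ++ v) = drop m u ++ v.
  by rewrite -{1}(cat_take_drop m u) -catA drop_size_cat // size_takel //; slia.
rewrite (e v (b, drop m u)) // mulr_sumr; apply: eq_bigr => l _ /=; ring.
Qed.

(** The suffix contains all of [psi b], but a row does not know which [b] is meant. The index [b]
    has to be carried through the factorization, whence the factor [#|B|]. *)
Lemma tens_srk2 o n : (p < o)%N -> srk (fun _ : unit => phi) (o - p) n ->
  srk (fun b => tens m phi (psi b)) o (n * #|B|).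
Proof.
move=> op [H [k e]]; apply: tens_srk0.
rewrite -[(n * #|B|)%N](_ : #|{: 'I_n * B}| = _); last by rewrite card_prod !card_ord.
apply: (@rk_fin _ _ _ _ _ _ _
  (fun (l : 'I_n * B) v => H l.1 (take (o - p) v) * psi l.2 (drop (o - p) v))
  (fun l j => k l.1 (tt, j.2) * (j.1 == l.2)%:R)) => v [b u] /= sv su.
transitivity (phi (u ++ take (o - p) v) * psi b (drop (o - p) v)).
  case: (leqP o (m + p)) => h; last first.
    rewrite (supp_tens sphi (spsi b)) ?sphi ?mul0r // size_cat ?size_takel ?sv;
      by [apply/eqP; slia | apply/eqP; slia | slia].
  rewrite /tens -{1 2}(cat_take_drop (o - p) v) !catA.
  have st : size (u ++ take (o - p) v) = m by rewrite size_cat size_takel ?sv; slia.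
  by rewrite take_size_cat // drop_size_cat.
rewrite (e (take (o - p) v) (tt, u)) //; last first.
  by rewrite size_takel // sv leq_subr.
rewrite -(pair_bigA _ (fun l c => H l (take (o - p) v) * psi c (drop (o - p) v) *
   (k l (tt, u) * (b == c)%:R))) /= mulr_suml; apply: eq_bigr => l _.
rewrite (bigD1 b) //= eqxx mulr1 big1 ?addr0; first by ring.
by move=> c cb; rewrite eq_sym (negPf cb) !mulr0.
Qed.

End TensRank.
End CutRank.

(** * Killing one level *)

Section KillWord.
Variables (K : fieldType) (T : finType) (x : T) (s0 gam : nat).
Local Notation g := (2 * gam)%N.
Local Notation s := (s0 + g)%N.
Variables (B : finType) (b0 : B) (al : seq T -> K) (z : B -> seq T -> K).
Hypotheses (sal : supp g al) (sz : forall b, supp g (z b)).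
Local Notation hblock := (@half_block K T x s0).

(* Two half-blocks, each a long run of the letter x followed by a short zone of
   length g; as s = 4 u and 2 gam <= u in the applications, a window of length
   between 5 u and 7 u + 1 meets one or two zones, and contains one of them. *)
Definition kill_word (b : B) := tens s (hblock al) (hblock (z b)).

Lemma kill_word_supp b : supp (s * 2)%N (kill_word b).
Proof. by rewrite muln2 -addnn; apply: supp_tens; apply: half_block_supp. Qed.

Lemma half_block_rk (A : finType) (a0 : A) (y : A -> seq T -> K) o : (o <= s)%N ->
  (forall a, supp g (y a)) ->
  prk (fun a => hblock (y a)) o (#|A| * #|T| ^ gam) /\
  srk (fun a => hblock (y a)) o (#|A| * #|T| ^ gam).
Proof.
move=> os sy; have T0 : (0 < #|T|)%N by apply/card_gt0P; exists x.
have A0 : (0 < #|A|)%N by apply/card_gt0P; exists a0.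
have n0 : (0 < #|T| ^ gam)%N by rewrite expn_gt0 T0.
have sd : supp s0 (delta K (nseq s0 x)).
  by have := @supp_delta K _ (nseq s0 x); rewrite size_nseq.
split.
  case: (leqP o s0) => h.
    apply: (@rk_leq _ _ _ _ _ _ 1); first by rewrite muln_gt0 A0.
    by apply: tens_prk1 => //; case: (@delta_rk K T unit (nseq s0 x) o).
  by apply: tens_prk2 => //; case: (@zone_rk K T A y gam (o - s0) a0 T0 sy).
case: (leqP o g) => h.
  by apply: (tens_srk1 sd sy) => //; case: (@zone_rk K T A y gam o a0 T0 sy).
apply: (@rk_leq _ _ _ _ _ _ (1 * #|A|)); first by rewrite mul1n leq_pmulr.
by apply: (tens_srk2 sd sy) => //; case: (@delta_rk K T unit (nseq s0 x) (o - g)).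
Qed.

Lemma kill_word_rk :
  pre_rk (s * 2) kill_word (#|B| * #|T| ^ gam) /\
  suf_rk (s * 2) kill_word (#|B| * #|T| ^ gam).
Proof.
have T0 : (0 < #|T|)%N by apply/card_gt0P; exists x.
have B0 : (0 < #|B|)%N by apply/card_gt0P; exists b0.
have sh := half_block_supp x sal; have shz b := half_block_supp x (sz b).
have ha o : (o <= s)%N -> prk (fun _ : unit => hblock al) o (#|T| ^ gam) /\
    srk (fun _ : unit => hblock al) o (#|T| ^ gam).
  move=> os; have := @half_block_rk _ tt (fun _ => al) o os (fun _ => sal).
  by rewrite card_unit mul1n.
have hz o : (o <= s)%N -> prk (fun b => hblock (z b)) o (#|B| * #|T| ^ gam) /\
    srk (fun b => hblock (z b)) o (#|B| * #|T| ^ gam).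
  by move=> os; apply: half_block_rk.
split=> o oq; [change (prk kill_word o (#|B| * #|T| ^ gam)) |
               change (srk kill_word o (#|B| * #|T| ^ gam))].
  case: (leqP o s) => h.
    apply: (@rk_leq _ _ _ _ _ _ (#|T| ^ gam)); first by rewrite leq_pmull.
    by apply: (@tens_prk1 _ _ _ (hblock al) (fun b => hblock (z b))) => //; case: (ha o h).
  apply: (@tens_prk2 _ _ _ (hblock al) (fun b => hblock (z b))) => //; have h' : (o - s <= s)%N by lia.
  by case: (hz (o - s)%N h').
case: (leqP o s) => h.
  by apply: (@tens_srk1 _ _ _ (hblock al) (fun b => hblock (z b)) s s) => //; case: (hz o h).
rewrite mulnC; have h' : (o - s <= s)%N by lia.
by apply: (@tens_srk2 _ _ _ (hblock al) (fun b => hblock (z b)) s s) => //; case: (ha (o - s)%N h').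
Qed.

Lemma kill_word_indep : (exists t, al t != 0) ->
  (forall e : B -> K, (forall t, \sum_b e b * z b t = 0) -> forall b, e b = 0) ->
  forall e : B -> K, (forall w, size w = (s * 2)%N -> \sum_b e b * kill_word b w = 0) ->
    forall b, e b = 0.
Proof.
move=> [t at0] zi e h; apply: zi => t'.
case: (eqVneq (size t') g) => st'; last first.
  by rewrite big1 // => b _; rewrite sz ?mulr0.
have st : size t = g by apply/eqP; apply: contraT => /sal e0; rewrite e0 eqxx in at0.
have hs : size ((nseq s0 x ++ t) ++ (nseq s0 x ++ t')) = (s * 2)%N.
  by rewrite !size_cat size_nseq st st'; lia.
have h' := h _ hs.
apply: (mulfI at0); rewrite mulr0 -[RHS]h' mulr_sumr; apply: eq_bigr => b _.
rewrite /kill_word tens_cat ?size_cat ?size_nseq ?st //.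
rewrite /half_block !tens_cat ?size_nseq // /delta eqxx !mul1r; ring.
Qed.

(** [None] stands for the fixed zone [al], and [Some b] for the varying zone of the letter [b]. *)
Definition zones (S : seq B) : seq (option B) :=
  flatten [seq [:: None; Some b] | b <- S].

Definition zone (a : option B) := if a is Some b then z b else al.

Lemma zone_supp a : supp g (zone a).
Proof. by case: a. Qed.

Lemma kill_word_flat S w :
  tev (s * 2) (map kill_word S) w = tev s (map (fun a => hblock (zone a)) (zones S)) w.
Proof.
elim: S w => //= b S IH w.
rewrite -[flatten _]/(zones S) drop_drop (_ : (s + s)%N = (s * 2)%N); last by lia.
rewrite -IH mulrA; congr (_ * _).
by rewrite /kill_word /tens take_takel ?take_drop; [congr (_ * hblock _ (drop _ (take _ _))) |]; lia.
Qed.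

End KillWord.

Section ExistsKill.
Variables (K : fieldType) (st : state K) (m n u gam d : nat).
Local Notation T := (letters st).
Local Notation L := (len st).
Local Notation g := (2 * gam)%N.
Local Notation s0 := (4 * u - g)%N.
Hypotheses (vst : valid st) (hm : pre_rk L (@word_of K st) m)
  (hn : suf_rk L (@word_of K st) n).
Hypotheses (gam0 : (0 < gam)%N) (gu : (g <= u)%N) (D1 : (1 < #|T|)%N).

(** The finite list [rels] replaces the relation at all left offsets below [N]: any [Psi] it
    annihilates is annihilated by the functionals that the translates of the relation induce on
    words in the letters. *)
Definition controls (rels : seq (nat * (seq T -> K))) (f : nat * seq (K * seq 'I_2)) N :=
  forall k a b, (size a < N)%N -> (size b < L)%N -> (size a + f.1 + size b)%N = (L * k)%N ->
  forall Psi : seq T -> K,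
  allp (fun r => \sum_(s <- words T r.1) r.2 s * Psi s = 0) rels ->
  \sum_(s <- words T k) pairing (fun w => ev s (a ++ w ++ b)) f.2 * Psi s = 0.

Definition good_rel (f : nat * seq (K * seq 'I_2)) :=
  homog f.1 f.2 /\ (5 * u * L < f.1 < 7 * u * L)%N.

Lemma exists_controls1 f N : good_rel f -> (N <= L)%N ->
  exists rels, [/\ (size rels <= N * (m * n))%N,
    allp (fun r => (5 * u <= r.1 <= 7 * u + 1)%N) rels & controls rels f N].
Proof.
case: f => e ws [/= hw /andP[e5 e7]]; have L0 := len_gt0 vst.
have u0 : (0 < u)%N by lia.
elim: N => [|N IH] NL; first by exists [::]; split.
have [rels [sr rr cr]] := IH (ltnW NL).
(* The left offset determines the right one: [o'] is the only offset below L that completes the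
   window to a whole number [k] of letters. *)
pose o' := ((L - (N + e) %% L) %% L)%N; pose k := ((N + e + o') %/ L)%N.
have lo' : (o' < L)%N by apply: ltn_pmod.
have ek : (N + e + o')%N = (L * k)%N.
  rewrite mulnC /k divnK // /o' /dvdn -modnDml; apply/eqP.
  have := ltn_pmod (N + e) L0; set a := ((N + e) %% L)%N => al.
  case: (posnP a) => [->|a0]; first by rewrite subn0 modnn addn0 mod0n.
  by rewrite [((L - a) %% L)%N]modn_small ?subnKC ?modnn //; lia.
(* Two offsets add less than 2 L to a degree below 7 u L, so k < 7 u + 2. This is the origin of the
   bound 7 u + 1. *)
have k57 : (5 * u <= k <= 7 * u + 1)%N.
  apply/andP; split.
    have : (5 * u * L < k * L)%N by rewrite [(k * L)%N]mulnC -ek; lia.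
    by rewrite ltn_pmul2r // => /ltnW.
  have : (k * L < (7 * u + 2) * L)%N.
    by rewrite [(k * L)%N]mulnC -ek mulnDl; lia.
  by rewrite ltn_pmul2r // addn2 addn1 ltnS.
have k1 : (1 < k)%N by case/andP: k57 => h _; apply: leq_trans h; lia.
have [H [kk eHk]] := relation_rk vst hw hm hn NL lo' k1 ek.
exists (rels ++ [seq (k, kk l) | l <- enum 'I_(m * n)]); split.
- by rewrite size_cat size_map size_enum_ord mulSn addnC leq_add2l.
- by apply/allp_cat; split=> //; apply/allp_map/allp_mem.
move=> k' a b; rewrite ltnS leq_eqVlt => /orP[/eqP sa|sa] sb e' Psi /allp_cat[hr hk]; last first.
  exact: (cr k' a b).
have sb' : size b = o'.
  rewrite /o'; move: e'; rewrite /= sa => e'.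
  have h1 : (L %| N + e + size b)%N by rewrite e' dvdn_mulr.
  have h2 : (L %| N + e + o')%N by rewrite ek dvdn_mulr.
  apply/eqP; rewrite -/o' -[size b](modn_small sb) -[o'](modn_small lo') -(eqn_modDl (N + e)).
  by move: h1 h2; rewrite /dvdn => /eqP -> /eqP ->.
have ekk : k' = k.
  by apply/eqP; rewrite -(eqn_pmul2l L0) -ek -e' sa sb'.
rewrite {}ekk in e' *.
transitivity (\sum_l H l (a, b) * \sum_(s <- words T k) kk l s * Psi s).
  under [RHS]eq_bigr do rewrite mulr_sumr.
  rewrite [RHS]exchange_big big_seq [RHS]big_seq; apply: eq_bigr => s.
  rewrite mem_words => /eqP ss /=.
  have := eHk (a, b) s (conj sa sb') ss; rewrite /= => ->.
  by rewrite mulr_suml; apply: eq_bigr => l _; rewrite mulrA.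
rewrite big1 // => l _; move/allp_map/allp_mem: hk => /(_ l) /= ->; first by rewrite mulr0.
by rewrite mem_enum.
Qed.

Lemma exists_controls fs : allp good_rel fs ->
  exists rels, [/\ (size rels <= size fs * (L * (m * n)))%N,
    allp (fun r => (5 * u <= r.1 <= 7 * u + 1)%N) rels &
    allp (fun f => controls rels f L) fs].
Proof.
elim: fs => [|f fs IH] /=; first by exists [::]; split.
case=> gf /IH[rels [sr rr cr]].
have [rels' [sr' rr' cr']] := exists_controls1 gf (leqnn L).
exists (rels' ++ rels); split.
- by rewrite size_cat mulSn leq_add.
- exact/allp_cat.
split=> [k a b sa sb e Psi /allp_cat[h _]|]; first exact: cr'.
apply: allp_sub cr => f' h k a b sa sb e Psi /allp_cat[_ h']; exact: h.
Qed.

Definition kill_state (al : seq T -> K) (z : 'I_d.+1 * T -> seq T -> K) : state K :=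
  comp (ord0, letter0 st) ((s0 + g) * 2) (kill_word (letter0 st) s0 gam al z).

(** Any two neighbouring zones thus include [al] exactly once, so the conditions linear in the other
    zone suffice. *)
Lemma zones_alt (B : finType) (S : seq B) Z1 (a b : option B) Z2 :
  zones S = Z1 ++ a :: b :: Z2 -> isSome a != isSome b.
Proof.
move=> e; pose r (a b : option B) := isSome a != isSome b.
have h c : isSome c -> path r c (zones S).
  elim: (S) c => //= b' S' IH c cs; rewrite {1 2}/r cs /=; exact: IH.
case: S e h => [|b' S] e; first by move/(congr1 size): e; rewrite size_cat /=; lia.
by move=> /(_ (Some b') isT); rewrite e cat_path /= => /and4P[].
Qed.

Lemma exists_kill fs (X := (size fs * (L * (m * n)))%N) : allp good_rel fs ->
  (X * (8 * u + 2 * #|T| ^ gam) < #|T| ^ g)%N ->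
  (X * #|T| * (24 * u + 10 * #|T| ^ gam) + d.+1 <= #|T| ^ (g - 1))%N ->
  exists (al : seq T -> K) (be : 'I_d.+1 -> seq T -> K),
    let z b := tens (g - 1)%N (be b.1) (delta K [:: b.2]) in
    [/\ supp g al, exists t, al t != 0, forall c, supp (g - 1)%N (be c),
        forall e : 'I_d.+1 -> K, (forall t, \sum_c e c * be c t = 0) ->
          forall c, e c = 0 &
        allp (fun f => killed (kill_state al z) f.2) fs].
Proof.
move=> gf Xa Xb; have [rels [sr rr cr]] := exists_controls gf.
have [||al [be [sal al0 sbe bei ker]]] := @exists_killers K T (letter0 st) u gam
    gam0 gu D1 rels d.+1 rr.
- by apply: leq_ltn_trans Xa; rewrite leq_mul2r sr orbT.
- apply: leq_trans Xb; by rewrite leq_add2r leq_mul // leq_mul.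
exists al, be => z; split=> //.
have sz b : supp g (z b).
  rewrite (_ : g = (g - 1 + 1)%N); last by lia.
  by apply: supp_tens => //; apply: (@supp_delta K T [:: b.2]).
have s4 : (s0 + g)%N = (4 * u)%N by lia.
move: (cr) (gf); elim: (fs) => //= f fs' IH [crf crf'] [[hf _] gf']; split; last exact: IH.
apply: (comp_kills vst _ hf); first by lia.
move=> k a b sa sb e S U V; apply: (crf k a b sa sb e (fun s => tev _ _ (U ++ s ++ V))).
elim: (rels) rr ker => //= -[k' rho] rels' IH' [kr rr'] [[k1 k2 k3] ker']; split; last exact: IH'.
under eq_bigr do rewrite kill_word_flat.
have g0 : (0 < g)%N by lia.
apply: (windows_killed s4 gu g0 (zone_supp sal sz)) => //=.
  by case=> [[c v]|] //=; apply: k2.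
move=> Z1 [[c v]|] [[c' v']|] Z3 /zones_alt //= _.
  by case: (k3 c v).
by case: (k3 c' v').
Qed.

End ExistsKill.

Lemma indep_neq0 (K : fieldType) (T : Type) d (be : 'I_d.+1 -> T -> K) i :
  (forall e : 'I_d.+1 -> K, (forall t, \sum_c e c * be c t = 0) -> forall c, e c = 0) ->
  exists t, be i t != 0.
Proof.
move=> h; apply: contrapT => n.
suff e : forall t, \sum_c (c == i)%:R * be c t = 0.
  by have := h _ e i; rewrite eqxx => /eqP; rewrite oner_eq0.
move=> t; rewrite (bigD1 i) //= eqxx mul1r big1 ?addr0; last first.
  by move=> c /negPf ->; rewrite mul0r.
by apply/eqP; apply: contrapT => /negP ht; apply: n; exists t.
Qed.

(* The functionals of the letters share a common left factor z, and the right
   factors, of degree N, are independent. *)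
Definition has_half (K : fieldType) (st : state K) N :=
  (N <= len st)%N /\
  exists Q : letters st -> seq 'I_2 -> K,
    (forall e : letters st -> K,
       (forall w, size w = N -> \sum_a e a * Q a w = 0) -> forall a, e a = 0) /\
    exists2 z : seq 'I_2 -> K,
      (exists2 u, size u = (len st - N)%N & z u != 0) &
      forall a u w, size u = (len st - N)%N -> size w = N ->
        word_of a (u ++ w) = z u * Q a w.

Lemma ev_comb_neq0 (K : fieldType) (st : state K) n (c : seq (letters st) -> K) s :
  valid st -> size s = n -> c s != 0 ->
  exists2 u, size u = (len st * n)%N & \sum_(s <- words (letters st) n) c s * ev s u != 0.
Proof.
move=> vst ss cs; apply: contrapT => h; move/eqP: cs; apply.
apply: (ev_indep vst _ ss) => w.
case: (eqVneq (size w) (len st * n)%N) => sw; last first.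
  rewrite big1_seq // => t /andP[_]; rewrite mem_words => /eqP st'.
  by rewrite (ev_supp vst) ?mulr0 // st'.
by apply/eqP; apply: contrapT => /negP n0; apply: h; exists w.
Qed.

Section KillState.
Variables (K : fieldType) (st : state K) (m n u gam d : nat).
Local Notation T := (letters st).
Local Notation L := (len st).
Local Notation g := (2 * gam)%N.
Local Notation s0 := (4 * u - g)%N.
Local Notation s := (s0 + g)%N.
Local Notation x := (letter0 st).
Hypotheses (vst : valid st) (hm : pre_rk L (@word_of K st) m)
  (hn : suf_rk L (@word_of K st) n).
Hypotheses (gam0 : (0 < gam)%N) (gu : (g <= u)%N).
Variables (al : seq T -> K) (be : 'I_d.+1 -> seq T -> K).
Let z (b : 'I_d.+1 * T) := tens (g - 1)%N (be b.1) (delta K [:: b.2]).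
Hypotheses (sal : supp g al) (al0 : exists t, al t != 0)
  (sbe : forall c, supp (g - 1)%N (be c))
  (bei : forall e : 'I_d.+1 -> K, (forall t, \sum_c e c * be c t = 0) ->
          forall c, e c = 0).
Local Notation st' := (@kill_state K st u gam d al z).

Lemma z_supp b : supp g (z b).
Proof.
have -> : g = (g - 1 + 1)%N by lia.
by apply: supp_tens => //; apply: (@supp_delta K T [:: b.2]).
Qed.

Lemma z_indep (e : 'I_d.+1 * T -> K) :
  (forall t, \sum_b e b * z b t = 0) -> forall b, e b = 0.
Proof.
move=> h [c v]; apply: (bei (e := fun c => e (c, v))) => t.
case: (eqVneq (size t) (g - 1)%N) => stt; last first.
  by rewrite big1 // => c' _; rewrite sbe ?mulr0.
transitivity (\sum_c \sum_v' e (c, v') * z (c, v') (t ++ [:: v])); last first.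
  by rewrite pair_bigA -[RHS](h (t ++ [:: v])); apply: eq_bigr => -[].
apply: eq_bigr => c' _ /=; rewrite (bigD1 v) //= big1 ?addr0.
  by rewrite /z tens_cat // /delta eqxx mulr1.
by move=> v' v'v; rewrite /z tens_cat // /delta eqseq_cons eq_sym (negPf v'v) !mulr0.
Qed.

Let q0 : (0 < s * 2)%N. Proof. by lia. Qed.
Let s4 : s = (4 * u)%N. Proof. by lia. Qed.

Lemma kill_state_valid : valid st'.
Proof.
apply: comp_valid => // e he; apply: (kill_word_indep sal z_supp al0 z_indep) => w sw.
exact: he.
Qed.

Lemma kill_state_rk : pre_rk (len st') (@word_of K st') (d.+1 * #|T| * #|T| ^ gam * m) /\
  suf_rk (len st') (@word_of K st') (d.+1 * #|T| * #|T| ^ gam * n).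
Proof.
have [h1 h2] := kill_word_rk x s0 (ord0, x) sal z_supp.
move: h1 h2; rewrite card_prod card_ord => h1 h2.
by split; [apply: comp_pre | apply: comp_suf].
Qed.

(** The new letter [(ord0, a)] ends with the old letter [a]. All that precedes it, built from [al]
    and [be ord0], is the same for every [a] and is nonzero. *)
Lemma kill_state_emb : emb st st'.
Proof.
have [t at0] := al0; have [t' bt0] := indep_neq0 ord0 bei.
have stt : size t = g by apply/eqP; apply: contraT => /sal e0; rewrite e0 eqxx in at0.
have stt' : size t' = (g - 1)%N.
  by apply/eqP; apply: contraT => /sbe e0; rewrite e0 eqxx in bt0.
apply: comp_emb => //.
pose y r := half_block x s0 al (take s r) * (delta K (nseq s0 x) (take s0 (drop s r)) *
  be ord0 (drop s0 (drop s r))).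
exists y.
  exists ((nseq s0 x ++ t) ++ (nseq s0 x ++ t')).
    rewrite !size_cat size_nseq stt stt'; lia.
  rewrite /y take_size_cat ?size_cat ?size_nseq ?stt // drop_size_cat; last first.
    by rewrite size_cat size_nseq stt.
  rewrite take_size_cat ?size_nseq // drop_size_cat ?size_nseq //.
  by rewrite /half_block tens_cat ?size_nseq // /delta !eqxx !mul1r mulf_neq0.
move=> a; exists (ord0, a) => r v sr.
rewrite /kill_word -{1}(cat_take_drop s r) -catA tens_cat; last by rewrite size_takel; slia.
rewrite /y -mulrA; congr (_ * _).
rewrite -{1}(cat_take_drop s0 (drop s r)) -catA /half_block tens_cat; last first.
  by rewrite size_takel // size_drop sr; slia.
rewrite -mulrA; congr (_ * _).
rewrite /z tens_cat; last by rewrite !size_drop; slia.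
by rewrite /delta eqseq_cons andbT.
Qed.

Lemma kill_state_half : has_half st' (L * s).
Proof.
have eL : (len st' - L * s)%N = (L * s)%N by rewrite /= -mulnBr; congr (_ * _)%N; lia.
split; first by rewrite /= leq_mul2l; apply/orP; right; lia.
have [t at0] := al0.
have stt : size t = g by apply/eqP; apply: contraT => /sal e0; rewrite e0 eqxx in at0.
exists (fun b w => \sum_(r <- words T s) half_block x s0 (z b) r * ev r w); split.
  move=> e he; apply: z_indep => t'.
  case: (eqVneq (size t') g) => stt'; last first.
    by rewrite big1 // => b _; rewrite z_supp ?mulr0.
  have : \sum_b e b * half_block x s0 (z b) (nseq s0 x ++ t') = 0.
    apply: (ev_indep (c := fun r => \sum_b e b * half_block x s0 (z b) r) vst (n := s)); last first.
      by rewrite size_cat size_nseq stt'.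
    move=> w; case: (eqVneq (size w) (L * s)%N) => sw; last first.
      rewrite big1_seq // => r /andP[_]; rewrite mem_words => /eqP sr.
      by rewrite (ev_supp vst) ?mulr0 // sr.
    rewrite -[RHS](he w sw) /=; under eq_bigr do rewrite mulr_suml.
    rewrite exchange_big; apply: eq_bigr => b _; rewrite mulr_sumr.
    by apply: eq_bigr => r _; rewrite mulrA.
  move=> h; rewrite -[RHS]h; apply: eq_bigr => b _; congr (_ * _).
  by rewrite /half_block tens_cat ?size_nseq // /delta eqxx mul1r.
rewrite eL; exists (fun w => \sum_(r <- words T s) half_block x s0 al r * ev r w).
  apply: (ev_comb_neq0 (s := nseq s0 x ++ t) vst); first by rewrite size_cat size_nseq stt.
  by rewrite /half_block tens_cat ?size_nseq // /delta eqxx mul1r.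
move=> b v w sv sw /=.
have -> : words T (s * 2) = words T (s + s) by congr words; lia.
rewrite sum_words_cat big_distrlr /= big_seq [RHS]big_seq.
apply: eq_bigr => r; rewrite mem_words => /eqP sr; apply: eq_bigr => r' _.
by rewrite /kill_word tens_cat // ev_cat ?sr //; ring.
Qed.

End KillState.

(** * Spreading *)

Section Spread.
Variables (K : fieldType) (st : state K) (h : nat).
Local Notation T := (letters st).
Local Notation L := (len st).
Local Notation x := (letter0 st).
Hypotheses (vst : valid st) (h0 : (0 < h)%N).

(* Padding with one letter keeps the growth polynomial up to the next level: a
   window shorter than a block has at most one letter other than x. *)
Definition spread_word (a : T) := nseq h.-1 x ++ [:: a].

Definition spread : state K := comp x h (fun a => delta K (spread_word a)).

Lemma size_spread_word a : size (spread_word a) = h.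
Proof. by rewrite size_cat size_nseq addn1 prednK. Qed.

Lemma word_of_spread a w : @word_of K spread a w = ev (spread_word a) w.
Proof.
rewrite /= (@sum_words1 _ _ h _ (spread_word a)) ?size_spread_word //.
  by rewrite /delta eqxx mul1r.
by move=> s _ /negPf ns; rewrite /delta ns mul0r.
Qed.

Lemma spread_valid : valid spread.
Proof.
apply: comp_valid => // e he b.
rewrite -[LHS](_ : \sum_a e a * delta K (spread_word a) (spread_word b) = _).
  by rewrite he // size_spread_word.
rewrite (bigD1 b) //= {1}/delta eqxx mulr1 big1 ?addr0 // => a ab.
rewrite /delta /spread_word eqseq_cat // eqxx /= eqseq_cons andbT eq_sym.
by rewrite (negPf ab) mulr0.
Qed.

Lemma spread_pre n : pre_rk L (@word_of K st) n ->
  pre_rk (len spread) (@word_of K spread) n.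
Proof.
move=> hn; rewrite -[n]mul1n; apply: comp_pre => // o oh.
exists (fun _ u => (u == nseq o x)%:R),
       (fun _ j => (j.2 == nseq (h.-1 - o) x ++ [:: j.1])%:R) => u [a v] /= su _.
rewrite big_ord1 /delta /spread_word.
have -> : nseq h.-1 x = nseq o x ++ nseq (h.-1 - o) x.
  by rewrite -nseqD; congr nseq; lia.
by rewrite -catA eqseq_cat ?size_nseq // -natrM mulnb.
Qed.

(** A nonempty suffix contains the distinguished letter, which the row must guess among [#|T|]
    possibilities. A proper prefix contains only padding, so its rank does not grow. *)
Lemma spread_suf n : suf_rk L (@word_of K st) n ->
  suf_rk (len spread) (@word_of K spread) (#|T| * n).
Proof.
move=> hn; apply: comp_suf => // o oh.
have T0 : (0 < #|T|)%N by apply/card_gt0P; exists x.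
case: (posnP o) => o0.
  apply: (rk_leq T0).
  exists (fun _ _ => 1), (fun _ j => (j.2 == spread_word j.1)%:R) => u [a v] /= su _.
  by rewrite big_ord1 mul1r; move: su; rewrite o0 => /size0nil ->; rewrite cats0.
apply: (@rk_fin _ _ _ _ _ _ _ (fun (l : T) v => (v == nseq o.-1 x ++ [:: l])%:R)
  (fun l j => (j.2 == nseq (h - o) x)%:R * (j.1 == l)%:R)) => v [a u] /= sv _.
rewrite (bigD1 a) //= eqxx mulr1 big1 ?addr0; last first.
  by move=> l; rewrite eq_sym => /negPf ->; rewrite !mulr0.
rewrite /delta /spread_word.
have -> : nseq h.-1 x = nseq (h - o) x ++ nseq o.-1 x.
  by rewrite -nseqD; congr nseq; lia.
rewrite -catA mulrC -natrM mulnb.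
case: (eqVneq (size u) (h - o)%N) => su; first by rewrite eqseq_cat // size_nseq.
case: eqP => [e|_].
  have := congr1 size e; rewrite !size_cat /= !size_nseq sv => es.
  by move/eqP: su; case; slia.
by case: eqP => [e|//]; move/eqP: su; case; rewrite e size_nseq.
Qed.

Lemma spread_emb : emb st spread.
Proof.
apply: comp_emb => //.
exists (delta K (nseq h.-1 x)).
  exists (nseq h.-1 x); first by rewrite size_nseq subn1.
  by rewrite /delta eqxx oner_neq0.
move=> a; exists a => s t ss.
rewrite /delta /spread_word eqseq_cat ?size_nseq ?ss ?subn1 //.
by rewrite eqseq_cons andbT -natrM mulnb.
Qed.

Definition spread_seq (S : seq T) := flatten [seq spread_word a | a <- S].

Lemma ev_spread S w : @ev K spread S w = ev (spread_seq S) w.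
Proof.
elim: S w => // a S IH w.
have := @ev_cat_take K spread [:: a] S w; rewrite cat1s => ->.
rewrite IH ev1; last exact: spread_valid.
rewrite word_of_spread -[spread_seq (a :: S)]/(spread_word a ++ spread_seq S).
by rewrite ev_cat_take size_spread_word muln1.
Qed.

Lemma size_spread_seq S : size (spread_seq S) = (size S * h)%N.
Proof.
elim: S => // a S IH.
by rewrite -[spread_seq (a :: S)]/(spread_word a ++ spread_seq S) size_cat size_spread_word IH.
Qed.

Lemma nth_spread_seq S t : (t %% h)%N != h.-1 -> nth x (spread_seq S) t = x.
Proof.
elim: S t => [|a S IH] t ht; first by rewrite nth_nil.
rewrite -[spread_seq (a :: S)]/(spread_word a ++ spread_seq S) nth_cat size_spread_word; case: ltnP => th.
  rewrite nth_cat size_nseq; case: ltnP => th'; first by rewrite nth_nseq th'.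
  by exfalso; move/eqP: ht; apply; rewrite modn_small //; lia.
by apply: IH; rewrite -(subnK th) modnDr in ht.
Qed.

(** Only positions congruent to [h - 1] modulo [h] can carry a letter other than [x], and at most
    [h] consecutive positions include at most one of them. Counted from the start of [m], its
    position is [i0]. *)
Lemma spread_infix S A m B : spread_seq S = A ++ m ++ B -> (size m <= h)%N ->
  m = [::] \/ exists i a i', m = nseq i x ++ a :: nseq i' x.
Proof.
move=> e mh; case: (posnP (size m)) => m0; first by left; apply: size0nil.
right.
have nm i : (i < size m)%N -> ((size A + i) %% h)%N != h.-1 -> nth x m i = x.
  move=> im /(nth_spread_seq S); rewrite e nth_cat ltnNge leq_addr /= addKn.
  by rewrite nth_cat im.
pose i0 := (h.-1 - (size A %% h))%N.
have hA := ltn_pmod (size A) h0.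
have i0h : ((size A + i0) %% h)%N = h.-1.
  by rewrite -modnDml modn_small /i0; lia.
have uni i : (i < h)%N -> ((size A + i) %% h)%N = h.-1 -> i = i0.
  move=> ih hi; apply/eqP; rewrite -[i](modn_small ih) -[i0](@modn_small _ h) ?/i0; last by lia.
  by rewrite -(eqn_modDl (size A)) hi -/i0 i0h.
case: (ltnP i0 (size m)) => hi0.
  exists i0, (nth x m i0), (size m - i0 - 1)%N.
  apply: (@eq_from_nth _ x); first by rewrite size_cat /= !size_nseq; slia.
  move=> i im; rewrite nth_cat size_nseq; case: ltngtP => ii.
  - rewrite nth_nseq ii nm //; apply/eqP => /uni; slia.
  - rewrite -(subnSK ii) /= nth_nseq if_same nm //; apply/eqP => /uni; slia.
  - by rewrite ii subnn.
(* There is no such position: [m] is a run of [x], whose last letter plays the role of the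
   distinguished one. *)
exists (size m).-1, x, 0%N.
apply: (@eq_from_nth _ x); first by rewrite size_cat /= size_nseq; slia.
move=> i im; rewrite nm //; last by apply/eqP => /uni; slia.
rewrite nth_cat size_nseq; case: ltnP => hi; first by rewrite nth_nseq hi.
by rewrite (_ : (i - _)%N = 0%N) //; slia.
Qed.

End Spread.

Section Base.
Variable K : fieldType.

Definition base : state K := State ord0 1 (fun a : 'I_2 => delta K [:: a]).

Lemma base_valid : valid base.
Proof.
split=> //= [a|e he a]; first exact: (@supp_delta K 'I_2 [:: a]).
rewrite -[RHS](he [:: a]) (bigD1 a) //= /delta eqxx mulr1 big1 ?addr0 // => b ba.
by rewrite eqseq_cons eq_sym (negPf ba) mulr0.
Qed.

Lemma base_pre : pre_rk (len base) (@word_of K base) 1.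
Proof.
move=> [|//] _; exists (fun _ _ => 1), (fun _ j => delta K [:: j.1] j.2) => u [a v] /= su _.
by rewrite big_ord1 mul1r (size0nil su).
Qed.

Lemma base_suf : suf_rk (len base) (@word_of K base) 1.
Proof.
move=> [|//] _; exists (fun _ _ => 1), (fun _ j => delta K [:: j.1] j.2) => u [a v] /= su _.
by rewrite big_ord1 mul1r (size0nil su) cats0.
Qed.

Lemma base_ev s w : @ev K base s w = delta K s w.
Proof.
elim: s w => [|a s IH] w //.
have := @ev_cat_take K base [:: a] s w; rewrite cat1s => ->.
rewrite IH ev1; last exact: base_valid.
case: w => [|b w] /=; first by rewrite /delta mul0r.
by rewrite /delta take0 drop0 -natrM mulnb !eqseq_cons andbT.
Qed.

Lemma comp_base_word (B : finType) b0 q (C : B -> seq 'I_2 -> K) b w :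
  (forall b, supp q (C b)) -> @word_of K (@comp K base B b0 q C) b w = C b w.
Proof.
move=> sC /=; case: (eqVneq (size w) q) => sw; last first.
  rewrite sC // big1_seq // => s /andP[_]; rewrite mem_words => /eqP ss.
  rewrite base_ev /delta; case: eqP => [e|_]; last by rewrite mulr0.
  by move: sw; rewrite e ss eqxx.
rewrite (@sum_words1 _ _ q _ w) //; first by rewrite base_ev /delta eqxx mulr1.
by move=> s _ sw'; rewrite base_ev /delta eq_sym (negPf sw') mulr0.
Qed.

End Base.

(** * Spans of windows *)

Section WindowCases.
Variables (K : fieldType) (T : finType) (A : Type) (f : A -> seq T -> K) (L : nat).
Hypotheses (L0 : (0 < L)%N) (fs : forall a, supp L (f a)).

(** The functional lives in the single degree [L * size Z - size U - size V], which is at most [p].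
    After stripping, the cases are that no factor remains, that one does, or that two cut factors
    enclose whole ones. *)
Lemma window_cases (Z : seq A) U V p : (L * size Z <= size U + size V + p)%N ->
  let phi w := tev L (map f Z) (U ++ w ++ V) in
  phi =1 (fun=> 0) \/
  exists c psi, phi =1 (fun w => c * psi w) /\
  [\/ psi = delta K [::],
      exists a u v, [/\ (size u < L)%N, (size v < L)%N,
        (L <= size u + size v + p)%N, exists Z1 Z3, Z = Z1 ++ a :: Z3 &
        psi = (fun w => f a (u ++ w ++ v))] |
      exists a m b u v, [/\ (size u < L)%N, (size v < L)%N,
        (L - size u + L * size m + (L - size v) <= p)%N,
        exists Z1 Z3, Z = Z1 ++ a :: m ++ b :: Z3 &
        psi = tens (L - size u) (fun w => f a (u ++ w))
          (tens (L * size m) (tev L (map f m)) (fun w => f b (w ++ v)))]].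
Proof.
move=> hp phi.
case: (leqP (size U + size V) (L * size Z)) => hUV; last first.
  left=> w; rewrite /phi (tev_supp_map fs) // !size_cat; apply/eqP; slia.
set k := (L * size Z - (size U + size V))%N.
have e : (size U + k + size V)%N = (L * size Z)%N by rewrite /k; slia.
have [Z1 [Z2 [Z3 [U1 [u [v [V3 [[eZ eU eV] su sv suv hw]]]]]]]] := tev_peel f L0 e.
have kp : (k <= p)%N by rewrite /k; slia.
have {}hw w : phi w = tev L (map f Z1) U1 * tev L (map f Z3) V3 *
    tev L (map f Z2) (u ++ w ++ v).
  case: (eqVneq (size w) k) => sw; first by rewrite /phi hw // mulrAC.
  rewrite /phi [LHS](tev_supp_map fs); last first.
    by rewrite !size_cat; apply/eqP => e'; move/eqP: sw; apply; slia.
  rewrite [Y in _ * Y](tev_supp_map fs) ?mulr0 // !size_cat.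
  by apply/eqP => e'; move/eqP: sw; apply; slia.
right; exists (tev L (map f Z1) U1 * tev L (map f Z3) V3).
case: Z2 eZ suv hw => [|a Z2] eZ suv hw.
  have [eu ev] : u = [::] /\ v = [::].
    by move: suv; rewrite muln0 => /eqP; rewrite !addn_eq0 => /andP[/andP[/eqP/size0nil -> _] /eqP/size0nil ->].
  exists (delta K [::]); split; last by constructor 1.
  by move=> w; rewrite hw eu ev /= cats0.
case/lastP: Z2 eZ suv hw => [|m b] eZ suv hw.
  exists (fun w => f a (u ++ w ++ v)); split.
    by move=> w; rewrite hw (tev1 _ (fs a)).
  constructor 2; exists a, u, v; split=> //; first by move: suv; rewrite /=; slia.
  by exists Z1, Z3.
exists (tens (L - size u) (fun w => f a (u ++ w))
          (tens (L * size m) (tev L (map f m)) (fun w => f b (w ++ v)))).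
have ek : k = (L - size u + (L * size m + (L - size v)))%N.
  by move: suv; rewrite /= size_rcons !mulnS; slia.
split; last first.
  constructor 3; exists a, m, b, u, v; split=> //; first by slia.
  by exists Z1, Z3; rewrite eZ -cats1 /= -catA.
move=> w; rewrite hw; congr (_ * _).
case: (eqVneq (size w) k) => sw; last first.
  rewrite (tev_supp_map fs); last first.
    by rewrite !size_cat -suv; apply/eqP => e'; move/eqP: sw; apply; slia.
  have h1 : supp (L - size u)%N (fun w => f a (u ++ w)).
    by move=> w' hw'; apply: fs; rewrite size_cat; apply/eqP => e'; move/eqP: hw'; apply; slia.
  have h2 : supp (L - size v)%N (fun w => f b (w ++ v)).
    by move=> w' hw'; apply: fs; rewrite size_cat; apply/eqP => e'; move/eqP: hw'; apply; slia.
  have h3 : supp (L * size m)%N (tev L (map f m)) by apply: tev_supp_map.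
  by rewrite (supp_tens h1 (supp_tens h3 h2)) // -ek.
set i := (L - size u)%N; set w1 := take i w; set w' := drop i w.
set wm := take (L * size m) w'; set w2 := drop (L * size m) w'.
have sw1 : size w1 = i by rewrite size_takel //; slia.
have sw' : size w' = (L * size m + (L - size v))%N by rewrite size_drop; slia.
have swm : size wm = (L * size m)%N by rewrite size_takel //; slia.
have -> : u ++ w ++ v = (u ++ w1) ++ (wm ++ (w2 ++ v)).
  by rewrite -{1}(cat_take_drop i w) -/w1 -/w' -{1}(cat_take_drop (L * size m) w') -!catA.
rewrite -cats1 (_ : map f (a :: m ++ [:: b]) = [:: f a] ++ map f m ++ [:: f b]); last first.
  by rewrite /= map_cat.
rewrite tev_cat ?muln1 ?size_cat; last by rewrite sw1 /i /=; slia.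
rewrite tev_cat ?size_map //.
by rewrite !(tev1 _ (fs _)).
Qed.

End WindowCases.

Section CrudeWindows.
Variables (K : fieldType) (st : state K) (Sp Ss S : nat).
Local Notation T := (letters st).
Local Notation L := (len st).
Local Notation x := (letter0 st).
Hypotheses (vst : valid st) (hp : pre_rk L (@word_of K st) Sp)
  (hs : suf_rk L (@word_of K st) Ss)
  (SpS : (Sp <= S)%N) (SsS : (Ss <= S)%N) (DS : (#|T| <= S)%N).

(** Fixing the first [o] letters gives functionals on words of length [L - o], whose span is bounded
    by the suffix rank at [L - o]. That rank is available only for [0 < o]; for [o = 0] the family
    consists of the letters themselves. *)
Lemma left_span o : (o < L)%N -> exists F : seq (seq 'I_2 -> K), (size F <= S)%N /\
  forall a u, size u = o -> dspan F (fun w => word_of (s := st) a (u ++ w)).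
Proof.
move=> oL; case: (posnP o) => o0.
  exists [seq word_of (s := st) a | a <- enum T]; split.
    by rewrite size_map -cardE.
  move=> a u; rewrite o0 => /size0nil ->; apply: dspan_map; exact: mem_enum.
have [|H [k e]] := hs (o := (L - o)%N); first by lia.
exists [seq (fun w => (size w == L - o)%N%:R * H l w) | l <- enum 'I_Ss]; split.
  by rewrite size_map size_enum_ord.
move=> a u su.
apply: (@dspan_ext _ _ _ (fun w => \sum_l k l (a, u) * ((size w == L - o)%N%:R * H l w))).
  move=> w /=; case: eqP => sw.
    by rewrite (e w (a, u)) //; apply: eq_bigr => l _; rewrite mul1r mulrC.
  rewrite (word_supp vst) ?big1 // => [l _|]; first by rewrite mul0r mulr0.
  by rewrite size_cat su; apply/eqP => e'; apply: sw; slia.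
apply: dspan_sum => l; apply: dspanZ.
by apply: (@dspan_map _ _ _ _ (fun l w => (size w == L - o)%N%:R * H l w)); rewrite mem_enum.
Qed.

Lemma right_span o : (o < L)%N -> exists F : seq (seq 'I_2 -> K), (size F <= S)%N /\
  forall a v, size v = o -> dspan F (fun w => word_of (s := st) a (w ++ v)).
Proof.
move=> oL; case: (posnP o) => o0.
  exists [seq word_of (s := st) a | a <- enum T]; split.
    by rewrite size_map -cardE.
  move=> a v; rewrite o0 => /size0nil ->.
  apply: (@dspan_ext _ _ _ (word_of (s := st) a)); first by move=> w; rewrite cats0.
  apply: dspan_map; exact: mem_enum.
have [|H [k e]] := hp (o := (L - o)%N); first by lia.
exists [seq (fun w => (size w == L - o)%N%:R * H l w) | l <- enum 'I_Sp]; split.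
  by rewrite size_map size_enum_ord.
move=> a u su.
apply: (@dspan_ext _ _ _ (fun w => \sum_l k l (a, u) * ((size w == L - o)%N%:R * H l w))).
  move=> w /=; case: eqP => sw.
    by rewrite (e w (a, u)) //; apply: eq_bigr => l _; rewrite mul1r mulrC.
  rewrite (word_supp vst) ?big1 // => [l _|]; first by rewrite mul0r mulr0.
  by rewrite size_cat su; apply/eqP => e'; apply: sw; slia.
apply: dspan_sum => l; apply: dspanZ.
by apply: (@dspan_map _ _ _ _ (fun l w => (size w == L - o)%N%:R * H l w)); rewrite mem_enum.
Qed.

(** The letter is cut on both sides. The right cut is expressed by genuine letters with fixed right
    ends, so that the suffix rank applies to these in turn, giving [S * S]. *)
Lemma inner_span o o' : (o < L)%N -> (o' < L)%N ->
  exists F : seq (seq 'I_2 -> K), (size F <= S * S)%N /\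
  forall a u v, size u = o -> size v = o' ->
    dspan F (fun w => word_of (s := st) a (u ++ w ++ v)).
Proof.
move=> oL oL'.
have S0 : (0 < S)%N by apply: leq_trans DS; apply/card_gt0P; exists x.
case: (posnP o') => o0'.
  have [F [sF hF]] := left_span oL; exists F; split.
    by apply: leq_trans sF _; rewrite leq_pmulr.
  move=> a u v su; rewrite o0' => /size0nil ->.
  apply: dspan_ext (hF a u su) => w; by rewrite cats0.
case: (posnP o) => o0.
  have [F [sF hF]] := right_span oL'; exists F; split.
    by apply: leq_trans sF _; rewrite leq_pmulr.
  move=> a u v; rewrite o0 => /size0nil -> sv; exact: hF.
have lo' : (L - o' < L)%N by lia.
have [m [js [k [mn _ ek]]]] := rk_members (hp lo').
have lo : (L - o < L)%N by lia.
have [H [kap eH]] := hs lo.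
pose G (l : 'I_m * 'I_Ss) (w : seq 'I_2) : K :=
  if (size w == L - o - o')%N && (size (js l.1).2 == o')
  then H l.2 (w ++ (js l.1).2) else 0.
exists [seq G l | l <- enum {: 'I_m * 'I_Ss}]; split.
  rewrite size_map -cardE card_prod !card_ord leq_mul //; exact: leq_trans mn SpS.
move=> a u v su sv.
case: (leqP (o + o') L) => hoo; last first.
  apply: (@dspan_ext _ _ _ (fun=> 0)); last exact: dspan0.
  by move=> w; rewrite (word_supp vst) // !size_cat su sv; apply/eqP; slia.
apply: (@dspan_ext _ _ _ (fun w => \sum_(l : 'I_m * 'I_Ss)
   (k l.1 (a, v) * kap l.2 ((js l.1).1, u)) * G l w)).
  move=> w; rewrite -(pair_bigA _ (fun l l' => (k l (a, v) * kap l' ((js l).1, u)) * G (l, l') w)) /=.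
  case: (eqVneq (size w) (L - o - o')%N) => sw; last first.
    rewrite (word_supp vst) ?big1 // => [l _|].
      by rewrite big1 // => l' _; rewrite /G (negPf sw) mulr0.
    by rewrite !size_cat su sv; apply/eqP => e'; move/eqP: sw; apply; slia.
  have suw : size (u ++ w) = (L - o')%N by rewrite size_cat su sw; lia.
  rewrite catA (ek (u ++ w) (a, v)) //; apply: eq_bigr => l _.
  case: (eqVneq (size (js l).2) o') => sj; last first.
    rewrite (word_supp vst) ?mul0r ?big1 // => [l' _|].
      by rewrite /G /= (negPf sj) andbF mulr0.
    by rewrite size_cat suw; apply/eqP => e'; move/eqP: sj; apply; slia.
  have swj : size (w ++ (js l).2) = (L - o)%N by rewrite size_cat sw sj; lia.
  rewrite -catA (eH (w ++ (js l).2) ((js l).1, u)) // mulr_suml.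
  by apply: eq_bigr => l' _; rewrite /G /= sw sj !eqxx /=; ring.
apply: dspan_sum => l; apply: dspanZ.
by apply: dspan_map; rewrite mem_enum.
Qed.

End CrudeWindows.

(** The inequality on sizes says that the functional lives on words of length at most [p]; one
    family of at most [n] functionals has to serve all words and all translates. *)
Definition window_span (K : fieldType) (st : state K) p n :=
  exists2 F : seq (seq 'I_2 -> K), (size F <= n)%N &
    forall (S : seq (letters st)) u v, (len st * size S <= size u + size v + p)%N ->
      dspan F (fun w => ev S (u ++ w ++ v)).

Lemma window_span_leq (K : fieldType) (st : state K) p n m :
  (n <= m)%N -> window_span st p n -> window_span st p m.
Proof. by move=> nm [F sF hF]; exists F => //; apply: leq_trans nm. Qed.

Lemma size_bind_le (A : eqType) (B : Type) (f : A -> seq B) (l : seq A) m :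
  (forall a, a \in l -> size (f a) <= m)%N ->
  (size (flatten [seq f a | a <- l]) <= size l * m)%N.
Proof.
elim: l => //= a l IH h; rewrite size_cat mulSn leq_add //.
  by apply: h; rewrite inE eqxx.
by apply: IH => b bl; apply: h; rewrite inE bl orbT.
Qed.

Lemma size_bind_iota (B : Type) (f : nat -> seq B) n m :
  (forall j, (j < n)%N -> size (f j) <= m)%N ->
  (size (flatten [seq f j | j <- iota 0 n]) <= n * m)%N.
Proof.
move=> h; rewrite -[n in (_ <= n * _)%N](size_iota 0); apply: size_bind_le => j.
by rewrite mem_iota; apply: h.
Qed.

Definition sparse_words (T : finType) (x : T) j : seq (seq T) :=
  if j is j'.+1 then
    flatten [seq [seq nseq i x ++ a :: nseq (j' - i) x | a <- enum T] | i <- iota 0 j]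
  else [:: [::]].

Lemma size_sparse_words (T : finType) (x : T) j :
  (size (sparse_words x j) <= j.+1 * #|T|)%N.
Proof.
have T0 : (0 < #|T|)%N by apply/card_gt0P; exists x.
case: j => [|j]; first by rewrite /= mul1n.
rewrite size_bind; under eq_bigr do rewrite size_map -cardE.
by rewrite big_const_seq count_predT iter_addn_0 size_iota mulnC leq_mul2r leqnSn orbT.
Qed.

Lemma mem_sparse_words (T : finType) (x : T) (m : seq T) :
  m = [::] \/ (exists i a i', m = nseq i x ++ a :: nseq i' x) ->
  m \in sparse_words x (size m).
Proof.
case=> [->|[i [a [i' ->]]]]; first by rewrite inE.
rewrite size_cat /= !size_nseq addnS; apply/flattenP.
exists [seq nseq i x ++ b :: nseq (i + i' - i) x | b <- enum T].
  by apply/mapP; exists i => //; rewrite mem_iota; lia.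
by rewrite addKn; apply/mapP; exists a => //; rewrite mem_enum.
Qed.

Section CrudeUpper.
Variables (K : fieldType) (st : state K) (Sp Ss S h : nat).
Local Notation T := (letters st).
Local Notation L := (len st).
Local Notation x := (letter0 st).
Hypotheses (vst : valid st) (h0 : (0 < h)%N) (hp : pre_rk L (@word_of K st) Sp)
  (hs : suf_rk L (@word_of K st) Ss)
  (SpS : (Sp <= S)%N) (SsS : (Ss <= S)%N) (DS : (#|T| <= S)%N).

(** All pairs of offsets and all numbers of inner letters are counted independently. For
    [p <= L * h] the inner letters number at most [h], hence form a sparse word. The wasted factor
    of order [L ^ 2] is affordable at later levels, where [r] dominates the data of the earlier
    ones. *)
Lemma crude_window_span p (Q := (p %/ L)%N) : (p <= L * h)%N ->
  window_span (spread st h) p (1 + L * (L * (S * S)) + L * (L * (Q.+1 * (S * (Q.+1 * #|T| * S))))).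
Proof.
move=> pL; have L0 := len_gt0 vst.
have [FL hFL] : {FL : nat -> seq (seq 'I_2 -> K) & forall o, (o < L)%N ->
    (size (FL o) <= S)%N /\
    forall a u, size u = o -> dspan (FL o) (fun w => word_of (s := st) a (u ++ w))}.
  apply: (@choice _ _ (fun o F => (o < L)%N -> (size F <= S)%N /\
    forall a u, size u = o -> dspan F (fun w => word_of (s := st) a (u ++ w)))) => o.
  case: (ltnP o L) => oL; last by exists [::].
  by have [F hF] := left_span vst hs SpS SsS DS oL; exists F.
have [FR hFR] : {FR : nat -> seq (seq 'I_2 -> K) & forall o, (o < L)%N ->
    (size (FR o) <= S)%N /\
    forall a v, size v = o -> dspan (FR o) (fun w => word_of (s := st) a (w ++ v))}.
  apply: (@choice _ _ (fun o F => (o < L)%N -> (size F <= S)%N /\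
    forall a v, size v = o -> dspan F (fun w => word_of (s := st) a (w ++ v)))) => o.
  case: (ltnP o L) => oL; last by exists [::].
  by have [F hF] := right_span vst hp SpS SsS DS oL; exists F.
have [FI hFI] : {FI : nat * nat -> seq (seq 'I_2 -> K) & forall oo,
    (oo.1 < L)%N -> (oo.2 < L)%N -> (size (FI oo) <= S * S)%N /\
    forall a u v, size u = oo.1 -> size v = oo.2 ->
      dspan (FI oo) (fun w => word_of (s := st) a (u ++ w ++ v))}.
  apply: (@choice _ _ (fun (oo : nat * nat) F => (oo.1 < L)%N -> (oo.2 < L)%N ->
    (size F <= S * S)%N /\ forall a u v, size u = oo.1 -> size v = oo.2 ->
      dspan F (fun w => word_of (s := st) a (u ++ w ++ v)))) => -[o o'].
  case: (ltnP o L) => oL; last by exists [::] => /=; lia.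
  case: (ltnP o' L) => oL'; last by exists [::] => /=; lia.
  by have [F hF] := inner_span vst hp hs SpS SsS DS oL oL'; exists F.
pose FM j := [seq tev L (map (@word_of K st) m) | m <- sparse_words x j].
pose F3 o o' j := flatten [seq [seq tens (L - o) f y | y <-
   flatten [seq [seq tens (L * j) f' y' | y' <- FR o'] | f' <- FM j]] | f <- FL o].
pose F := delta K [::] :: flatten [seq flatten [seq FI (o, o') | o' <- iota 0 L] | o <- iota 0 L]
  ++ flatten [seq flatten [seq flatten [seq F3 o o' j | j <- iota 0 Q.+1] |
       o' <- iota 0 L] | o <- iota 0 L].
exists F.
  rewrite /F /= size_cat -add1n -addnA !leq_add2l leq_add //.
    apply: size_bind_iota => o oL.
    apply: size_bind_iota => o' oL'.
    by have [] := hFI (o, o') oL oL'.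
  apply: size_bind_iota => o oL.
  apply: size_bind_iota => o' oL'.
  apply: size_bind_iota => j jQ.
  have [sL _] := hFL o oL; have [sR _] := hFR o' oL'.
  rewrite size_tensl leq_mul // size_tensl leq_mul // size_map.
  by apply: leq_trans (size_sparse_words x j) _; rewrite leq_mul2r jQ orbT.
move=> s u0 v0 hsz.
have e w : ev s (u0 ++ w ++ v0) =
    tev L (map (@word_of K st) (spread_seq h s)) (u0 ++ w ++ v0) by rewrite ev_spread.
have hsz' : (L * size (spread_seq h s) <= size u0 + size v0 + p)%N.
  by rewrite size_spread_seq // [(size s * h)%N]mulnC mulnA.
case: (window_cases L0 (word_supp vst) hsz') => [hz|[c [psi [hc cases]]]].
  by apply: (@dspan_ext _ _ _ (fun=> 0)); [move=> w; rewrite e hz | apply: dspan0].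
apply: (@dspan_ext _ _ _ (fun w => c * psi w)); first by move=> w; rewrite e hc.
apply: dspanZ; case: cases.
- by move=> ->; move=> ws [].
- move=> [a [u [v [uL vL _ _ ->]]]]; apply: (@dspan_catr _ _ [:: _]); apply: dspan_catl.
  apply: (dspan_bind (i := size u)); first by rewrite mem_iota.
  apply: (dspan_bind (i := size v)); first by rewrite mem_iota.
  have [_ hh] := hFI (size u, size v) uL vL; exact: hh.
move=> [a [m [b [u [v [uL vL hm [Z1 [Z3 eZ]] ->]]]]]].
apply: (@dspan_catr _ _ [:: _]); apply: dspan_catr.
apply: (dspan_bind (i := size u)); first by rewrite mem_iota.
apply: (dspan_bind (i := size v)); first by rewrite mem_iota.
apply: (dspan_bind (i := size m)).
  by rewrite mem_iota /= ltnS leq_divRL // mulnC; apply: leq_trans hm; rewrite -addnA addnCA leq_addr.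
apply: dspan_tens; first by have [_] := hFL (size u) uL; apply.
apply: dspan_tens; last by have [_] := hFR (size v) vL; apply.
apply: (@dspan_map _ _ _ _ (fun m => tev L (map (@word_of K st) m))).
apply: mem_sparse_words.
apply: (@spread_infix _ _ _ h0 s (Z1 ++ [:: a]) m (b :: Z3)); first by rewrite eZ -catA.
have : (L * size m <= L * h)%N.
  by apply: leq_trans pL; apply: leq_trans hm; rewrite -addnA addnCA leq_addr.
by rewrite leq_pmul2l.
Qed.

End CrudeUpper.

(** * Finer count of windows, for the first level *)

Lemma dspan_tensr (K : fieldType) (T : eqType) i (f psi : seq T -> K) G :
  dspan G psi -> dspan [seq tens i f b | b <- G] (tens i f psi).
Proof.
move=> h; have hf : dspan [:: f] f by move=> ws [].
by have := dspan_tens (m := i) hf h; rewrite /= cats0.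
Qed.

Section ZoneWindows.
Variables (K : fieldType) (T : finType) (x : T) (s0 gam : nat).
Local Notation g := (2 * gam)%N.
Local Notation s := (s0 + g)%N.
Variables (A : finType) (y : A -> seq T -> K).
Hypothesis (sy : forall a, supp g (y a)).
Local Notation xs i := (nseq i x).
Local Notation F a := (@half_block K T x s0 (y a)).

Definition dwords j := [seq delta K t | t <- words T j].

Lemma dspan_dwords j phi : supp j phi -> dspan (dwords j) phi.
Proof.
move=> sp; apply: (@dspan_ext _ _ _ (fun w => \sum_(t <- words T j) phi t * delta K t w)).
  move=> w; case: (eqVneq (size w) j) => sw; last first.
    rewrite sp // big1_seq // => t /andP[_]; rewrite mem_words => /eqP st.
    rewrite /delta; case: eqP => [e|_]; last by rewrite mulr0.
    by move: sw; rewrite e st eqxx.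
  rewrite (@sum_words1 _ _ j _ w) //; first by rewrite /delta eqxx mulr1.
  by move=> t _ tw; rewrite /delta eq_sym (negPf tw) mulr0.
move=> ws k; rewrite /pairing.
under eq_bigr do rewrite mulr_sumr.
rewrite exchange_big big1_seq // => t /andP[_ tw].
move/allp_map/allp_mem: k => /(_ t tw) e.
by under eq_bigr do rewrite mulrCA; rewrite -mulr_sumr -/(pairing _ _) e mulr0.
Qed.

(* Below gam all words of length j are used, above it the missing g - j letters
   are enumerated: the total over j stays of order D ^ gam. *)
Definition cutl j := if (j < gam)%N then dwords j else
  flatten [seq [seq (fun w => y a (u ++ w)) | u <- words T (g - j)] | a <- enum A].

Definition cutr j := if (j < gam)%N then dwords j else
  flatten [seq [seq (fun w => y a (w ++ v)) | v <- words T (g - j)] | a <- enum A].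

Lemma dspan_cutl a u j : (size u + j)%N = g -> dspan (cutl j) (fun w => y a (u ++ w)).
Proof.
move=> e; rewrite /cutl; case: ltnP => h.
  apply: dspan_dwords => w sw; apply: sy; rewrite size_cat -e; apply/eqP => e'.
  by move/eqP: sw; apply; slia.
apply: (dspan_bind (i := a)); first exact: mem_enum.
apply: (@dspan_map _ _ _ _ (fun u w => y a (u ++ w))).
by rewrite mem_words -e addnK.
Qed.

Lemma dspan_cutr a v j : (j + size v)%N = g -> dspan (cutr j) (fun w => y a (w ++ v)).
Proof.
move=> e; rewrite /cutr; case: ltnP => h.
  apply: dspan_dwords => w sw; apply: sy; rewrite size_cat -e; apply/eqP => e'.
  by move/eqP: sw; apply; slia.
apply: (dspan_bind (i := a)); first exact: mem_enum.
apply: (@dspan_map _ _ _ _ (fun v w => y a (w ++ v))).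
by rewrite mem_words -e addKn.
Qed.

Definition cutsize j := if (j < gam)%N then (#|T| ^ j)%N else (#|A| * #|T| ^ (g - j))%N.

Lemma size_cutl j : size (cutl j) = cutsize j.
Proof.
rewrite /cutl /cutsize; case: ltnP => _; first by rewrite size_map size_words.
rewrite size_bind; under eq_bigr do rewrite size_map size_words.
by rewrite big_const_seq count_predT iter_addn_0 -cardE mulnC.
Qed.

Lemma size_cutr j : size (cutr j) = cutsize j.
Proof.
rewrite /cutr /cutsize; case: ltnP => _; first by rewrite size_map size_words.
rewrite size_bind; under eq_bigr do rewrite size_map size_words.
by rewrite big_const_seq count_predT iter_addn_0 -cardE mulnC.
Qed.

Lemma sum_cutsize : (1 < #|T|)%N ->
  (\sum_(j <- iota 0 g) cutsize j <= (1 + 2 * #|A|) * #|T| ^ gam)%N.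
Proof.
move=> D1; rewrite mul2n -addnn iotaD big_cat /= add0n mulnDl mul1n leq_add //.
  rewrite (@eq_big_seq _ _ _ _ _ _ (fun j => #|T| ^ j)%N); first exact: sum_pow_lt.
  by move=> j; rewrite mem_iota /cutsize => /andP[_ ->].
rewrite (@eq_big_seq _ _ _ _ _ _ (fun j => #|A| * #|T| ^ (g - j))%N); last first.
  by move=> j; rewrite mem_iota /cutsize => /andP[h _]; rewrite ltnNge h.
by rewrite -big_distrr /= [(2 * #|A|)%N]mulnC -mulnA leq_mul2l sum_pow_rev // orbT.
Qed.

(* The left and right parts of a window, by the size of the missing piece. *)
Definition lefts o := if (o <= s0)%N then
    [seq tens (s0 - o)%N (delta K (xs (s0 - o))) (y a) | a <- enum A]
  else cutl (s - o)%N.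

Definition rights o := if (o < g)%N then
    [seq tens s0 (delta K (xs s0)) f | f <- cutr (g - o)%N]
  else [:: delta K (xs (s - o))].

Lemma F_left a u : (size u <= s0)%N -> exists c, forall w, F a (u ++ w) =
  c * tens (s0 - size u)%N (delta K (xs (s0 - size u))) (y a) w.
Proof.
move=> us; exists (u == xs (size u))%:R => w.
rewrite /half_block /tens take_cat drop_cat ltnNge us /= mulrA; congr (_ * _).
have -> : xs s0 = xs (size u) ++ xs (s0 - size u) by rewrite -nseqD subnKC.
by rewrite /delta eqseq_cat ?size_nseq // -natrM mulnb.
Qed.

Lemma F_right a v w : (size v < g)%N ->
  F a (w ++ v) = tens s0 (delta K (xs s0)) (fun w => y a (w ++ v)) w.
Proof.
move=> vg; case: (leqP s0 (size w)) => h.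
  rewrite /half_block /tens takel_cat //; congr (_ * y a _).
  by rewrite -{1}(cat_take_drop s0 w) -catA drop_size_cat // size_takel.
rewrite (half_block_supp x (sy a)) ?size_cat; last by apply/eqP; slia.
rewrite /tens take_oversize ?(ltnW h) // /delta; case: eqP => [e|_]; last by rewrite mul0r.
by move: h; rewrite e size_nseq ltnn.
Qed.

Lemma F_right_cut a v : (g <= size v)%N -> (size v < s)%N -> exists c, forall w,
  F a (w ++ v) = c * delta K (xs (s - size v)) w.
Proof.
move=> vg vs; exists (F a (xs (s - size v) ++ v)) => w.
rewrite /delta; case: eqP => [->|ne]; first by rewrite mulr1.
rewrite mulr0; case: (eqVneq (size w) (s - size v)%N) => sw; last first.
  by rewrite (half_block_supp x (sy a)) // size_cat; apply/eqP => e; move/eqP: sw; apply; slia.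
rewrite -(cat_take_drop (size v - g) v) catA /half_block tens_cat; last first.
  by rewrite size_cat sw size_takel ?leq_subr //; slia.
rewrite /delta; case: eqP => [e|_]; last by rewrite mul0r.
case: ne; have := congr1 (take (size w)) e; rewrite take_size_cat // => ->.
by rewrite take_nseq sw //; slia.
Qed.

Lemma dspan_lefts a u : (size u < s)%N -> dspan (lefts (size u)) (fun w => F a (u ++ w)).
Proof.
move=> us; rewrite /lefts; case: leqP => h.
  have [c hc] := F_left a h.
  apply: (@dspan_ext _ _ _ (fun w => c * tens (s0 - size u)%N (delta K (xs (s0 - size u))) (y a) w)).
    by move=> w; rewrite hc.
  apply: dspanZ; apply: (@dspan_map _ _ _ _ (fun a => tens _ _ (y a))); exact: mem_enum.
apply: (@dspan_ext _ _ _ (fun w => (take s0 u == xs s0)%:R * y a (drop s0 u ++ w))).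
  by move=> w; rewrite half_block_left_cut.
by apply/dspanZ/dspan_cutl; rewrite size_drop; slia.
Qed.

Lemma dspan_rights a v : (size v < s)%N -> dspan (rights (size v)) (fun w => F a (w ++ v)).
Proof.
move=> vs; rewrite /rights; case: ltnP => h.
  apply: (@dspan_ext _ _ _ (tens s0 (delta K (xs s0)) (fun w => y a (w ++ v)))).
    by move=> w; rewrite F_right.
  by apply/dspan_tensr/dspan_cutr; rewrite subnK // ltnW.
have [c hc] := F_right_cut a h vs.
apply: (@dspan_ext _ _ _ (fun w => c * delta K (xs (s - size v)) w)); first by move=> w; rewrite hc.
by apply: dspanZ => ws [].
Qed.

(* A window inside a single half-block. *)
Definition inners p := [seq delta K (xs i) | i <- iota 0 p.+1] ++
  flatten [seq flatten [seq [seq tens i (delta K (xs i)) f | f <- cutr j] |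
    j <- iota 0 g.+1] | i <- iota 0 p.+1] ++
  flatten [seq dwords j | j <- iota 0 g].

(** The three lists in [inners] answer to the position of the ends: both in the run, the left one in
    the run and the right one in the zone, or both in the zone. *)
Lemma dspan_inners a u v p : (size u < s)%N -> (size v < s)%N ->
  (s <= size u + size v + p)%N -> dspan (inners p) (fun w => F a (u ++ w ++ v)).
Proof.
move=> us vs hp.
case: (leqP (size u + size v) s) => huv; last first.
  apply: (@dspan_ext _ _ _ (fun=> 0)); last exact: dspan0.
  by move=> w; rewrite (half_block_supp x (sy a)) // !size_cat; apply/eqP; slia.
case: (leqP (size u) s0) => h.
  have [c hc] := F_left a h; set i := (s0 - size u)%N in hc.
  apply: (@dspan_ext _ _ _ (fun w => c * tens i (delta K (xs i)) (y a) (w ++ v))).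
    by move=> w; rewrite hc.
  apply: dspanZ; case: (leqP g (size v)) => gv.
    apply: dspan_catl; set j := (s - size u - size v)%N.
    apply: (@dspan_ext _ _ _ (fun w =>
        tens i (delta K (xs i)) (y a) (xs j ++ v) * delta K (xs j) w)).
      move=> w; rewrite {2}/delta; case: eqP => [->|ne]; first by rewrite mulr1.
      rewrite mulr0; have si : supp i (delta K (xs i)).
        by have := @supp_delta K T (xs i); rewrite size_nseq.
      case: (eqVneq (size w) j) => sw; last first.
        rewrite (supp_tens si (sy a)) // size_cat /i; apply/eqP => e.
        by move/eqP: sw; apply; rewrite /j; slia.
      rewrite -(cat_take_drop (size v - g) v) catA tens_cat; last first.
        by rewrite size_cat sw size_takel ?leq_subr // /i /j; slia.
      rewrite /delta; case: eqP => [e|_]; last by rewrite mul0r.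
      case: ne; have := congr1 (take (size w)) e; rewrite take_size_cat // => ->.
      by rewrite take_nseq sw // /i /j; slia.
    apply: dspanZ; apply: (@dspan_map _ _ _ _ (fun i => delta K (xs i))).
    by rewrite mem_iota /j; slia.
  apply: dspan_catr; apply: dspan_catl.
  apply: (dspan_bind (i := i)); first by rewrite mem_iota /i; slia.
  apply: (dspan_bind (i := (g - size v)%N)); first by rewrite mem_iota; slia.
  have hd : dspan (cutr (g - size v)%N) (fun w => y a (w ++ v)).
    by apply: dspan_cutr; rewrite subnK // ltnW.
  apply: (@dspan_ext _ _ _ (tens i (delta K (xs i)) (fun w => y a (w ++ v)))); last first.
    exact: dspan_tensr hd.
  move=> w; rewrite /tens; case: (leqP i (size w)) => iw.
    rewrite takel_cat //; congr (_ * y a _).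
    by rewrite -[in RHS](cat_take_drop i w) -catA drop_size_cat // size_takel.
  rewrite [in LHS]take_oversize ?(ltnW iw) //.
  have -> : delta K (xs i) w = 0.
    by rewrite /delta; case: eqP => // e; move: iw; rewrite e size_nseq ltnn.
  rewrite mul0r; case: (eqVneq (size (w ++ v)) (i + g)%N) => sw; last first.
    rewrite -/(tens i (delta K (xs i)) (y a) (w ++ v)) (@supp_tens _ _ i g) //.
    by have := @supp_delta K T (xs i); rewrite size_nseq.
  by exfalso; move: sw; rewrite size_cat; slia.
apply: dspan_catr; apply: dspan_catr.
apply: (@dspan_ext _ _ _ (fun w => (take s0 u == xs s0)%:R * y a (drop s0 u ++ (w ++ v)))).
  by move=> w; rewrite half_block_left_cut.
apply: dspanZ; apply: (dspan_bind (i := (s - size u - size v)%N)).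
  by rewrite mem_iota; slia.
apply: dspan_dwords => w sw; apply: sy; rewrite !size_cat size_drop.
by apply/eqP => e; move/eqP: sw; apply; slia.
Qed.

End ZoneWindows.

Lemma dspan_tensl (K : fieldType) (T : eqType) i (b phi : seq T -> K) F :
  dspan F phi -> dspan [seq tens i f b | f <- F] (tens i phi b).
Proof.
move=> h ws k.
have e f : pairing (tens i f b) ws =
    pairing f [seq (p.1 * b (drop i p.2), take i p.2) | p <- ws].
  rewrite /pairing big_map; apply: eq_bigr => p _ /=.
  by rewrite -mulrA [X in _ * X]mulrC.
rewrite e; apply: h; move/allp_map: k; apply: allp_sub => f; by rewrite e.
Qed.

Section ZoneSpan.
Variables (K : fieldType) (T : finType) (x : T) (s0 gam : nat).
Local Notation g := (2 * gam)%N.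
Local Notation s := (s0 + g)%N.
Variables (A : finType) (y : A -> seq T -> K).
Hypothesis (sy : forall a, supp g (y a)).
Local Notation xs i := (nseq i x).
Local Notation F a := (@half_block K T x s0 (y a)).
Local Notation cutl := (@cutl K T gam A y).
Local Notation cutr := (@cutr K T gam A y).
Local Notation SF := ((1 + 2 * #|A|) * #|T| ^ gam)%N.

(* inl i: a full zone after i letters x; inr j: the last j letters of a zone. *)
Definition left_idx n : seq (nat + nat) :=
  [seq inl i | i <- iota 0 n] ++ [seq inr j | j <- iota 0 g].
Definition left_len (k : nat + nat) := if k is inl i then (i + g)%N else
  if k is inr j then j else 0%N.
Definition left_fun (k : nat + nat) : seq (seq T -> K) := match k with
  | inl i => [seq tens i (delta K (xs i)) (y a) | a <- enum A]
  | inr j => cutl j end.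

(* inl j: the first j letters of a zone; inr i: only i letters x. *)
Definition right_idx : seq (nat + nat) :=
  [seq inl j | j <- iota 0 g.+1] ++ [seq inr i | i <- iota 0 s.+1].
Definition right_fun (k : nat + nat) : seq (seq T -> K) := match k with
  | inl j => [seq tens s0 (delta K (xs s0)) f | f <- cutr j]
  | inr i => [:: delta K (xs i)] end.

Lemma left_sizes n : (1 < #|T|)%N ->
  (\sum_(k <- left_idx n) size (left_fun k) <= n * #|A| + SF)%N.
Proof.
move=> D1; rewrite big_cat !big_map leq_add //=.
  under eq_bigr do rewrite size_map -cardE.
  by rewrite big_const_seq count_predT iter_addn_0 size_iota mulnC.
by under eq_bigr do rewrite size_cutl; apply: sum_cutsize.
Qed.

Lemma cutr_sizes : (1 < #|T|)%N ->
  (\sum_(j <- iota 0 g.+1) size (cutr j) <= SF + #|A|)%N.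
Proof.
move=> D1; under eq_bigr do rewrite size_cutr.
rewrite -addn1 iotaD big_cat /= big_seq1 leq_add ?sum_cutsize //.
rewrite /cutsize add0n ltnNge (_ : (gam <= g)%N); last by lia.
by rewrite subnn expn0 muln1.
Qed.

Lemma right_sizes : (1 < #|T|)%N ->
  (\sum_(k <- right_idx) size (right_fun k) <= SF + #|A| + s.+1)%N.
Proof.
move=> D1; rewrite big_cat !big_map; apply: leq_add.
  by under eq_bigr do rewrite size_map; apply: cutr_sizes.
by rewrite (eq_bigr (fun=> 1%N)) // sum1_size size_iota.
Qed.

Lemma span_left a u : (size u < s)%N -> exists k,
  [/\ left_len k = (s - size u)%N, k \in left_idx s0.+1,
      forall p, (s - size u <= p)%N -> k \in left_idx p.+1 &
      dspan (left_fun k) (fun w => F a (u ++ w))].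
Proof.
move=> us; have := @dspan_lefts K T x s0 gam A y sy a u us; rewrite /lefts; case: leqP => h hd.
  exists (inl (s0 - size u)%N); split=> //.
  - by rewrite /=; slia.
  - by rewrite mem_cat; apply/orP; left; apply/mapP; eexists; last reflexivity; rewrite mem_iota; slia.
  - by move=> p hp; rewrite mem_cat; apply/orP; left; apply/mapP; eexists; last reflexivity; rewrite mem_iota; slia.
exists (inr (s - size u)%N); split=> //.
- by rewrite mem_cat; apply/orP; right; apply/mapP; eexists; last reflexivity; rewrite mem_iota; slia.
- by move=> p hp; rewrite mem_cat; apply/orP; right; apply/mapP; eexists; last reflexivity; rewrite mem_iota; slia.
Qed.

Lemma span_right a v : (size v < s)%N -> exists2 k, k \in right_idx &
  dspan (right_fun k) (fun w => F a (w ++ v)).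
Proof.
move=> vs; have := @dspan_rights K T x s0 gam A y sy a v vs; rewrite /rights; case: ltnP => h hd.
  exists (inl (g - size v)%N) => //.
  by rewrite mem_cat; apply/orP; left; apply/mapP; eexists; last reflexivity; rewrite mem_iota; slia.
exists (inr (s - size v)%N) => //.
by rewrite mem_cat; apply/orP; right; apply/mapP; eexists; last reflexivity; rewrite mem_iota; slia.
Qed.

Variables (p Q : nat) (Mid : nat -> seq (seq T -> K)).

Definition one_zone := flatten [seq flatten [seq
  [seq tens (left_len k) f (delta K (xs i)) | f <- left_fun k] |
    k <- left_idx p.+1] | i <- iota 0 p.+1].

Definition two_zones := flatten [seq flatten [seq flatten [seq
  flatten [seq [seq tens (left_len k) f b | b <-
     flatten [seq [seq tens (s * j) m b' | b' <- right_fun k'] | m <- Mid j]] | f <- left_fun k] |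
    k' <- right_idx] | j <- iota 0 Q.+1] | k <- left_idx s0.+1].

(** A window with [p <= s - g] that crosses into the next half-block ends within its run, so it
    meets only one zone. The family [two_zones], of order [s ^ 2], has to be omitted there: it fits
    under the constant 8 in front of [p ^ 4] only once [p] is comparable to [s]. *)
Definition zone_family := delta K [::] :: inners x gam y p ++ one_zone ++
  (if (s < p + g)%N then two_zones else [::]).

Lemma one_zone_size : (1 < #|T|)%N ->
  (size one_zone <= p.+1 * (p.+1 * #|A| + SF))%N.
Proof.
move=> D1; apply: size_bind_iota => i _.
rewrite size_bind; under eq_bigr do rewrite size_map; exact: left_sizes.
Qed.

Lemma inners_size : (1 < #|T|)%N ->
  (size (inners x gam y p) <= p.+1 + (p.+1 * (SF + #|A|) + #|T| ^ g))%N.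
Proof.
move=> D1; rewrite /inners 2!size_cat size_map size_iota leq_add2l; apply: leq_add.
  apply: size_bind_iota => i _; rewrite size_bind.
  by under eq_bigr do rewrite size_map; apply: cutr_sizes.
rewrite size_bind; under eq_bigr do rewrite size_map size_words; exact: sum_pow_lt.
Qed.

Lemma two_zones_size M : (1 < #|T|)%N -> (forall j, (j <= Q)%N -> (size (Mid j) <= M)%N) ->
  (size two_zones <= (s0.+1 * #|A| + SF) * (Q.+1 * (M * (SF + #|A| + s.+1))))%N.
Proof.
move=> D1 hM; rewrite /two_zones.
move: (left_sizes s0.+1 D1) (right_sizes D1).
move: (left_idx s0.+1) right_idx => LI RI hL hR.
rewrite size_bind.
apply: leq_trans (_ : (\sum_(k <- LI) size (left_fun k)) *
   (Q.+1 * (M * (SF + #|A| + s.+1))) <= _)%N; last by rewrite leq_mul2r hL orbT.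
rewrite big_distrl; apply: leq_sum => k _ /=.
apply: leq_trans (_ : Q.+1 * (size (left_fun k) * (M * (SF + #|A| + s.+1))) <= _)%N; last first.
  by rewrite mulnCA.
apply: size_bind_iota => j jQ; rewrite size_bind.
apply: leq_trans (_ : size (left_fun k) * (M * (\sum_(k' <- RI) size (right_fun k'))) <= _)%N; last first.
  by rewrite !leq_mul.
rewrite !big_distrr; apply: leq_sum => k' _ /=.
by rewrite size_tensl leq_mul // size_tensl leq_mul // hM.
Qed.

Lemma zone_family_span Z U V : (0 < s)%N -> (s * size Z <= size U + size V + p)%N ->
  (forall Z1 m Z3, Z = Z1 ++ m ++ Z3 -> (0 < size Z1)%N -> (0 < size Z3)%N ->
     (s * size m + 2 <= p)%N ->
     (size m <= Q)%N /\ dspan (Mid (size m)) (tev s (map (fun a => F a) m))) ->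
  dspan zone_family (fun w => tev s (map (fun a => F a) Z) (U ++ w ++ V)).
Proof.
move=> sgt0 hp hmid.
have Fs a : supp s (F a) by apply: half_block_supp.
case: (window_cases sgt0 Fs hp) => [hz|[c [psi [hc cases]]]].
  by apply: (@dspan_ext _ _ _ (fun=> 0)); [move=> w; rewrite hz | apply: dspan0].
apply: (@dspan_ext _ _ _ (fun w => c * psi w)); first by move=> w; rewrite hc.
apply: dspanZ; case: cases.
- by move=> -> ws [].
- move=> [a [u [v [us vs huv _ ->]]]].
  apply: (@dspan_catr _ _ [:: _]); apply: dspan_catl.
  exact: dspan_inners.
move=> [a [m [b [u [v [us vs hm [Z1 [Z3 eZ]] ->]]]]]].
apply: (@dspan_catr _ _ [:: _]); apply: dspan_catr.
have [k [klen k1 k2 kd]] := span_left a us.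
case: ltnP => hsp; last first.
  rewrite cats0.
  have m0 : m = [::].
    case: m hm {eZ} => // a' m; rewrite /= mulnS; slia.
  rewrite m0 /= muln0.
  (* The left piece uses at least one of the [p <= s - g] letters, so fewer than [s - g] remain on
     the right and the second zone is not reached. *)
  have gv : (g <= size v)%N by slia.
  have [c' hc'] := @F_right_cut K T x s0 gam A y sy b v gv vs.
  apply: (dspan_bind (i := (s - size v)%N)); first by rewrite mem_iota; slia.
  apply: (dspan_bind (i := k)); first by apply: k2; slia.
  rewrite klen.
  apply: (@dspan_ext _ _ _ (fun w => c' *
     tens (s - size u) (fun w => F a (u ++ w)) (delta K (xs (s - size v))) w)).
    move=> w; rewrite /tens mulrCA; congr (_ * _).
    by rewrite take0 eqxx mul1r drop0 hc'.
  by apply/dspanZ/dspan_tensl.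
have [k' k'i kd'] := span_right b vs.
have [mQ md] := hmid (Z1 ++ [:: a]) m (b :: Z3) ltac:(by rewrite eZ -catA)
  ltac:(by rewrite size_cat addn1) isT ltac:(slia).
apply: dspan_catr; apply: (dspan_bind (i := k)) => //.
apply: (dspan_bind (i := size m)); first by rewrite mem_iota.
apply: (dspan_bind (i := k')) => //.
rewrite klen; apply: dspan_tens kd _; exact: dspan_tens.
Qed.

End ZoneSpan.

Section Zones.
Variable B : finType.
Implicit Types S : seq B.

Lemma size_zones S : size (zones S) = (size S).*2.
Proof. by elim: S => //= b S IH; rewrite -[size (flatten _)]/(size (zones S)) IH. Qed.

Lemma drop_zones n S : drop n.*2 (zones S) = zones (drop n S).
Proof. by elim: n S => [|n IH] [|b S] //=; rewrite ?drop0 //; apply: IH. Qed.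

Lemma take_zones n S : take n.*2 (zones S) = zones (take n S).
Proof.
elim: n S => [|n IH] [|b S] //=.
by congr [:: _, _ & _]; apply: IH.
Qed.

(** [e] is the parity of the number of preceding zones: it is 1 when the stretch begins at the
    varying zone of a letter, so that it spills over into one more zone. *)
Lemma zones_infix S Z1 m Z3 : zones S = Z1 ++ m ++ Z3 ->
  exists e S1 m' S3, [/\ (e < 2)%N, S = S1 ++ m' ++ S3,
    size m' = uphalf (size m + e) & m = take (size m) (drop e (zones m'))].
Proof.
move=> eZ; set t := size Z1; set e : nat := odd t; set j := size m.
have sz := size_zones S; rewrite eZ !size_cat -/t -/j in sz.
have et : t = (e + t./2.*2)%N by rewrite odd_double_half.
have e2 : (e < 2)%N by rewrite /e; case: odd.
pose S' := drop t./2 S; pose n := uphalf (j + e).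
have nS : (n <= size S')%N.
  by rewrite /n /S' size_drop leq_uphalf_double; move: sz et; rewrite -!muln2 mulnBl; lia.
exists e, (take t./2 S), (take n S'), (drop n S'); split=> //.
- by rewrite !cat_take_drop.
- by rewrite size_takel.
have -> : m = take j (drop t (zones S)) by rewrite eZ drop_size_cat // take_size_cat.
rewrite {1}et -drop_drop drop_zones -/S' -take_zones !take_drop take_takel //.
by rewrite /n -leq_uphalf_double.
Qed.

End Zones.

Lemma uphalf_sum j : (uphalf j + uphalf (j + 1) = j.+1)%N.
Proof.
rewrite addn1 uphalf_half -[uphalf j.+1]/(j./2.+1) addnS -addnA addnn.
by rewrite odd_double_half.
Qed.

Lemma eq_tev (K : fieldType) (T : eqType) (A : Type) L (f f' : A -> seq T -> K) Z w :
  (forall a, f a =1 f' a) -> tev L (map f Z) w = tev L (map f' Z) w.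
Proof. by move=> h; elim: Z w => //= a Z IH w; rewrite h IH. Qed.

Section FirstUpper.
Variables (K : fieldType) (u gam d h : nat).
Local Notation g := (2 * gam)%N.
Local Notation s0 := (4 * u - g)%N.
Local Notation s := (s0 + g)%N.
Local Notation st0 := (@base K).
Local Notation B := ('I_d.+1 * letters st0)%type.
Variables (al : seq 'I_2 -> K) (z : B -> seq 'I_2 -> K).
Hypotheses (gam0 : (0 < gam)%N) (gu : (g <= u)%N) (h0 : (0 < h)%N)
  (sal : supp g al) (sz : forall b, supp g (z b)).
Local Notation st := (@kill_state K st0 u gam d al z).
Local Notation F a := (@half_block K 'I_2 ord0 s0 (zone al z a)).

(** Stretches of [j] zones in a padded word; [(ord0, ord0)] is the padding letter and [e] the parity
    of the first zone. *)
Definition mid_words j : seq (seq (option B)) := flatten [seq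
  [seq take j (drop e (zones m)) | m <- sparse_words (ord0, ord0) (uphalf (j + e))] |
  e <- [:: 0%N; 1%N]].

Lemma size_mid_words j : (size (mid_words j) <= (j + 3) * #|{: B}|)%N.
Proof.
rewrite size_bind !big_cons big_nil !addn0 !size_map.
have hsp k := @size_sparse_words {: B} (ord0, ord0) k.
apply: leq_trans (leq_add (hsp _) (hsp _)) _.
rewrite -mulnDl leq_mul2r; apply/orP; right; have := uphalf_sum j; lia.
Qed.

(** At the first level [r] may be 1, and the factor of order [2 ^ n] in the squares of the cut ranks
    could not be absorbed by [r ^ 33]. Here the old letters are the generators, so pieces of
    half-blocks are counted by position, the sum over all cuts of a zone being of order
    [2 ^ gam]. *)
Lemma first_window_span p (Q := (p %/ s)%N) (A := #|{: B}|.+1) (SF := ((1 + 2 * A) * 2 ^ gam)%N) :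
  valid st -> (p <= s * 2 * h)%N ->
  window_span (spread st h) p (1 + (p.+1 + (p.+1 * (SF + A) + 2 ^ g) +
    (p.+1 * (p.+1 * A + SF) +
     if (s < p + g)%N then
       (s0.+1 * A + SF) * (Q.+1 * ((Q + 3) * #|{: B}| * (SF + A + s.+1))) else 0))).
Proof.
move=> vst ph.
have sgt0 : (0 < s)%N by lia.
have sy : forall a, supp g (zone al z a) by apply: zone_supp.
have cA : #|{: option B}| = A by rewrite card_option.
have c2 : #|'I_2| = 2 by rewrite card_ord.
have D1 : (1 < #|'I_2|)%N by rewrite c2.
pose Mid j := [seq tev s (map (fun a => F a) m) | m <- mid_words j].
exists (@zone_family K 'I_2 ord0 s0 gam _ (zone al z) p Q Mid).
  have sc (X : Type) (a : X) I O W : size (a :: I ++ O ++ W) = (1 + (size I + (size O + size W)))%N.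
    by rewrite /= !size_cat.
  rewrite sc leq_add2l; apply: leq_add.
    by have := @inners_size K 'I_2 ord0 gam _ (zone al z) p D1; rewrite c2 cA.
  apply: leq_add; first by have := @one_zone_size K 'I_2 ord0 gam _ (zone al z) p D1; rewrite c2 cA.
  case: ifP => // _.
  have := @two_zones_size K 'I_2 ord0 s0 gam _ (zone al z) Q Mid ((Q + 3) * #|{: B}|)%N D1.
  rewrite c2 cA; apply => j jQ; rewrite size_map; apply: leq_trans (size_mid_words j) _.
  by rewrite leq_mul2r leq_add2r jQ orbT.
move=> S U V hp.
have wk : forall b, @word_of K st b =1 kill_word ord0 s0 gam al z b.
  move=> b w; apply: comp_base_word => b'; exact: kill_word_supp.
have e w : ev S (U ++ w ++ V) =
    tev s (map (fun a => F a) (zones (spread_seq h S))) (U ++ w ++ V).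
  rewrite ev_spread // /ev -kill_word_flat (_ : len st = s * 2)%N ?(mul1n, muln1) //=.
    exact: eq_tev.
  by rewrite [LHS]mul1n.
have sS : size (spread_seq h S) = (size S * h)%N by apply: size_spread_seq.
apply: (dspan_ext (fun w => esym (e w))).
apply: zone_family_span => //.
  rewrite size_zones sS; apply: leq_trans hp; rewrite /= mul1n.
  by rewrite -muln2; apply/eq_leq; ring.
move=> Z1 m Z3 eZ Z1p Z3p hm.
have mQ : (size m <= Q)%N by rewrite leq_divRL //; lia.
split=> //.
have [c [S1 [m' [S3 [c2' eS sm' em]]]]] := zones_infix eZ.
apply: (@dspan_map _ _ _ _ (fun m => tev s (map (fun a => F a) m))).
(* Strictness, due to the pieces at both ends, keeps the stretch within [h] letters even if it
   starts in the middle of one. *)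
have jh : (size m < 2 * h)%N.
  have : (s * size m < s * (2 * h))%N by lia.
  by rewrite ltn_pmul2l.
apply/flattenP; exists [seq take (size m) (drop c (zones m')) |
    m' <- sparse_words (ord0, ord0) (uphalf (size m + c))].
  by apply/mapP; exists c => //; case: c c2' {sm' em} => [|[]].
apply/mapP; exists m'; last exact: em.
rewrite -sm'; apply: mem_sparse_words.
apply: (@spread_infix K st h h0 S _ _ _ eS); rewrite sm'.
rewrite leq_uphalf_double -muln2; move: jh c2' => /=; clear; slia.
Qed.

End FirstUpper.
Local Open Scope nat_scope.

(** * Numerical estimates *)

Lemma one_zone_bound p A SF B2 R : 0 < R -> 16 <= p -> A <= 17 * R -> SF <= 420 * p * R ->
  B2 <= 128 * p ^ 2 * R ->
  1 + (p.+1 + (p.+1 * (SF + A) + B2) + p.+1 * (p.+1 * A + SF)) <= 1100 * p ^ 2 * R.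
Proof.
move=> R0 p16 hA hSF hB.
have h1 : p.+1 * (SF + A) <= p.+1 * (420 * p * R + 17 * R) by rewrite leq_mul2l leq_add.
have h2 : p.+1 * (p.+1 * A + SF) <= p.+1 * (p.+1 * (17 * R) + 420 * p * R).
  by rewrite leq_mul2l leq_add // leq_mul2l hA.
have h3 : 1 + (p.+1 + (p.+1 * (420 * p + 17) + 128 * p ^ 2) + p.+1 * (p.+1 * 17 + 420 * p)) <=
    1100 * p ^ 2.
  by have -> : p = (p - 16) + 16; [lia | move: (p - 16) => q; rewrite !expnS expn0; nia].
have h4 : (1 + (p.+1 + (p.+1 * (420 * p + 17) + 128 * p ^ 2) + p.+1 * (p.+1 * 17 + 420 * p))) * R
    <= 1100 * p ^ 2 * R by rewrite leq_mul2r h3 orbT.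
apply: leq_trans h4; have h5 : p.+1 <= p.+1 * R by rewrite leq_pmulr.
apply: leq_trans (_ : R + (p.+1 * R + (p.+1 * (420 * p * R + 17 * R) + 128 * p ^ 2 * R) +
   p.+1 * (p.+1 * (17 * R) + 420 * p * R)) <= _); last by apply/eq_leq; ring.
by apply: leq_add => //; apply: leq_add h2; apply: leq_add h5 _; apply: leq_add h1 hB.
Qed.

(** The inequality [3 * sg < 4 * p] makes all factors multiples of [p]. The bound [256 <= sg], due
    to the absence of levels below 8, brings the constant 58 * 16 * 37 * 35 / (3 * 256 ^ 2) below
    7. *)
Lemma two_zone_bound p sg s0 A SF D Q H R : 0 < R -> 256 <= sg -> 3 * sg < 4 * p -> s0 <= sg ->
  H ^ 2 <= 2 * sg -> SF <= 280 * H * R -> A <= 17 * R -> D <= 16 * R -> Q * sg <= p ->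
  (s0.+1 * A + SF) * (Q.+1 * ((Q + 3) * D * (SF + A + sg.+1))) <= 7 * p ^ 4 * R ^ 3.
Proof.
move=> R0 sg256 sp s0s hH hSF hA hD hQ.
have p193 : 193 <= p by lia.
have hH8 : 8 * H <= p.
  rewrite -(leq_exp2r _ _ (e := 2)) // expnMn.
  apply: leq_trans (_ : 72 * H ^ 2 <= _); first by rewrite leq_mul2r orbT.
  have h1 : 72 * H ^ 2 <= 144 * sg by lia.
  apply: (leq_trans h1); apply: leq_trans (_ : 192 * p <= _); first by lia.
  by rewrite expnS expn1 leq_mul2r; lia.
have hSF' : SF <= 35 * p * R.
  by apply: leq_trans hSF _; rewrite leq_mul2r; lia.
have a1 : s0.+1 * A + SF <= 58 * p * R.
  apply: leq_trans (_ : sg.+1 * (17 * R) + 35 * p * R <= _).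
    by rewrite leq_add // leq_mul.
  by rewrite mulnA -mulnDl leq_mul2r; lia.
have a2 : SF + A + sg.+1 <= 37 * p * R.
  apply: leq_trans (_ : 35 * p * R + 17 * R + sg.+1 * R <= _).
    by rewrite !leq_add // leq_pmulr.
  by rewrite -!mulnDl leq_mul2r; lia.
apply: leq_trans (_ : 58 * p * R * (Q.+1 * ((Q + 3) * (16 * R) * (37 * p * R))) <= _).
  by rewrite !leq_mul.
have -> : 58 * p * R * (Q.+1 * ((Q + 3) * (16 * R) * (37 * p * R))) =
  16 * 2146 * (Q.+1 * (Q + 3)) * p ^ 2 * R ^ 3 by ring.
rewrite leq_mul2r; apply/orP; right.
have -> : 7 * p ^ 4 = 7 * p ^ 2 * p ^ 2 by ring.
rewrite leq_mul2r; apply/orP; right.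
have h1 : Q.+1 * sg * 3 <= 7 * p by lia.
have h2 : (Q + 3) * sg <= 5 * p by lia.
have h3 : (Q.+1 * sg * 3) * ((Q + 3) * sg) <= 7 * p * (5 * p) by apply: leq_mul.
have h4 : 256 * 256 <= sg * sg by apply: leq_mul.
have h5 : (Q.+1 * (Q + 3)) * (256 * 256) <= (Q.+1 * (Q + 3)) * (sg * sg) by rewrite leq_mul2l h4 orbT.
have h6 : (Q.+1 * sg * 3) * ((Q + 3) * sg) = 3 * ((Q.+1 * (Q + 3)) * (sg * sg)) by ring.
have h7 : 7 * p * (5 * p) = 35 * p ^ 2 by ring.
move: h3 h5; rewrite h6 h7.
move: (Q.+1 * (Q + 3) * (sg * sg)) (p ^ 2) (Q.+1 * (Q + 3)) => a b c. lia.
Qed.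

(** [sg] is the length of a half-block, [H] approximates its square root, and [R = r ^ 7]. When two
    zones can be met, 8 = 1 + 7: the families with at most one zone take [p ^ 4 * R ^ 3], those with
    two zones 7 times as much, and [R ^ 3 = r ^ 21]. *)
Lemma first_bound p sg s0 g A SF D Q H R r B2 : 0 < r -> R = r ^ 7 -> 256 <= sg -> sg <= p ^ 2 ->
  s0 <= sg -> 4 * g <= sg ->
  H ^ 2 <= 2 * sg -> SF <= 280 * H * R -> A <= 17 * R -> D <= 16 * R -> Q * sg <= p ->
  B2 <= 64 * H ^ 2 * R ->
  1 + (p.+1 + (p.+1 * (SF + A) + B2) + (p.+1 * (p.+1 * A + SF) +
    if sg < p + g then (s0.+1 * A + SF) * (Q.+1 * ((Q + 3) * D * (SF + A + sg.+1))) else 0))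
  <= 8 * p ^ 4 * r ^ 33.
Proof.
move=> r0 eR sg256 sp s0s gs hH hSF hA hD hQ hB.
have R0 : 0 < R by rewrite eR expn_gt0 r0.
have p16 : 16 <= p by rewrite -(leq_exp2r _ _ (e := 2)) //; apply: leq_trans sp.
have hHp : 2 * H <= 3 * p.
  rewrite -(leq_exp2r _ _ (e := 2)) // !expnMn; lia.
have o := @one_zone_bound p A SF B2 R R0 p16 hA.
have {}o : 1 + (p.+1 + (p.+1 * (SF + A) + B2) + p.+1 * (p.+1 * A + SF)) <= 1100 * p ^ 2 * R.
  apply: o; first by apply: leq_trans hSF _; rewrite leq_mul2r; lia.
  by apply: leq_trans hB _; rewrite leq_mul2r; lia.
have p4 : p ^ 4 = p ^ 2 * p ^ 2 by rewrite -expnD.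
have r21 : R ^ 3 <= r ^ 33 by rewrite eR -expnM leq_pexp2l.
have r7 : R <= r ^ 33 by rewrite eR leq_pexp2l.
case: ltnP => hc; last first.
  rewrite addn0; apply: (leq_trans o); apply: leq_trans (_ : 8 * p ^ 4 * R <= _).
    have -> : 8 * p ^ 4 = 8 * p ^ 2 * p ^ 2 by rewrite p4 -mulnA.
    rewrite !leq_mul2r; apply/orP; right; apply/orP; right.
    have h : 16 ^ 2 <= p ^ 2 by rewrite leq_exp2r.
    lia.
  by rewrite leq_mul2l r7 orbT.
have sp' : 3 * sg < 4 * p by lia.
have t := @two_zone_bound p sg s0 A SF D Q H R R0 sg256 sp' s0s hH hSF hA hD hQ.
have p193 : 193 <= p by lia.
have o' : 1100 * p ^ 2 * R <= 1 * p ^ 4 * R ^ 3.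
  apply: leq_mul; last by rewrite -{1}[R]expn1 leq_pexp2l.
  rewrite mul1n p4 leq_mul2r; apply/orP; right.
  have h : 193 ^ 2 <= p ^ 2 by rewrite leq_exp2r.
  lia.
apply: leq_trans (_ : 1 * p ^ 4 * R ^ 3 + 7 * p ^ 4 * R ^ 3 <= _); last first.
  by rewrite -!mulnDl; apply: leq_mul.
rewrite !addnA; rewrite !addnA in o; apply: leq_add t; exact: leq_trans o o'.
Qed.

(** With [L <= 2 p ^ 2] and [L (Q + 1) <= 3 p ^ 2] the total is at most 1 + (4 + 9) p ^ 4 S ^ 2 D,
    and [2 S ^ 2 D <= r ^ 33] brings this below the constant 8. *)
Lemma next_bound p n L Q S D r : 8 <= n -> L = 2 ^ n.+1 -> 2 ^ n <= p ^ 2 -> Q * L <= p ->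
  1 < r -> 0 < D -> 2 * (S ^ 2 * D) <= r ^ 33 ->
  1 + L * (L * (S * S)) + L * (L * (Q.+1 * (S * (Q.+1 * D * S)))) <= 8 * p ^ 4 * r ^ 33.
Proof.
move=> n8 eL hp hQ r1 D0 hS.
have p16 : 16 <= p.
  by rewrite -(leq_exp2r _ _ (e := 2)) //; apply: leq_trans hp; rewrite (leq_pexp2l (m := 2) (n1 := 8)).
have hL : L <= 2 * p ^ 2 by rewrite eL expnS leq_mul2l.
have hLQ : L * Q.+1 <= 3 * p ^ 2.
  have : 16 * p <= p ^ 2 by rewrite expnS expn1 leq_mul2r p16 orbT.
  rewrite mulnS [L * Q]mulnC; lia.
have e1 : L * (L * (S * S)) + L * (L * (Q.+1 * (S * (Q.+1 * D * S)))) =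
  L ^ 2 * S ^ 2 + (L * Q.+1) ^ 2 * (S ^ 2 * D) by ring.
rewrite -addnA e1; set Y := S ^ 2 * D in hS *.
have hSY : S ^ 2 <= Y by rewrite leq_pmulr.
have p4 : p ^ 4 = (p ^ 2) ^ 2 by rewrite -expnM.
have h1 : L ^ 2 * S ^ 2 <= 4 * p ^ 4 * Y.
  apply: leq_mul => //; rewrite p4; apply: leq_trans (_ : (2 * p ^ 2) ^ 2 <= _).
    by rewrite leq_exp2r.
  by rewrite expnMn.
have h2 : (L * Q.+1) ^ 2 * Y <= 9 * p ^ 4 * Y.
  apply: leq_mul => //; rewrite p4; apply: leq_trans (_ : (3 * p ^ 2) ^ 2 <= _).
    by rewrite leq_exp2r.
  by rewrite expnMn.
have h3 : p ^ 4 * (2 * Y) <= p ^ 4 * r ^ 33 by rewrite leq_mul2l hS orbT.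
have h4 : 0 < p ^ 4 * r ^ 33 by rewrite muln_gt0 !expn_gt0; lia.
move: h1 h2 h3 h4; move: (L ^ 2 * _) ((L * _) ^ 2 * _) => a b.
move: (p ^ 4) (r ^ 33) => c d; nia.
Qed.

Lemma exists_exponent D N : 1 < D -> 1 < N -> exists g, [/\ 0 < g, N <= D ^ g & D ^ g < N * D].
Proof.
move=> D1 N1; have /andP[h1 h2] := up_log_bounds D1 N1.
have g0 : 0 < up_log D N by rewrite lt0n; apply: contraTneq h2 => ->; rewrite expn0 -ltnNge.
exists (up_log D N); split=> //.
by rewrite -[up_log D N](prednK g0) expnSr ltn_pmul2r // ltnW.
Qed.

(* The outcome of killing the r relations of degrees in (2 ^ m, 2 ^ m.+1]. The
   bound in [level_rk] is the invariant: at the next level n it gives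
   40 len S ^ 2 #|letters| ^ 3 <= r n, which is what [next_cond] needs. *)
Record level (K : fieldType) (m r : nat) (st : state K) : Prop := Level {
  level_valid : valid st;
  level_len : len st = 2 ^ m.+1;
  level_letters : 16 <= #|letters st| <= 16 * r ^ 6;
  level_many : r ^ 4 <= 2 * #|letters st|;
  level_rk : exists S, [/\ pre_rk (len st) (@word_of K st) S,
    suf_rk (len st) (@word_of K st) S, #|letters st| <= S &
    S ^ 2 * #|letters st| ^ 3 <= 2 ^ (m + 29) * r ^ 31];
  level_half : has_half st (2 ^ m);
  level_span : forall h p, 0 < h -> 2 ^ m <= p ^ 2 -> p <= len st * h ->
    window_span (spread st h) p (8 * p ^ 4 * r ^ 33)
}.

Definition extends (K : fieldType) (st st' : state K) :=
  (forall ws, killed st ws -> killed st' ws) /\ emb st st'.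

Definition level_rel (K : fieldType) n (f : nat * seq (K * seq 'I_2)) :=
  homog f.1 f.2 /\ 5 * 2 ^ (n - 2) < f.1 < 7 * 2 ^ (n - 2).

Section Kill.
Variables (K : fieldType) (st : state K) (a b u gam d n : nat).
Hypotheses (vst : valid st) (ha : pre_rk (len st) (@word_of K st) a)
  (hb : suf_rk (len st) (@word_of K st) b).
Local Notation g := (2 * gam).
Local Notation D := #|letters st|.
Hypotheses (gam0 : 0 < gam) (gu : g <= u) (D1 : 1 < D) (n2 : 2 <= n)
  (eL : len st * u = 2 ^ (n - 2)).

Lemma kill_level fs (X := size fs * (len st * (a * b))) :
  allp (level_rel n) fs ->
  X * (8 * u + 2 * D ^ gam) < D ^ g ->
  X * D * (24 * u + 10 * D ^ gam) + d.+1 <= D ^ (g - 1) ->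
  exists al z, let st' := @kill_state K st u gam d al z in
    [/\ valid st', len st' = 2 ^ n.+1, has_half st' (2 ^ n),
      supp g al /\ (forall b, supp g (z b)) &
      [/\ extends st st', allp (fun f => killed st' f.2) fs,
        pre_rk (len st') (@word_of K st') (d.+1 * D * D ^ gam * a) &
        suf_rk (len st') (@word_of K st') (d.+1 * D * D ^ gam * b)]].
Proof.
move=> hf X1 X2.
have en : 2 ^ n = len st * u * 4 by rewrite eL -(expnD 2 _ 2) subnK.
have gf : allp (good_rel st u) fs.
  apply: allp_sub hf => f [h1 h2]; split=> //.
  by rewrite -!mulnA [u * _]mulnC eL.
have [al [be [sal al0 sbe bei k]]] := exists_kill vst ha hb gam0 gu D1 gf X1 X2.
exists al, (fun b => tens (g - 1) (be b.1) (delta K [:: b.2])) => /=.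
have s4 : (4 * u - g + g) = 4 * u by lia.
have [rk1 rk2] := kill_state_rk vst ha hb gam0 gu sal sbe.
split=> //.
- exact: kill_state_valid.
- by rewrite /= s4 expnS en; ring.
- rewrite en -mulnA [u * 4]mulnC -{1}s4; exact: kill_state_half.
- split=> // bb; exact: z_supp.
split=> //; split.
  by move=> ws; apply: comp_killed.
exact: kill_state_emb.
Qed.

End Kill.

(** This is twice the count of [exists_killers] for two letters and 8 r ^ 4 zones, since
    [B ^ 2 = 2 * 2 ^ (2 gam - 1)]. As [r] may be small, the term in [u] is compensated by [H ^ 2]
    and not by [r]. *)
Lemma first_cond u H R r B : 0 < r -> B = 8 * H * R -> 4 * u <= H ^ 2 -> 16 <= H -> r ^ 2 <= R ->
  2 * (r * 2 * (24 * u + 10 * B) + 8 * r ^ 4) <= B ^ 2.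
Proof.
move=> r0 eB hu H16 hR.
have rR : r <= R by apply: leq_trans hR; rewrite expnS expn1 leq_pmulr.
have R1 : R <= R ^ 2 by rewrite expnS expn1 leq_pmulr //; lia.
have a1 : r * (4 * u) <= R ^ 2 * H ^ 2 by apply: leq_mul => //; apply: leq_trans rR R1.
have a2 : r * R * (16 * H) <= R ^ 2 * H ^ 2.
  by rewrite !(expnS _ 1) !expn1 !leq_mul.
have a3 : r ^ 4 * 1 <= R ^ 2 * H ^ 2.
  apply: leq_mul; last by rewrite expn_gt0; lia.
  by rewrite (expnM r 2 2) leq_exp2r.
apply: leq_trans (_ : 24 * (r * (4 * u)) + 20 * (r * R * (16 * H)) + 16 * (r ^ 4 * 1) <= _).
  by rewrite eB; apply/eq_leq; ring.
rewrite eB (_ : (8 * H * R) ^ 2 = 64 * (R ^ 2 * H ^ 2)); [lia | by ring].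
Qed.

Lemma expn_ge n : 5 <= n -> 2 ^ n >= n + 10 + n.
Proof.
elim: n => // n IH; rewrite leq_eqVlt => /orP[/eqP <- //|h].
by have := IH h; rewrite expnS; lia.
Qed.

Lemma half_split n : 8 <= n -> 8 * (2 ^ (n./2 - 3)) <= 2 ^ (n - 3).
Proof. by move=> n8; rewrite -[8]/(2 ^ 3) -expnD leq_pexp2l //; lia. Qed.

(** [R] is a power of 2 between [r ^ 2] and [r ^ 3]: one exists because powers of 2 grow by the
    factor 2 <= r, while r = 1 leaves R = 1. The bound on [r] keeps its exponent small enough for
    the zone to fit. *)
Lemma first_exponent n r : 8 <= n -> 0 < r -> r < 2 ^ (2 ^ (n./2 - 3)) -> exists gam R,
  [/\ 0 < gam, 2 * gam <= 2 ^ (n - 2), 2 ^ gam = 8 * 2 ^ uphalf n * R & r ^ 2 <= R <= r ^ 3].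
Proof.
move=> n8 r0 hr; set t := 2 ^ (n./2 - 3) in hr.
have [rho [h1 h2 h3]] : exists rho, [/\ r ^ 2 <= 2 ^ rho, 2 ^ rho <= r ^ 3 & rho <= 3 * t].
  have [->|r1] := eqVneq r 1; first by exists 0.
  have r2 : 1 < r by lia.
  have [g [_ ha hb]] := @exists_exponent 2 (r ^ 2) isT ltac:(by rewrite -{1}(exp1n 2) ltn_exp2r).
  have hc : 2 ^ g <= r ^ 3.
    by apply: leq_trans (ltnW hb) _; rewrite (expnSr r 2) leq_mul2l r2 orbT.
  exists g; split=> //; rewrite -(leq_exp2l (m := 2)) // mulnC expnM.
  by apply: leq_trans hc _; rewrite leq_exp2r // ltnW.
exists (uphalf n + 3 + rho), (2 ^ rho); split.
- lia.
- have e := half_split n8; rewrite -/t in e.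
  have e2 : 2 ^ (n - 2) = 2 ^ (n - 3) + 2 ^ (n - 3).
    by rewrite addnn -mul2n -expnS; congr (2 ^ _); lia.
  have e3 := @expn_ge (n - 3) ltac:(lia).
  have e4 : uphalf n + uphalf n <= n.+1 by rewrite addnn uphalf_half; lia.
  lia.
- by rewrite !expnD -[2 ^ 3]/8; ring.
by rewrite h1.
Qed.

Section FirstKill.
Variable K : fieldType.

Lemma first_kill r n (fs : seq (nat * seq (K * seq 'I_2))) : 8 <= n -> 0 < r ->
  r < 2 ^ (2 ^ (n./2 - 3)) -> size fs = r -> allp (level_rel n) fs ->
  exists st', [/\ level n r st', extends (base K) st' & allp (fun f => killed st' f.2) fs].
Proof.
move=> n8 r0 hr sf hf.
have [gam [R [gam0 gu eB /andP[R2 R3]]]] := first_exponent n8 r0 hr.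
set H := 2 ^ uphalf n in eB; set u := 2 ^ (n - 2) in gu.
have c2 : #|letters (base K)| = 2 by rewrite card_ord.
have hn : n <= (uphalf n).*2 <= n.+1 by rewrite uphalf_half; lia.
have H2 : 2 ^ n <= H ^ 2 <= 2 * 2 ^ n.
  by rewrite -expnM muln2 -expnS !leq_pexp2l //; case/andP: hn.
have H16 : 16 <= H by rewrite (leq_pexp2l (m := 2) (n1 := 4)) //; lia.
have eu : 2 ^ n = 4 * u by rewrite /u -(expnD 2 2); congr (2 ^ _); lia.
have fc := @first_cond u H R r _ r0 eB ltac:(lia) H16 R2.
have eg : 2 ^ (2 * gam) = (2 ^ gam) ^ 2 by rewrite mulnC expnM.
have eg1 : 2 * 2 ^ (2 * gam - 1) = (2 ^ gam) ^ 2.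
  by rewrite -eg -expnS; congr (2 ^ _); lia.
(* With the two old letters this makes 16 r ^ 4 new ones, at least 16 for every [r], as the choice
   of [gam] at the next level requires. *)
have [d ed] : exists d, d.+1 = 8 * r ^ 4.
  by exists (8 * r ^ 4).-1; rewrite prednK // muln_gt0 expn_gt0 r0.
have r4 : 0 < r ^ 4 by rewrite expn_gt0 r0.
have := @kill_level K (base K) 1 1 u gam d n (base_valid K)
  (@base_pre K) (@base_suf K) gam0 gu ltac:(by rewrite c2) ltac:(lia) (mul1n _) fs hf.
rewrite c2 sf !muln1 eg; case.
- apply: leq_trans fc; move: r4; rewrite !mulnDr; move: (2 ^ gam) (r ^ 4) => B R'; nia.
- rewrite -(leq_pmul2l (m := 2)) // eg1 ed; exact: fc.
move=> al [z [v' el hh [sal sz] [ext kk rk1 rk2]]].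
set st' := kill_state u gam al z in v' el hh ext kk rk1 rk2.
have cD : #|letters st'| = 16 * r ^ 4.
  by rewrite /st' /= card_prod card_ord c2 ed; ring.
exists st'; split=> //; split=> //.
- rewrite cD; have : r ^ 4 <= r ^ 6 by rewrite leq_pexp2l.
  by lia.
- by rewrite cD; lia.
- rewrite ed in rk1 rk2; exists (8 * r ^ 4 * 2 * 2 ^ gam); split=> //.
    by rewrite cD (_ : 8 * r ^ 4 * 2 = 16 * r ^ 4) ?leq_pmulr ?expn_gt0 //; ring.
  rewrite cD eB.
  have -> : (8 * r ^ 4 * 2 * (8 * H * R)) ^ 2 * (16 * r ^ 4) ^ 3 =
    16 ^ 5 * 64 * (H ^ 2 * (R ^ 2 * r ^ 20)) by ring.
  have -> : 2 ^ (n + 29) * r ^ 31 = 16 ^ 5 * 64 * (8 * 2 ^ n * r ^ 31).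
    by rewrite expnD -[29]/(20 + 6 + 3) !expnD -(expnM 2 4 5); ring.
  rewrite leq_mul2l; apply/orP; right; apply: leq_mul; first by lia.
  apply: leq_trans (_ : (r ^ 3) ^ 2 * r ^ 20 <= _).
    by rewrite leq_mul2r leq_exp2r ?R3 ?orbT.
  by rewrite -expnM -expnD leq_pexp2l.
move=> h p h0 hp pl.
have s4 : 4 * u - 2 * gam + 2 * gam = 2 ^ n by lia.
have r47 : r ^ 4 <= r ^ 7 by rewrite leq_pexp2l.
have R7 : 0 < r ^ 7 by rewrite expn_gt0 r0.
apply: window_span_leq (@first_window_span K u gam d h al z gam0 gu h0 sal sz p v' _); last first.
  by apply: leq_trans pl _; rewrite el s4 expnSr.
have cD' : #|{: 'I_d.+1 * letters (base K)}| = 16 * r ^ 4 by rewrite -cD.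
rewrite cD' s4; apply: (@first_bound p (2 ^ n) _ _ _ _ _ _ H _ r) => //.
- by rewrite (leq_pexp2l (m := 2) (n1 := 8)).
- lia.
- lia.
- by case/andP: H2.
- rewrite eB; apply: leq_trans (_ : 35 * r ^ 4 * (8 * H * r ^ 3) <= _).
    apply: leq_mul; first by lia.
    by rewrite leq_mul2l R3 orbT.
  by apply/eq_leq; ring.
- lia.
- lia.
- exact: leq_trunc_div.
- rewrite eg eB (_ : (8 * H * R) ^ 2 = 64 * H ^ 2 * R ^ 2); last by ring.
  rewrite leq_mul2l; apply/orP; right; apply: leq_trans (_ : (r ^ 3) ^ 2 <= _).
    by rewrite leq_exp2r.
  by rewrite -expnM leq_pexp2l.
Qed.

End FirstKill.

(** From [D ^ (gam - 1) < N < 4 ^ u] and [D >= 4 ^ 2] follows [2 gam - 2 < u]; evenness of [u]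
    excludes [u = 2 gam - 1]. *)
Lemma next_exponent D N u : 16 <= D -> 1 < N -> N < 4 ^ u -> ~~ odd u -> exists gam,
  [/\ 0 < gam, 2 * gam <= u, N <= D ^ gam & D ^ gam < N * D].
Proof.
move=> D16 N1 Nu ou; have [gam [g0 h1 h2]] := @exists_exponent D N ltac:(lia) N1.
exists gam; split=> //.
have h3 : D ^ gam.-1 < N.
  by move: h2; rewrite -{1}(prednK g0) expnSr ltn_pmul2r //; lia.
have h4 : 4 ^ (2 * gam.-1) < 4 ^ u.
  rewrite (expnM 4 2); apply: leq_ltn_trans Nu; apply: ltnW; apply: leq_ltn_trans h3.
  by case: (gam.-1) => // k; rewrite leq_exp2r.
rewrite ltn_exp2l // in h4.
have : u != 2 * gam - 1 by apply: contraNneq ou => ->; rewrite oddB ?oddM //=; lia.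
lia.
Qed.

(** The lower and upper bounds on [r] are compatible only if [3 n + 4 < 2 ^ (n - m - 3)], which
    forces levels to be at least 9 apart. *)
Lemma next_numbers m n q r : 0 < q -> 8 <= m -> m < n -> 2 ^ (3 * n + 4) * q ^ 33 < r ->
  r < 2 ^ (2 ^ (n - m - 3)) -> m + 9 <= n /\ 17 <= n.
Proof.
move=> q0 m8 mn h1 h2.
have h3 : 2 ^ (3 * n + 4) < 2 ^ (2 ^ (n - m - 3)).
  apply: leq_ltn_trans h2; apply: ltnW; apply: leq_ltn_trans h1.
  by rewrite leq_pmulr // expn_gt0 q0.
rewrite ltn_exp2l // in h3.
have : 5 < n - m - 3.
  rewrite ltnNge; apply: contraL h3 => h; rewrite -leqNgt.
  case: (leqP n 9) => n9; first by rewrite (_ : n - m - 3 = 0) //; lia.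
  by apply: leq_trans (_ : 2 ^ 5 <= _); [rewrite leq_pexp2l | lia].
lia.
Qed.

Lemma next_size m n q r L S D : 0 < q -> m + 9 <= n -> 17 <= n -> 2 ^ (3 * n + 4) * q ^ 33 < r ->
  L <= 2 ^ (n - 8) -> S ^ 2 * D ^ 3 <= 2 ^ (m + 29) * q ^ 31 -> 40 * (L * (S ^ 2 * D ^ 3)) <= r.
Proof.
move=> q0 mn n17 hr hL hS; apply: leq_trans (ltnW hr).
apply: leq_trans (_ : 2 ^ 6 * (2 ^ (n - 8) * (2 ^ (m + 29) * q ^ 31)) <= _).
  by apply: leq_mul => //; apply: leq_mul.
rewrite (mulnA (2 ^ 6)) -expnD (mulnA (2 ^ (6 + _))) -expnD; apply: leq_mul; first by rewrite leq_pexp2l //; lia.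
by rewrite leq_pexp2l.
Qed.

(** The dependence on the previous level is absorbed by [r]. From [d <= r ^ 4 D ^ 2] and
    [B <= r ^ 2 D] the left side is at most [r ^ 24 D ^ 11 (S ^ 2 D ^ 3)], of degree 66 + 31 = 97 in
    [q]. Since 97 <= 99, three factors [r], each above [2 ^ (3 n + 4) q ^ 33], suffice. *)
Lemma next_ranks m n q r D S B d : 0 < q -> m < n -> 17 <= n -> 2 ^ (3 * n + 4) * q ^ 33 < r ->
  D <= 16 * q ^ 6 -> S ^ 2 * D ^ 3 <= 2 ^ (m + 29) * q ^ 31 -> B <= r ^ 2 * D -> d <= B ^ 2 ->
  d <= 16 * r ^ 6 /\ (d * B * (D * S)) ^ 2 * d ^ 3 <= 2 ^ (n + 29) * r ^ 31.
Proof.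
move=> q0 mn n17 hr hD hS hB hd.
have r1 : 1 < r.
  apply: leq_ltn_trans hr; rewrite -[1]muln1 leq_mul // expn_gt0 ?q0 //.
have hd' : d <= r ^ 4 * D ^ 2.
  apply: leq_trans hd _; apply: leq_trans (_ : (r ^ 2 * D) ^ 2 <= _).
    by rewrite leq_exp2r.
  by apply/eq_leq; ring.
have q12 : 2 ^ (3 * n + 4) * q ^ 12 <= r.
  apply: leq_trans (ltnW hr); rewrite leq_mul2l leq_pexp2l ?orbT //.
have D2 : D ^ 2 <= r.
  apply: leq_trans q12; apply: leq_trans (_ : (16 * q ^ 6) ^ 2 <= _).
    by rewrite leq_exp2r.
  rewrite expnMn -expnM leq_mul2r -[16]/(2 ^ 4) -expnM leq_pexp2l ?orbT //; lia.
split.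
  apply: leq_trans hd' _; apply: leq_trans (_ : r ^ 4 * r <= _).
    by rewrite leq_mul2l D2 orbT.
  by rewrite -expnSr; apply: leq_trans (_ : r ^ 6 <= _); [rewrite leq_pexp2l //; lia | lia].
apply: leq_trans (_ : (r ^ 4 * D ^ 2) ^ 5 * (r ^ 2 * D) ^ 2 * (D ^ 2 * S ^ 2) <= _).
  have -> : (d * B * (D * S)) ^ 2 * d ^ 3 = d ^ 5 * B ^ 2 * (D ^ 2 * S ^ 2) by ring.
  by rewrite leq_mul2r; apply/orP; right; apply: leq_mul; rewrite leq_exp2r.
have -> : (r ^ 4 * D ^ 2) ^ 5 * (r ^ 2 * D) ^ 2 * (D ^ 2 * S ^ 2) =
  r ^ 24 * (D ^ 11 * (S ^ 2 * D ^ 3)) by ring.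
apply: leq_trans (_ : r ^ 24 * ((16 * q ^ 6) ^ 11 * (2 ^ (m + 29) * q ^ 31)) <= _).
  by rewrite leq_mul2l; apply/orP; right; apply: leq_mul; rewrite ?leq_exp2r.
have -> : r ^ 24 * ((16 * q ^ 6) ^ 11 * (2 ^ (m + 29) * q ^ 31)) =
   2 ^ (m + 73) * q ^ 97 * r ^ 24.
  have -> : (16 * q ^ 6) ^ 11 = 2 ^ 44 * q ^ 66.
    by rewrite expnMn -(expnM q) -[16]/(2 ^ 4) -(expnM 2).
  have -> : 2 ^ (m + 73) = 2 ^ 44 * 2 ^ (m + 29) by rewrite -expnD; congr (2 ^ _); lia.
  have -> : q ^ 97 = q ^ 66 * q ^ 31 by rewrite -expnD.
  by move: (2 ^ 44) (2 ^ (m + 29)) => x y; ring.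
rewrite (_ : r ^ 31 = r ^ 7 * r ^ 24); last by rewrite -expnD.
rewrite mulnA leq_mul2r; apply/orP; right.
apply: leq_trans (_ : r ^ 3 <= _).
  apply: leq_trans (_ : (2 ^ (3 * n + 4) * q ^ 33) ^ 3 <= _); last by rewrite leq_exp2r // ltnW.
  rewrite expnMn -!expnM; apply: leq_mul; first by rewrite leq_pexp2l //; lia.
  by rewrite leq_pexp2l.
rewrite -[r ^ 3]mul1n; apply: leq_mul; first by rewrite expn_gt0.
by rewrite leq_pexp2l //; lia.
Qed.

(** The invariant gives [40 X D ^ 2 <= r ^ 2 <= B], and [24 u + 10 B <= 20 B], so the conditions use
    at most half of the unknowns. One factor [D] is the cost of the free last letter, the other
    turns [D ^ (2 gam - 1)] into [B ^ 2]. *)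
Lemma next_cond r D S L u B : 0 < D -> 0 < r -> 40 * (L * (S ^ 2 * D ^ 3)) <= r -> r ^ 2 <= B ->
  16 * u <= B -> let X := r * (L * (S * (D * S))) in
  2 * (X * D * (24 * u + 10 * B) * D) <= B ^ 2 /\ X * (8 * u + 2 * B) < B ^ 2.
Proof.
move=> D0 r0 hr hB hu X.
have B0 : 0 < B by apply: leq_trans hB; rewrite expn_gt0 r0.
have e1 : X * D * D = r * (L * (S ^ 2 * D ^ 3)) by rewrite /X; ring.
have h1 : 40 * (X * D * D) <= B.
  by apply: leq_trans hB; rewrite e1 mulnCA (expnS _ 1) expn1 leq_mul2l hr orbT.
have h2 : 24 * u + 10 * B <= 20 * B by lia.
have h3 : 40 * (X * D * D) * (24 * u + 10 * B) <= B * (20 * B) by apply: leq_mul.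
have e2 : B * (20 * B) = 20 * B ^ 2 by ring.
have e3 : 40 * (X * D * D) * (24 * u + 10 * B) = 20 * (2 * (X * D * (24 * u + 10 * B) * D)) by ring.
have h4 : 2 * (X * D * (24 * u + 10 * B) * D) <= B ^ 2.
  by move: h3; rewrite e2 e3 leq_mul2l.
split=> //.
have B2 : 0 < B ^ 2 by rewrite expn_gt0 B0.
have h5 : 2 * (X * (8 * u + 2 * B)) <= B ^ 2.
  apply: leq_trans h4; rewrite leq_mul2l /=.
  have -> : X * D * (24 * u + 10 * B) * D = X * (D * D * (24 * u + 10 * B)) by ring.
  rewrite leq_mul2l; apply/orP; right; apply: leq_trans (_ : 1 * (24 * u + 10 * B) <= _).
    by lia.
  by rewrite leq_mul2r muln_gt0 D0 orbT.
lia.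
Qed.

Lemma exists_pred G W : 0 < G -> 2 * W <= G ->
  exists d, [/\ d.+1 = G - W, W + d.+1 <= G & G <= 2 * d.+1].
Proof. by move=> G0 hW; exists (G - W).-1; split; lia. Qed.

Section NextKill.
Variable K : fieldType.

(** The previous level enters only through its block length, its number [D] of letters and its cut
    rank [S]; padding keeps the prefix rank [S] and makes the suffix rank [D * S]. *)
Lemma next_kill m q n r (st0 : state K) (fs : seq (nat * seq (K * seq 'I_2))) h :
  h = 2 ^ (maxn m.+1 (uphalf n) - m.+1) ->
  level m q st0 -> 0 < q -> 8 <= m -> m < n -> 2 ^ (3 * n + 4) * q ^ 33 < r ->
  r < 2 ^ (2 ^ (n - m - 3)) -> r < 2 ^ (2 ^ (n./2 - 3)) -> size fs = r -> allp (level_rel n) fs ->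
  exists st', [/\ level n r st', extends (spread st0 h) st' & allp (fun f => killed st' f.2) fs].
Proof.
move=> eh [v0 el0 /andP[D16 D6] _ [S [pS sS DS hS]] _ _] q0 m8 mn hr hr1 hr2 sf hf.
have [mn9 n17] := next_numbers q0 m8 mn hr hr1.
move: hr1 hr2.
set D := #|letters st0| in D16 D6 DS hS.
set l := maxn m.+1 (uphalf n) in eh.
have ln : l <= n - 8 by rewrite geq_max uphalf_half; lia.
have l2 : 0 < n - 2 - l by lia.
have l4 : l + (n - 2 - l) = n - 2 by lia.
have n5 : 5 <= 3 * n + 4 by lia.
have l3 : 4 + (n - 2 - l) <= 3 * n + 4 by lia.
have ml : m.+1 <= l by rewrite leq_maxl.
have h0 : 0 < h by rewrite eh expn_gt0.
have v := spread_valid v0 h0.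
have eL : len (spread st0 h) = 2 ^ l by rewrite /= el0 eh -expnD subnKC.
have pS' := spread_pre v0 h0 pS; have sS' := spread_suf v0 h0 sS.
rewrite -/D in sS'.
set u := 2 ^ (n - 2 - l).
have eu : len (spread st0 h) * u = 2 ^ (n - 2) by rewrite eL -expnD l4.
have rbig : 2 ^ (3 * n + 4) <= r.
  by apply: leq_trans (ltnW hr); rewrite leq_pmulr // expn_gt0 q0.
have r52 : 2 ^ 5 <= r by apply: leq_trans rbig; rewrite leq_pexp2l.
have r1 : 1 < r by lia.
have r0 : 0 < r by lia.
have ou : ~~ odd u by rewrite oddX /= orbF -lt0n.
have u16' : 16 * u <= r.
  by apply: leq_trans rbig; rewrite /u -(expnD 2 4) leq_pexp2l.
move=> hr1 hr2; have ru : r < 2 ^ u.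
  (* The two values of [l] call for the two doubly exponential bounds on [r]. *)
  have [e|e] : l = m.+1 \/ l = uphalf n by rewrite /l /maxn; case: ifP; auto.
    have eq1 : n - 2 - l = n - m - 3 by rewrite e; clear; lia.
    by rewrite /u eq1.
  apply: leq_trans hr2 _; rewrite leq_exp2l // leq_exp2l //.
  by rewrite e uphalf_half; clear; lia.
have N4 : r ^ 2 < 4 ^ u by rewrite -[4]/(2 ^ 2) -(expnM 2) mulnC expnM ltn_exp2r.
have N1 : 1 < r ^ 2 by rewrite -(exp1n 2) ltn_exp2r.
clearbody u; have [gam [gam0 gu hB1 hB2]] := next_exponent D16 N1 N4 ou.
clear N4 ru hr1 hr2.
set B := D ^ gam in hB1 hB2.
have D0 : 0 < D by apply: leq_trans D16.
have hrL : 40 * (2 ^ l * (S ^ 2 * D ^ 3)) <= r.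
  by apply: next_size hr _ hS; rewrite // leq_pexp2l.
have u16 : 16 * u <= B.
  apply: leq_trans hB1; apply: leq_trans (_ : r <= _); last by rewrite (expnS _ 1) leq_pmulr ?expn1.
  exact: u16'.
have [c1 c2] := next_cond D0 r0 hrL hB1 u16.
set X := r * _ in c1 c2.
have eg : D ^ (2 * gam) = B ^ 2 by rewrite mulnC expnM.
have eg1 : D ^ (2 * gam - 1) * D = B ^ 2.
  by rewrite -eg -expnSr subn1 prednK // muln_gt0.
set G := D ^ (2 * gam - 1) in eg1.
have c3 : 2 * (X * D * (24 * u + 10 * B)) <= G.
  by move: c1; rewrite -eg1 mulnA leq_pmul2r.
have G0 : 0 < G by rewrite expn_gt0 D0.
(* All remaining dimensions are used: at least half of the [G] unknowns are left, so with the free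
   last letter there are at least [B ^ 2 / 2 >= r ^ 4 / 2] new letters. *)
have [d [ed dG1 dG2]] := exists_pred G0 c3.
have := @kill_level K (spread st0 h) S (D * S) u gam d n v pS' sS' gam0 gu
  ltac:(by apply: leq_trans D16) ltac:(by apply: leq_trans n17) eu fs hf.
rewrite -[#|letters (spread st0 h)|]/D eL sf -/B eg -/X -/G; case=> //.
move=> al [z [v' el hh _ [ext kk rk1 rk2]]].
set st' := kill_state u gam al z in v' el hh ext kk rk1 rk2.
set Dn := d.+1 * D in rk1 rk2.
have cD : #|letters st'| = Dn by rewrite /st' /= card_prod card_ord.
have Dn1 : B ^ 2 <= 2 * Dn.
  by rewrite -eg1 /Dn mulnA leq_mul2r dG2 orbT.
have Dn2 : Dn <= B ^ 2 by rewrite -eg1 /Dn leq_mul2r ed leq_subr orbT.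
have Bb : B <= B ^ 2 by rewrite (expnS _ 1) leq_pmulr ?expn1 // expn_gt0 D0.
have r2b : r * 32 <= r ^ 2 by rewrite (expnS _ 1) expn1 leq_mul2l r52 orbT.
have Dn16 : 16 <= Dn by move: Dn1 hB1 Bb r2b r1; clear; lia.
have [k1 k2] := next_ranks q0 mn n17 hr D6 hS (ltnW hB2) Dn2.
have S0 : 0 < S by apply: leq_trans DS.
have B0 : 0 < B by rewrite expn_gt0 D0.
pose Sn := Dn * B * (D * S).
have DSn : Dn <= Sn by rewrite /Sn -mulnA leq_pmulr // !muln_gt0 B0 D0.
have rk1' : Dn * B * S <= Sn by rewrite leq_mul2l leq_pmull ?orbT.
have rk3 : pre_rk (len st') (@word_of K st') Sn.
  by move=> o ho; apply: rk_leq rk1' _; apply: rk1.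
exists st'; split=> //; split=> //.
- by rewrite cD Dn16.
- rewrite cD; apply: leq_trans Dn1; rewrite (expnM r 2 2) leq_exp2r //.
- by exists Sn; split=> //; rewrite cD.
move=> h' p h'0 hp pl.
apply: window_span_leq (crude_window_span v' h'0 rk3 rk2 (leqnn _) (leqnn _) _ pl); last by rewrite cD.
rewrite cD; apply: (@next_bound p n) => //.
- exact: leq_trans n17.
- exact: leq_trunc_div.
- exact: leq_trans Dn16.
have a1 : Sn ^ 2 * Dn * 16 ^ 2 <= Sn ^ 2 * Dn ^ 3.
  by rewrite -mulnA leq_mul2l (expnS Dn 2) leq_mul2l leq_exp2r // Dn16 !orbT.
have n29 : n + 29 <= 3 * n + 4 by move: n17; clear; lia.
have a2 : 2 ^ (n + 29) <= r by apply: leq_trans rbig; rewrite leq_pexp2l.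
have a3 : 2 ^ (n + 29) * r ^ 31 <= r * r ^ 31 by rewrite leq_mul2r a2 orbT.
have a4 : r * r ^ 31 <= r ^ 33 by rewrite -expnS leq_pexp2l.
have := leq_trans a1 (leq_trans k2 (leq_trans a3 a4)).
by move: (r ^ 33) (Sn ^ 2 * Dn) => x y; clear; lia.
Qed.

End NextKill.

(** * The chain of states *)

Section Extends.
Variable K : fieldType.
Implicit Types st : state K.

Lemma extends_refl st : extends st st.
Proof. by split=> //; apply: emb_refl. Qed.

Lemma extends_trans st1 st2 st3 : extends st1 st2 -> extends st2 st3 -> extends st1 st3.
Proof. by move=> [k1 e1] [k2 e2]; split=> [ws /k1 /k2 //|]; apply: emb_trans e1 e2. Qed.

Lemma extends_spread st h : valid st -> 0 < h -> extends st (spread st h).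
Proof. by move=> v h0; split=> [ws|]; [apply: comp_killed | apply: spread_emb]. Qed.

Lemma spread_seq_nseq st h k : 0 < h ->
  spread_seq h (nseq k (letter0 st)) = nseq (k * h) (letter0 st).
Proof.
move=> h0; elim: k => // k IH; rewrite [nseq k.+1 _]/=.
rewrite -[spread_seq h (_ :: _)]/(spread_word h (letter0 st) ++ spread_seq h (nseq k (letter0 st))).
by rewrite IH /spread_word -catA mulSn (_ : h + k * h = h.-1 + (1 + k * h)) ?nseqD //; lia.
Qed.

Lemma spread_word_mul st h k (a : letters st) : 0 < h -> 0 < k ->
  spread_word (h * k) a = spread_seq h (spread_word k a).
Proof.
move=> h0 k0; rewrite {2}/spread_word /spread_seq map_cat flatten_cat.
rewrite -/(spread_seq h _) spread_seq_nseq // /= cats0 /spread_word catA -nseqD.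
by congr (nseq _ _ ++ _); case: h k h0 k0 => // h [] // k _ _; nia.
Qed.

(** A letter padded to [h * k] is a word of [k] letters padded to [h], all but the last being the
    padding letter. Increasing the padding is therefore itself a replacement of letters. *)
Lemma extends_spread_mul st h k : valid st -> 0 < h -> 0 < k ->
  extends (spread st h) (spread st (h * k)).
Proof.
move=> v h0 k0; have hk0 : 0 < h * k by rewrite muln_gt0 h0.
have vh := spread_valid v h0; have vhk := spread_valid v hk0.
pose sk (S : seq (letters st)) := flatten [seq spread_word k a | a <- S].
have eS S : spread_seq (h * k) S = spread_seq h (sk S).
  elim: S => // a S IH.
  rewrite -[LHS]/(spread_word (h * k) a ++ spread_seq (h * k) S) IH spread_word_mul //.
  by rewrite -[sk (a :: S)]/(spread_word k a ++ sk S) /spread_seq map_cat flatten_cat.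
have ee S w : @ev K (spread st (h * k)) S w = @ev K (spread st h) (sk S) w.
  by rewrite !ev_spread // eS.
split=> [ws kw S u v'|].
  by rewrite (eq_pairing (f' := fun w => @ev K (spread st h) (sk S) (u ++ w ++ v'))).
have ew a w : @word_of K (spread st (h * k)) a w =
    @ev K (spread st h) (nseq k.-1 (letter0 st) ++ [:: a]) w.
  by rewrite -(ev1 a w vhk) ee /sk /= cats0.
split; first by rewrite /= mulnA leq_pmulr.
have eL : len (spread st (h * k)) - len (spread st h) = len (spread st h) * k.-1.
  by rewrite /= mulnA -{2}[len st * h]muln1 -mulnBr subn1.
rewrite eL; exists (@ev K (spread st h) (nseq k.-1 (letter0 st))).
  apply: contrapT => hn.
  have := @ev_indep K (spread st h) k.-1 (fun s => (s == nseq k.-1 (letter0 st))%:R%R) vh.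
  move=> /(_ _ (nseq k.-1 (letter0 st))); rewrite size_nseq eqxx => hi.
  suff : (1%R : K) = 0%R by move/eqP; rewrite oner_eq0.
  apply: hi => // w; rewrite (@sum_words1 _ _ k.-1 _ (nseq k.-1 (letter0 st))) ?size_nseq //.
    rewrite eqxx mul1r; case: (eqVneq (size w) (len (spread st h) * k.-1)) => sw.
      by apply/eqP; apply: contrapT => /negP nz; apply: hn; exists w.
    by rewrite (ev_supp vh) // size_nseq.
  by move=> s _ /negPf ->; rewrite mul0r.
move=> a; exists a => u w su sw.
by rewrite ew ev_cat ?size_nseq // ev1.
Qed.

End Extends.

Section Chain.
Variables (K : fieldType) (r : nat -> nat) (fs : nat -> seq (nat * seq (K * seq 'I_2))).
Hypotheses (fs_size : forall n, size (fs n) = r n)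
  (fs_rel : forall n, allp (level_rel n) (fs n))
  (r_small : forall n, n < 8 -> r n = 0)
  (r_half : forall n, r n != 0 -> r n < 2 ^ (2 ^ (n./2 - 3)))
  (r_grow : forall m n, r m != 0 -> r n != 0 -> m < n ->
     2 ^ (3 * n + 4) * r m ^ 33 < r n /\ r n < 2 ^ (2 ^ (n - m - 3))).

(* Makes the block length at stage n the maximum of 2 ^ m.+1 and 2 ^ uphalf n.+1. *)
Definition spread_exponent m n := maxn m.+1 (uphalf n.+1) - m.+1.

Definition spread_level n (st : state K) := exists m st0,
  [/\ m <= n, r m != 0, forall m', m < m' <= n -> r m' = 0, level m (r m) st0 &
      st = spread st0 (2 ^ spread_exponent m n)].

(* Before the first level with relations nothing is done; without any such level
   the lengths must still tend to infinity, to make the quotient infinite-dimensional. *)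
Definition chain_state n (st : state K) := valid st /\
  [\/ [/\ exists2 m, n < m & r m != 0, forall m, m <= n -> r m = 0 & st = base K],
      spread_level n st | (forall m, r m = 0) /\ 2 ^ n <= len st].

Lemma chain_start : exists st, chain_state 0 st.
Proof.
exists (base K); split; first exact: base_valid.
case: (pselect (exists m, r m != 0)) => [[m rm]|h].
  apply: Or31; split=> //; first by exists m; rewrite // lt0n; apply: contraNneq rm => ->; rewrite r_small.
  by move=> m'; rewrite leqn0 => /eqP ->; rewrite r_small.
apply: Or33; split=> // m; apply/eqP; apply: contrapT => /negP rm; apply: h; by exists m.
Qed.

Lemma spread_level_valid n st : spread_level n st -> valid st.
Proof. by case=> m [st0 [_ _ _ [v _ _ _ _ _ _] ->]]; apply: spread_valid; rewrite ?expn_gt0. Qed.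

(** A level just built counts as its own padding by 1, since [spread_exponent n n = 0]. *)
Lemma new_level n st st' : r n != 0 -> extends st st' -> level n (r n) st' ->
  allp (fun f => killed st' f.2) (fs n) ->
  exists st'', [/\ spread_level n st'', extends st st'' & allp (fun f => killed st'' f.2) (fs n)].
Proof.
move=> rn e l k; have v := level_valid l.
have [k1 e1] := @extends_spread K st' 1 v isT.
exists (spread st' 1); split.
- exists n, st'; split=> //; first by move=> m' /andP[h1 h2]; exfalso; lia.
  by rewrite /spread_exponent (_ : maxn _ _ - _ = 0) //; rewrite uphalf_half; lia.
- exact: extends_trans e (conj k1 e1).
- by apply: allp_sub k => f; apply: k1.
Qed.

Lemma chain_next n st : chain_state n st -> exists st',
  [/\ chain_state n.+1 st', extends st st' & allp (fun f => killed st' f.2) (fs n.+1)].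
Proof.
move=> [v h].
have fs0 : r n.+1 = 0 -> fs n.+1 = [::] by rewrite -fs_size => /size0nil.
have big : r n.+1 != 0 -> 8 <= n.+1.
  by move=> rn; rewrite leqNgt; apply: contra rn => /r_small ->.
case: h => [[[m nm rm] z eb]|[m [st0 [mn rm z l eb]]]|[z el]].
- have [rn|rn] := eqVneq (r n.+1) 0.
    exists st; rewrite fs0 //; split=> //; last exact: extends_refl.
    split=> //; apply: Or31; split=> //.
      by exists m => //; rewrite ltn_neqAle nm andbT; apply: contraNneq rm => <-; rewrite rn.
    by move=> m'; rewrite leq_eqVlt => /orP[/eqP ->|/z].
  have [] := @first_kill K (r n.+1) n.+1 (fs n.+1) (big rn) _ (r_half rn) (fs_size _) (fs_rel _).
    by rewrite lt0n.
  move=> st1 [l1 e1 k1]; rewrite -eb in e1.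
  have [st2 [l2 e2 k2]] := new_level rn e1 l1 k1.
  exists st2; split=> //; split; [exact: spread_level_valid l2 | exact: Or32].
- have v0 := level_valid l.
  have [rn|rn] := eqVneq (r n.+1) 0.
    have se : spread_exponent m n <= spread_exponent m n.+1.
      apply: leq_sub2r; rewrite geq_max leq_maxl leq_max leq_uphalf_double.
      move: (odd_double_half n.+2); rewrite uphalf_half -muln2; lia.
    exists (spread st0 (2 ^ spread_exponent m n.+1)); rewrite fs0 //.
    have sl : spread_level n.+1 (spread st0 (2 ^ spread_exponent m n.+1)).
      exists m, st0; split=> //; first by apply: leq_trans mn _.
      move=> m' /andP[h1]; rewrite leq_eqVlt => /orP[/eqP -> //|h2]; apply: z.
      by rewrite h1.
    split=> //; first by split; [exact: spread_level_valid sl | exact: Or32].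
    rewrite eb -(subnKC se) expnD; apply: extends_spread_mul => //; by rewrite expn_gt0.
  have [g1 g2] := r_grow rm rn (mn : m < n.+1).
  have m8 : 8 <= m by rewrite leqNgt; apply: contra rm => /r_small ->.
  have [] := @next_kill K m (r m) n.+1 (r n.+1) st0 (fs n.+1) _ erefl l _ m8 _ g1 g2 (r_half rn)
    (fs_size _) (fs_rel _) => //; first by rewrite lt0n.
  move=> st1 [l1 e1 k1]; rewrite -[X in extends X _]eb in e1.
  have [st2 [l2 e2 k2]] := new_level rn e1 l1 k1.
  exists st2; split=> //; split; [exact: spread_level_valid l2 | exact: Or32].
exists (spread st 2); rewrite fs0 //; split=> //; last exact: extends_spread.
split; first exact: spread_valid.
by apply: Or33; split=> //=; rewrite expnSr leq_mul2r el orbT.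
Qed.

Lemma exists_chain : exists st : nat -> state K, forall n,
  [/\ chain_state n (st n), extends (st n) (st n.+1) &
      allp (fun f => killed (st n.+1) f.2) (fs n.+1)].
Proof.
have [s0 h0] := cid chain_start.
have hn n (s : {st | chain_state n st}) : {s' : {st | chain_state n.+1 st} |
    extends (sval s) (sval s') /\ allp (fun f => killed (sval s') f.2) (fs n.+1)}.
  case: s => st h; have [st' [h1 h2 h3]] := cid (chain_next h).
  by exists (exist _ st' h1).
pose fix ch n : {st | chain_state n st} :=
  if n is n'.+1 then sval (hn n' (ch n')) else exist _ s0 h0.
exists (fun n => sval (ch n)) => n; split; first exact: (svalP (ch n)).
  by case: (svalP (hn n (ch n))).
by case: (svalP (hn n (ch n))).
Qed.

Variable st : nat -> state K.
Hypothesis hst : forall n,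
  [/\ chain_state n (st n), extends (st n) (st n.+1) &
      allp (fun f => killed (st n.+1) f.2) (fs n.+1)].

Lemma chain_valid n : valid (st n).
Proof. by case: (hst n) => -[]. Qed.

Lemma chain_extends m n : m <= n -> extends (st m) (st n).
Proof.
elim: n => [|n IH]; first by rewrite leqn0 => /eqP ->; apply: extends_refl.
rewrite leq_eqVlt => /orP[/eqP ->|/IH h]; first exact: extends_refl.
by apply: extends_trans h _; case: (hst n).
Qed.

Lemma chain_kills m n : m <= n -> allp (fun f => killed (st n) f.2) (fs m).
Proof.
case: m => [|m] h; first by rewrite (size0nil (etrans (fs_size 0) (r_small (n := 0) isT))).
have [k _] := chain_extends h; case: (hst m) => _ _.
by apply: allp_sub => f; apply: k.
Qed.

Lemma chain_len N : exists n, N <= len (st n).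
Proof.
have pow n : n <= 2 ^ n by apply: ltnW; apply: ltn_expl.
have lev n m : spread_level n (st n) -> n <= m -> n./2 <= len (st n).
  move=> [m' [st0 [_ _ _ l ->]]] _; rewrite /= (level_len l) -expnD.
  apply: leq_trans (pow _) _; rewrite leq_pexp2l // /spread_exponent subnKC ?leq_maxl //.
  by apply: leq_trans (leq_maxr _ _); rewrite uphalf_half; lia.
case: (pselect (exists m, r m != 0)) => [[m rm]|h].
  exists (m + N.*2); case: (hst (m + N.*2)) => -[_ [[_ z _]|l|[z _]]] _ _.
  - by rewrite z ?leq_addr in rm.
  - by apply: leq_trans (lev _ _ l (leqnn _)); lia.
  - by rewrite z in rm.
exists N; case: (hst N) => -[_ [[[m _ rm] _ _]|[m [st0 [_ rm _ _ _]]]|[_ l]]] _ _.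
- by case: h; exists m.
- by case: h; exists m.
- exact: leq_trans (pow _) l.
Qed.

Lemma chain_level j : r j != 0 -> exists2 st0, level j (r j) st0 & extends st0 (st j).
Proof.
move=> rj; case: (hst j) => -[_ [[_ z _]|[m [st0 [mj rm z l ->]]]|[z _]]] _ _.
- by rewrite z in rj.
- have emj : m = j.
    apply/eqP; rewrite eqn_leq mj leqNgt; apply: contra rj => h; rewrite z //.
    by rewrite h leqnn.
  by subst m; exists st0 => //; apply: extends_spread (level_valid l) _; rewrite expn_gt0.
- by rewrite z in rj.
Qed.

(** At the stage [n] with [2 ^ n <= p ^ 2 < 2 ^ (n + 1)] the last level is [k] by maximality, and
    the padded length is at least [2 ^ uphalf (n + 1) >= p], as [level_span] requires. *)
Lemma chain_span p k : 0 < p -> r k != 0 -> 2 ^ k <= p ^ 2 ->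
  (forall k', r k' != 0 -> 2 ^ k' <= p ^ 2 -> k' <= k) ->
  exists n, window_span (st n) p (8 * p ^ 4 * r k ^ 33).
Proof.
move=> p0 rk kp kmax.
have p2 : 0 < p ^ 2 by rewrite expn_gt0 p0.
have /andP[n1 n2] := trunc_log_bounds (isT : 1 < 2) p2; set n := trunc_log 2 _ in n1 n2.
have kn : k <= n by rewrite -ltnS -(ltn_exp2l (m := 2)) //; apply: leq_ltn_trans kp n2.
exists n; case: (hst n) => -[_ [[_ z _]|[m [st0 [mn rm z l ->]]]|[z _]]] _ _.
- by rewrite z in rk.
- have emk : m = k.
    apply/eqP; rewrite eqn_leq kmax ?(leq_trans _ n1) ?leq_pexp2l //.
    by rewrite leqNgt; apply: contra rk => h; rewrite z // h.
  subst m; apply: (level_span l) => //; first by rewrite expn_gt0.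
  rewrite (level_len l) -expnD /spread_exponent subnKC ?leq_maxl //.
  apply: leq_trans (_ : 2 ^ uphalf n.+1 <= _); last by rewrite leq_pexp2l // leq_maxr.
  rewrite -(leq_exp2r _ _ (e := 2)) //; apply: leq_trans (ltnW n2) _.
  rewrite -expnM leq_pexp2l //; move: (odd_double_half n.+1); rewrite uphalf_half; lia.
- by rewrite z in rk.
Qed.

End Chain.
Local Open Scope ring_scope.

(** * The quotient algebra *)

Section LinearForms.
Variable K : fieldType.
Local Notation A := (free_alg K).
Implicit Types (a b c : A) (phi psi : seq 'I_2 -> K).

Definition coeff_words a : seq (K * seq 'I_2) := [seq (a@_w, fmonom_val w) | w <- msupp a].

Definition lin phi a : K := mmap idfun (fun w : {fmonom 'I_2} => phi w) a.

Lemma linE phi a : lin phi a = pairing phi (coeff_words a).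
Proof. by rewrite /pairing big_map. Qed.

Lemma linU phi (x : K) w : lin phi << x *g w >> = x * phi w.
Proof. exact: mmapU. Qed.

Lemma linD phi : {morph lin phi : a b / a + b}.
Proof. exact: mmapD. Qed.

Lemma linB phi : {morph lin phi : a b / a - b}.
Proof. exact: mmapB. Qed.

Lemma lin0 phi : lin phi 0 = 0.
Proof. exact: mmap0. Qed.

Lemma lin_sum phi I (s : seq I) (P : pred I) (F : I -> A) :
  lin phi (\sum_(i <- s | P i) F i) = \sum_(i <- s | P i) lin phi (F i).
Proof. exact: raddf_sum. Qed.

Lemma linZ phi (x : K) a : lin phi (x *: a) = x * lin phi a.
Proof.
rewrite /lin (mmapEw (msuppZ_le _ _)) mmapE mulr_sumr.
by apply: eq_bigr => k _; rewrite mcoeffZ mulrA.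
Qed.

Lemma eq_lin phi psi a : (forall w : {fmonom 'I_2}, w \in msupp a -> phi w = psi w) ->
  lin phi a = lin psi a.
Proof.
move=> e; rewrite /lin !mmapE big_seq [RHS]big_seq; apply: eq_bigr => w wa.
by rewrite e.
Qed.

Lemma lin_scale phi (x : K) a : lin (fun w => x * phi w) a = x * lin phi a.
Proof. by rewrite /lin !mmapE mulr_sumr; apply: eq_bigr => w _; rewrite mulrCA. Qed.

Lemma lin_mul phi b a : lin phi (b * a) =
  \sum_(m <- msupp b) b@_m * lin (fun w => phi (fmonom_val m ++ w)) a.
Proof.
rewrite malgME lin_sum; apply: eq_bigr => m _.
rewrite lin_sum mulr_sumr; apply: eq_bigr => k _.
by rewrite linU fmM mulrA.
Qed.

Lemma lin_mulr phi b a : lin phi (a * b) =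
  \sum_(m <- msupp b) b@_m * lin (fun w => phi (w ++ fmonom_val m)) a.
Proof.
rewrite malgME exchange_big lin_sum; apply: eq_bigr => m _.
rewrite lin_sum mulr_sumr; apply: eq_bigr => k _ /=.
by rewrite linU fmM mulrCA mulrA.
Qed.

Lemma lin_homogeneous phi k l a : supp k phi -> homogeneous l a -> l != k -> lin phi a = 0.
Proof.
move=> sp ha lk; rewrite /lin mmapE big1_seq // => w /andP[_ wa].
by rewrite sp ?mulr0 // -[size _]/(fdeg w) (ha w wa).
Qed.

Lemma homogeneous_coeff_words k a : homogeneous k a -> homog k (coeff_words a).
Proof.
by move=> ha p /mapP[w wa ->]; apply: ha.
Qed.

Lemma homogeneous0 k : homogeneous k (0 : A).
Proof. by move=> w; rewrite msupp0. Qed.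

Lemma homogeneousP k (x : K) a b : homogeneous k a -> homogeneous k b -> homogeneous k (x *: a + b).
Proof.
move=> ha hb w /(fsubsetP (msuppD_le _ _)); rewrite inE => /orP[|/hb //].
by move/(fsubsetP (msuppZ_le _ _))/ha.
Qed.

Lemma homogeneous1 : homogeneous 0 (1 : A).
Proof. by move=> w; rewrite msuppU1 inE => /eqP ->; apply: fdeg1. Qed.

Lemma homogeneousM k l a b : homogeneous k a -> homogeneous l b -> homogeneous (k + l) (a * b).
Proof.
move=> ha hb w /msuppM_le [w1 [w2 [w1a w2b ->]]].
by rewrite fdegM (ha _ w1a) (hb _ w2b).
Qed.

Definition component k a : A := \sum_(w <- msupp a | fdeg w == k) << a@_w *g w >>.

Lemma component_homogeneous k a : homogeneous k (component k a).
Proof.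
rewrite /component; apply: (big_ind (homogeneous k)) => [|b c hb hc|w /eqP wk].
- exact: homogeneous0.
- by rewrite -[b]scale1r; apply: homogeneousP.
- by move=> v /(fsubsetP msuppU_le); rewrite inE => /eqP ->.
Qed.

Lemma sum_component N a : (forall w, w \in msupp a -> (fdeg w < N)%N) ->
  a = \sum_(k < N) component k a.
Proof.
move=> h; rewrite {1}(monalgE a) /component; under [RHS]eq_bigr do rewrite big_mkcond.
rewrite exchange_big /= big_seq [RHS]big_seq.
apply: eq_bigr => w wa; rewrite (bigD1 (Ordinal (h w wa))) //= eqxx big1 ?addr0 // => i.
by case: (fdeg w =P i) => // e /eqP[]; apply: val_inj.
Qed.

Lemma degree_bound a : exists N, forall w, w \in msupp a -> (fdeg w < N)%N.
Proof. by exists (@mmeasure _ K (@fdeg 'I_2) a) => w; apply: mmeasure_mnm_lt. Qed.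

End LinearForms.

Section Quotient.
Variables (K : fieldType) (E : free_alg K -> Prop).
Local Notation A := (free_alg K).
Hypotheses (EP : forall (x : K) a b, E a -> E b -> E (x *: a + b)) (E0 : E 0)
  (EM : forall a b, E a -> E (b * a)) (EMr : forall a b, E a -> E (a * b)) (E1 : ~ E 1).

(** The ideal [E] is presented as generated by the family of all its elements, so that [quot_alg]
    applies to it. *)
Let gen (a : {a | E a}) : A := sval a.
Local Notation R := (quot_alg gen).

Lemma gen_idealE a : gen_ideal gen a <-> E a.
Proof.
split=> [[s ->]|Ea].
  apply: (big_ind E) => // [b c Eb Ec|t _]; first by rewrite -[b]scale1r; apply: EP.
  by apply/EMr/EM; apply: (svalP t.1.2).
by exists [:: (1, exist _ a Ea, 1)]; rewrite big_seq1 mul1r mulr1.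
Qed.

Lemma quotient_nonzero : (1 : R) != 0.
Proof.
apply/eqP => e; apply: E1; apply/gen_idealE.
by rewrite -[1]subr0; apply/quot_projE; rewrite raddf0 [LHS]e.
Qed.

Fact quotient_scalerAl (x : K) (u v : R) : x *: (u * v) = x *: u * v.
Proof.
case: (quot_projP u) (quot_projP v) => a -> [b ->].
by rewrite -rmorphM -!linearZ -rmorphM scalerAl.
Qed.

Fact quotient_scalerAr (x : K) (u v : R) : x *: (u * v) = u * (x *: v).
Proof.
case: (quot_projP u) (quot_projP v) => a -> [b ->].
rewrite -rmorphM -!linearZ -rmorphM; congr (quot_proj gen _).
apply/malgP => k.
rewrite mcoeffZ mcoeffMl (mcoeffMlw _ (fsubset_refl _) (msuppZ_le _ _)) mulr_sumr.
apply: eq_bigr => k1 _; rewrite mulr_sumr; apply: eq_bigr => k2 _.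
by rewrite mcoeffZ mulrnAr mulrCA.
Qed.

HB.instance Definition _ := GRing.PzSemiRing_isNonZero.Build R quotient_nonzero.
HB.instance Definition _ := GRing.Lmodule_isLalgebra.Build K R quotient_scalerAl.
HB.instance Definition _ := GRing.Lalgebra_isAlgebra.Build K R quotient_scalerAr.

Lemma exists_quotient : exists (R : algType K) (p : {rmorphism A -> R}),
  [/\ scalable p, forall u, exists a, p a = u & forall a, p a = 0 <-> E a].
Proof.
exists (R : algType K), (quot_proj gen : {rmorphism A -> R}); split.
- by move=> x a; apply: linearZ.
- by move=> u; exists (repr u); apply: quot_projK.
move=> a; rewrite -gen_idealE; have := quot_projE gen a 0; rewrite subr0.
by rewrite (raddf0 (quot_proj gen)).
Qed.

End Quotient.

Section Descend.
Variables (K : fieldType) (J : Type) (f : J -> free_alg K) (R : algType K)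
  (p : {rmorphism free_alg K -> R}).
Hypotheses (pZ : scalable p) (pf : forall i, p (f i) = 0).

Definition descend (x : quot_alg f) : R := p (repr x).

Lemma descendE a : descend (quot_proj f a) = p a.
Proof.
apply/eqP; rewrite -subr_eq0 -rmorphB; apply/eqP.
have [s ->] := repr_quot_proj f a.
by rewrite rmorph_sum big1 // => t _; rewrite !rmorphM pf mulr0 mul0r.
Qed.

Fact descend_zmod : zmod_morphism descend.
Proof.
move=> x y; case: (quot_projP x) (quot_projP y) => a -> [b ->].
by rewrite -raddfB !descendE rmorphB.
Qed.

Fact descend_monoid : monoid_morphism descend.
Proof.
split; first by rewrite -(rmorph1 p) -descendE rmorph1.
move=> x y; case: (quot_projP x) (quot_projP y) => a -> [b ->].
by rewrite -rmorphM !descendE rmorphM.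
Qed.

HB.instance Definition _ := GRing.isZmodMorphism.Build (quot_alg f) R descend descend_zmod.
HB.instance Definition _ := GRing.isMonoidMorphism.Build (quot_alg f) R descend descend_monoid.

Lemma exists_descend : exists phi : {rmorphism quot_alg f -> R},
  scalable phi /\ forall a, phi (quot_proj f a) = p a.
Proof.
exists (descend : {rmorphism quot_alg f -> R}); split; last exact: descendE.
move=> x u; case: (quot_projP u) => a ->.
by rewrite -linearZ /= !descendE pZ.
Qed.

End Descend.

Section Dimension.
Variables (K : fieldType) (V : lmodType K) (W : V -> Prop).

Definition indep D (b : 'I_D -> V) := forall c : 'I_D -> K,
  \sum_i c i *: b i = 0 -> forall i, c i = 0.

Lemma exists_dim N :
  (forall b : 'I_N.+1 -> V, (forall i, W (b i)) -> ~ indep b) ->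
  exists2 D, has_dim W D & (D <= N)%N.
Proof.
move=> hN; pose P D := `[< exists b : 'I_D -> V, (forall i, W (b i)) /\ indep b >].
have P0 : exists D, P D.
  exists 0%N; apply/asboolP; exists (fun _ => 0); split=> [[]//|c _ []//].
have PN D : P D -> (D <= N)%N.
  move=> /asboolP[b [Wb ib]]; rewrite leqNgt; apply/negP => ND.
  apply: (hN (fun i => b (widen_ord ND i))) => // c hc i.
  pose c' (j : 'I_D) := if insub (val j) is Some i' then c i' else 0.
  have hw (i' : 'I_N.+1) : c' (widen_ord ND i') = c i' by rewrite /c' /= valK.
  rewrite -hw; apply: ib; rewrite (bigID (fun j : 'I_D => (j < N.+1)%N)) /=.
  rewrite [X in _ + X]big1 ?addr0; last first.
    by move=> j jN; rewrite /c' insubN ?scale0r.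
  rewrite -[RHS]hc (big_ord_narrow ND); apply: eq_bigr => j _; by rewrite hw.
case: (ex_maxnP P0 PN) => D /asboolP[b [Wb ib]] Dmax.
exists D; last by apply: PN; apply/asboolP; exists b.
exists b; split=> // v Wv; apply: contrapT => nv.
suff : P D.+1 by move/Dmax; rewrite ltnn.
pose b' (i : 'I_D.+1) := if unlift ord_max i is Some j then b j else v.
have bm : b' ord_max = v by rewrite /b' unlift_none.
have bl j : b' (lift ord_max j) = b j by rewrite /b' liftK.
apply/asboolP; exists b'; split=> [i|c].
  by rewrite /b'; case: unlift.
rewrite big_ord_recr /= bm => hc.
have e : \sum_(i < D) c (widen_ord (leqnSn D) i) *: b i + c ord_max *: v = 0.
  rewrite -[RHS]hc; congr (_ + _); apply: eq_bigr => i _.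
  by rewrite -(bl i); congr (_ *: b' _); apply: val_inj; rewrite /= /bump leqNgt ltn_ord.
have c0 : c ord_max = 0.
  apply: contrapT => /eqP cn; apply: nv.
  exists (fun i => - (c ord_max)^-1 * c (widen_ord (leqnSn D) i)).
  have -> : v = - (c ord_max)^-1 *: (\sum_(i < D) c (widen_ord (leqnSn D) i) *: b i).
    have /eqP := e; rewrite addrC addr_eq0 => /eqP h.
    by rewrite scaleNr -scalerN -h scalerA mulVf // scale1r.
  by rewrite scaler_sumr; apply: eq_bigr => i _; rewrite scalerA.
move: e; rewrite c0 scale0r addr0 => /ib h i.
case: (unliftP ord_max i) => [j ->|->] //.
by rewrite -(h j); congr c; apply: val_inj; rewrite /= /bump leqNgt ltn_ord.
Qed.

End Dimension.

Section Vanishing.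
Variables (K : fieldType) (st : nat -> state K).
Local Notation A := (free_alg K).
Hypotheses (vst : forall n, valid (st n))
  (mst : forall m n, (m <= n)%N -> extends (st m) (st n)).

Definition vanishing (a : A) := exists n, killed (st n) (coeff_words a).

Lemma killedE n (a : A) : killed (st n) (coeff_words a) <->
  forall s u v, lin (fun w => @ev K (st n) s (u ++ w ++ v)) a = 0.
Proof. by split=> h s u v; [rewrite linE h | rewrite -linE h]. Qed.

Lemma vanishingP (x : K) a b : vanishing a -> vanishing b -> vanishing (x *: a + b).
Proof.
move=> [m hm] [n hn]; exists (maxn m n).
have {}hm := (mst (leq_maxl m n)).1 _ hm; have {}hn := (mst (leq_maxr m n)).1 _ hn.
apply/killedE => s u v; move/killedE: hm => hm; move/killedE: hn => hn.
by rewrite linD linZ hm hn mulr0 addr0.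
Qed.

Lemma vanishing0 : vanishing 0.
Proof. by exists 0%N; apply/killedE => s u v; rewrite lin0. Qed.

Lemma vanishingMl a b : vanishing a -> vanishing (b * a).
Proof.
move=> [n /killedE h]; exists n; apply/killedE => s u v.
rewrite lin_mul big1 // => m _; rewrite -[RHS](mulr0 b@_m) -[X in _ = _ * X](h s (u ++ m) v).
by congr (_ * _); apply: eq_lin => w _; rewrite -!catA.
Qed.

Lemma vanishingMr a b : vanishing a -> vanishing (a * b).
Proof.
move=> [n /killedE h]; exists n; apply/killedE => s u v.
rewrite lin_mulr big1 // => m _; rewrite -[RHS](mulr0 b@_m) -[X in _ = _ * X](h s u (m ++ v)).
by congr (_ * _); apply: eq_lin => w _; rewrite -!catA.
Qed.

Lemma vanishing1 : ~ vanishing 1.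
Proof.
move=> [n /killedE /(_ [::] [::] [::])]; rewrite linU /ev /= fm1 /= mulr1 => /eqP.
by rewrite oner_eq0.
Qed.

(** Each functional defining the ideal lives in a single degree, so it sees the homogeneous
    components one at a time. *)
Lemma vanishing_homogeneous N (a : nat -> A) : (forall i, homogeneous i (a i)) ->
  vanishing (\sum_(i < N) a i) -> forall i, (i < N)%N -> vanishing (a i).
Proof.
move=> ha [n /killedE h] i iN; exists n; apply/killedE => s u v.
set phi := fun w => _.
have sphi : exists k, supp k phi.
  exists (len (st n) * size s - size u - size v)%N => w sw; apply: (ev_supp (vst n)).
  by rewrite !size_cat; apply: contraNneq sw => e; apply/eqP; slia.
have [k sk] := sphi.
have [ik|ik] := eqVneq i k; last exact: lin_homogeneous sk (ha i) ik.
rewrite -[RHS](h s u v) -/phi lin_sum (bigD1 (Ordinal iN)) //= big1 ?addr0 // => j ji.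
apply: lin_homogeneous sk (ha j) _; rewrite -ik; apply: contraNneq ji => e.
by apply/eqP/val_inj.
Qed.

(** By [emb], a nonzero multiple of the letter is a left translate of a letter of every later state;
    one of these states kills [a]. *)
Lemma vanishing_letter (st0 : state K) j b u0 a : valid st0 -> extends st0 (st j) ->
  vanishing a -> lin (fun w => @word_of K st0 b (u0 ++ w)) a = 0.
Proof.
move=> v0 e0 [n kn]; pose N := maxn n j.
have /killedE {}kn := (mst (leq_maxl n j : n <= N)%N).1 _ kn.
have [_ [le [z [u1 su1 zu1] hz]]] := extends_trans e0 (mst (leq_maxr n j : j <= N)%N).
have [b' hb] := hz b.
apply: (mulfI zu1); rewrite mulr0 -lin_scale -[RHS](kn [:: b'] (u1 ++ u0) [::]).
apply: eq_lin => w _; rewrite cats0 ev1 // -catA.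
case: (eqVneq (size (u0 ++ w)) (len st0)) => sw; first by rewrite hb.
rewrite (word_supp v0) // mulr0 (word_supp (vst N)) // size_cat su1.
by apply: contraNneq sw => e; apply/eqP; slia.
Qed.

Lemma window_span_vanishing n P N : window_span (st n) P N ->
  exists2 F : seq (seq 'I_2 -> K), (size F <= N)%N &
    forall a, (forall w, w \in msupp a -> (fdeg w <= P)%N) ->
      allp (fun phi => lin phi a = 0) F -> vanishing a.
Proof.
move=> [F sF hF]; exists F => // a ha hFa; exists n => s u v.
case: (leqP (len (st n) * size s) (size u + size v + P)) => h.
  by apply: (hF s u v h); apply: allp_sub hFa => phi; rewrite linE.
rewrite -linE /lin mmapE big1_seq // => w /andP[_ wa].
rewrite (ev_supp (vst n)) ?mulr0 // !size_cat -[size w]/(fdeg w).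
by have := ha w wa; apply: contraTneq => e; rewrite -ltnNge; slia.
Qed.

End Vanishing.

(** * Grading and dimensions of the quotient *)

Section Graded.
Variables (K : fieldType) (R : algType K) (p : {rmorphism free_alg K -> R})
  (E : free_alg K -> Prop).
Local Notation A := (free_alg K).
Hypotheses (pZ : scalable p) (psurj : forall u, exists a, p a = u)
  (pE : forall a, p a = 0 <-> E a)
  (Ehom : forall N (a : nat -> A), (forall i, homogeneous i (a i)) ->
     E (\sum_(i < N) a i) -> forall i, (i < N)%N -> E (a i)).

Definition graded_part n (u : R) := exists2 a, homogeneous n a & u = p a.
Local Notation G := graded_part.

Lemma graded_partE (c : nat -> R) : (forall i, G i (c i)) ->
  exists a : nat -> A, forall i, homogeneous i (a i) /\ c i = p (a i).
Proof.
move=> hc; have [a ha] : {a : nat -> A & forall i, homogeneous i (a i) /\ c i = p (a i)}.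
  by apply: (@choice _ _ (fun i a => homogeneous i a /\ c i = p a)) => i;
     have [a h1 h2] := hc i; exists a.
by exists a.
Qed.

Lemma quotient_grading : grading G.
Proof.
split.
- by move=> n; exists 0; [apply: homogeneous0 | rewrite rmorph0].
- move=> n x u v [a ha ->] [b hb ->]; exists (x *: a + b); first exact: homogeneousP.
  by rewrite rmorphD pZ.
- by exists 1; [apply: homogeneous1 | rewrite rmorph1].
- move=> m n u v [a ha ->] [b hb ->]; exists (a * b); first exact: homogeneousM.
  by rewrite rmorphM.
- move=> u; have [a <-] := psurj u; have [N hN] := degree_bound a.
  exists N, (fun k => p (component k a)); split=> [i|].
    by exists (component i a) => //; apply: component_homogeneous.
  by rewrite {1}(sum_component hN) rmorph_sum.
move=> N c /graded_partE[a ha] e i iN.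
have [_ ->] := ha i; apply/pE; apply: (Ehom (N := N)) => //.
  by move=> j; case: (ha j).
apply/pE; rewrite rmorph_sum -[RHS]e; apply: eq_bigr => j _; by case: (ha j) => _ ->.
Qed.

Lemma degree_leE n u : degree_le G n u <->
  exists2 a, (forall w, w \in msupp a -> (fdeg w <= n)%N) & u = p a.
Proof.
split=> [[c [/graded_partE[a ha] ->]]|[a ha ->]].
  exists (\sum_(i < n.+1) a i).
    have : forall i : 'I_n.+1, forall w, w \in msupp (a i) -> (fdeg w <= n)%N.
      by move=> i w /(ha i).1 ->; rewrite -ltnS.
    move=> h; apply: (big_ind (fun b : A => forall w, w \in msupp b -> (fdeg w <= n)%N)) => //.
    - by move=> w; rewrite msupp0.
    - by move=> b b' hb hb' w /(fsubsetP (msuppD_le _ _)); rewrite inE => /orP[/hb|/hb'].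
    by move=> i _; apply: h.
  by rewrite rmorph_sum; apply: eq_bigr => i _; case: (ha i).
exists (fun k => p (component k a)); split.
  by move=> i; exists (component i a) => //; apply: component_homogeneous.
by rewrite {1}(@sum_component _ n.+1 a) // rmorph_sum.
Qed.

Lemma dim_upper n N (F : seq (seq 'I_2 -> K)) : (size F <= N)%N ->
  (forall a, (forall w, w \in msupp a -> (fdeg w <= n)%N) ->
     allp (fun phi => lin phi a = 0) F -> E a) ->
  exists2 D, has_dim (degree_le G n) D & (D <= N)%N.
Proof.
move=> sF hF; apply: exists_dim => b hb ib.
have [a ha] : {a : 'I_N.+1 -> A & forall i,
    (forall w, w \in msupp (a i) -> (fdeg w <= n)%N) /\ b i = p (a i)}.
  apply: (@choice _ _ (fun i a => (forall w, w \in msupp a -> (fdeg w <= n)%N) /\ b i = p a)) => i.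
  by have /degree_leE[a h1 h2] := hb i; exists a.
have [|c [l cl] hc] := @exists_dependency K N.+1 nat (iota 0 (size F))
  (fun i l => lin (nth (fun=> 0) F i) (a l)); first by rewrite size_iota.
move/eqP: cl; apply; apply: (ib c).
transitivity (p (\sum_i c i *: a i)).
  by rewrite rmorph_sum; apply: eq_bigr => i _; case: (ha i) => _ ->; rewrite pZ.
apply/pE/hF.
  move: c {hc} => c; apply: (big_ind (fun b : A => forall w, w \in msupp b -> (fdeg w <= n)%N)) => //.
  - by move=> w; rewrite msupp0.
  - by move=> b' c' hb' hc' w /(fsubsetP (msuppD_le _ _)); rewrite inE => /orP[/hb'|/hc'].
  by move=> i _ w /(fsubsetP (msuppZ_le _ _)); case: (ha i) => h _; apply: h.
apply/(allpP _ (fun=> 0)) => i iF; rewrite lin_sum -[RHS](hc i) ?mem_iota //.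
by apply: eq_bigr => j _; rewrite linZ.
Qed.

Lemma dim_exists n : exists D, has_dim (degree_le G n) D.
Proof.
have [ws hws] : exists ws : seq (seq 'I_2), forall w, (size w <= n)%N -> w \in ws.
  exists (flatten [seq words 'I_2 k | k <- iota 0 n.+1]) => w wn.
  by apply/flatten_mapP; exists (size w); rewrite ?mem_words // mem_iota ltnS.
pose F := [seq delta K w | w <- ws].
have [||D hD _] := @dim_upper n (size F) F; [by [] | | by exists D].
move=> a ha hF; suff -> : a = 0 by apply/pE; rewrite rmorph0.
apply/malgP => w; rewrite mcoeff0.
have [wa|/mcoeff_outdom //] := boolP (w \in msupp a).
move/allp_map/allp_mem: hF => /(_ (fmonom_val w)).
rewrite /lin mmapE (bigD1_seq w) //= {1}/delta eqxx mulr1 big1 ?addr0; last first.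
  by move=> v vw; rewrite /delta -fmP (negPf vw) mulr0.
apply; apply: hws; exact: ha.
Qed.

(** If [D < #|T|], some nontrivial combination of the [Q b] vanishes on representatives of a basis.
    As the [Q b] vanish on [E], it vanishes on all words of length [m], against independence. *)
Lemma dim_lower n m (T : finType) (Q : T -> seq 'I_2 -> K) D :
  (m <= n)%N -> (forall b a, E a -> lin (Q b) a = 0) ->
  (forall e : T -> K, (forall w, size w = m -> \sum_b e b * Q b w = 0) -> forall b, e b = 0) ->
  has_dim (degree_le G n) D -> (#|T| <= D)%N.
Proof.
move=> mn QE Qi [b [Wb _ span]]; rewrite leqNgt; apply/negP => DT.
have [a ha] : {a : 'I_D -> A & forall i, b i = p (a i)}.
  by apply: (@choice _ _ (fun i a => b i = p a)) => i; have [a ha] := psurj (b i); exists a.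
have [|c [l cl] hc] := @exists_dependency K #|T| _ (enum 'I_D)
  (fun i l => lin (Q (enum_val l)) (a i)); first by rewrite size_enum_ord.
move/eqP: cl; apply; rewrite -(enum_valK l).
apply: (Qi (fun t => c (enum_rank t))) => w sw.
pose W : A := << FMonom w >>.
have [|x hx] := span (p W).
  by apply/degree_leE; exists W => // v /(fsubsetP msuppU_le); rewrite inE => /eqP ->; rewrite /fdeg /= sw.
have Ew : E (W - \sum_i x i *: a i).
  apply/pE; rewrite rmorphB rmorph_sum hx; apply/eqP; rewrite subr_eq0; apply/eqP.
  by apply: eq_bigr => i _; rewrite pZ ha.
transitivity (\sum_t c (enum_rank t) * \sum_i x i * lin (Q t) (a i)).
  apply: eq_bigr => t _; congr (_ * _); have := QE t _ Ew.
  rewrite linB linU mul1r => /eqP; rewrite subr_eq0 => /eqP ->.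
  by rewrite lin_sum; apply: eq_bigr => i _; rewrite linZ.
under eq_bigr do rewrite mulr_sumr; rewrite exchange_big big1 // => i _.
transitivity (x i * \sum_l c l * lin (Q (enum_val l)) (a i)); last by rewrite hc ?mulr0 ?mem_enum.
rewrite mulr_sumr [RHS](reindex (@enum_rank T)) /=; last first.
  by apply: onW_bij; apply: enum_rank_bij.
by apply: eq_bigr => t _; rewrite enum_rankK mulrCA.
Qed.

(** Representatives of a finite spanning set have bounded degree, so a functional living in a higher
    degree kills them all and, vanishing on [E], would kill every word. *)
Lemma quotient_infinite : (forall N, exists phi m w,
    [/\ (N <= m)%N, supp m phi, phi w != 0 & forall a, E a -> lin phi a = 0]) ->
  infinite_dim R.
Proof.
move=> h D [b [_ _ span]].
have [a ha] : {a : 'I_D -> A & forall i, b i = p (a i)}.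
  by apply: (@choice _ _ (fun i a => b i = p a)) => i; have [a ha] := psurj (b i); exists a.
have [B hB] : {B : 'I_D -> nat & forall i w, w \in msupp (a i) -> (fdeg w < B i)%N}.
  by apply: (@choice _ _ (fun i N => forall w, w \in msupp (a i) -> (fdeg w < N)%N)) => i; apply: degree_bound.
have [phi [m [w [Nm sphi phiw hphi]]]] := h (\max_i B i)%N.
pose W : A := << FMonom w >>.
have [x hx] := span (p W) I.
have Ew : E (W - \sum_i x i *: a i).
  apply/pE; rewrite rmorphB rmorph_sum hx; apply/eqP; rewrite subr_eq0; apply/eqP.
  by apply: eq_bigr => i _; rewrite pZ ha.
move/eqP: phiw; apply; have := hphi _ Ew.
rewrite linB linU mul1r lin_sum big1 ?subr0 // => i _.
rewrite linZ /lin mmapE big1_seq ?mulr0 // => v /andP[_ va].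
rewrite sphi ?mulr0 // -[size _]/(fdeg v) neq_ltn (leq_trans (hB i v va)) //.
by apply: leq_trans Nm; apply: leq_bigmax.
Qed.

End Graded.
Local Open Scope classical_set_scope.
Local Open Scope card_scope.
Local Open Scope ring_scope.

(** * From real exponents to natural numbers *)

Section Reals.
Variable F : realType.

Lemma tower_bound (x : F) (N k : nat) :
  x <= k%:R -> (N%:R : F) < 2 `^ (2 `^ x) -> (N < 2 ^ (2 ^ k))%N.
Proof.
move=> xk h; rewrite -(ltr_nat F) natrX; apply: lt_le_trans h _.
rewrite -powR_mulrn // ler_powR ?ler1n // natrX -powR_mulrn //.
by rewrite ler_powR ?ler1n.
Qed.

Lemma le_log2 (a n k : nat) : (0 < n)%N ->
  ((k%:R : F) <= a%:R * log2 n%:R) = (2 ^ k <= n ^ a)%N.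
Proof.
move=> n0; have l2 : 0 < ln (2 : F) by rewrite ln_gt0 // ltr1n.
rewrite /log2 mulrA ler_pdivlMr // mulr_natl mulr_natl -!lnXn ?ltr0n //.
by rewrite ler_ln ?posrE ?exprn_gt0 ?ltr0n // -!natrX ler_nat.
Qed.

Lemma half_exponent n : (n%:R / 2 - 4 : F) <= (n./2 - 3)%N%:R.
Proof.
have h : (n%:R : F) <= 2 * (n./2)%:R + 1.
  by rewrite -[2 : F]/(2%:R) -natrM natr1 ler_nat; lia.
have h' : ((n./2)%:R : F) <= (n./2 - 3)%N%:R + 3.
  by rewrite -[3 : F]/(3%:R) -natrD ler_nat; lia.
lra.
Qed.

Lemma diff_exponent n m : (m < n)%N -> (n%:R - m%:R - 3 : F) <= (n - m - 3)%N%:R.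
Proof.
move=> mn; have h : (n%:R : F) <= (n - m - 3)%N%:R + m%:R + 3.
  by rewrite -[3 : F]/(3%:R) -!natrD ler_nat; lia.
lra.
Qed.

(** The excluded interval around [2 ^ n] ends at 5 times [2 ^ (n - 2)], and the one around
    [2 ^ (n + 1)] begins at 7 times [2 ^ (n - 2)]. *)
Lemma gap_range (n d : nat) : (2 <= n)%N -> (2 ^ n < d <= 2 ^ n.+1)%N ->
  (forall n : nat, ~~ ((2 : F) ^+ n - 2 ^ (n%:Z - 3) <= (d%:R : F) <= 2 ^+ n + 2 ^ (n%:Z - 2))) ->
  (5 * 2 ^ (n - 2) < d < 7 * 2 ^ (n - 2))%N.
Proof.
move=> n2 /andP[h1 h2] g; set q := (2 ^ (n - 2))%N.
have e1 : (2 ^ n = 4 * q)%N by rewrite /q -(expnD 2 2); congr (2 ^ _)%N; lia.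
have e2 : (2 : F) ^ (n%:Z - 2) = q%:R.
  by rewrite /q natrX exprnP; congr (_ ^ _); lia.
have e3 : (2 : F) ^ (n.+1%:Z - 3) = q%:R.
  by rewrite /q natrX exprnP; congr (_ ^ _); lia.
apply/andP; split; rewrite ltnNge; apply/negP => hd.
  move/negP: (g n); apply; rewrite e2 -natrX e1 -natrD ler_nat; apply/andP; split; last by lia.
  apply: le_trans (_ : (4 * q)%:R <= _); last by rewrite ler_nat; lia.
  by rewrite gerBl exprz_ge0.
move/negP: (g n.+1); apply; rewrite e3 -natrX expnS e1.
apply/andP; split.
  by rewrite lerBlDr -natrD ler_nat; lia.
apply: le_trans (_ : (2 * (4 * q))%:R <= _); first by rewrite ler_nat -e1 -expnS.
by rewrite lerDl exprz_ge0.
Qed.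

(** Degree 1 lies in the excluded interval for n = 0. A relation of degree 1 would belong to no
    level, as levels start above [2 ^ 0]. *)
Lemma gap_not1 (d : nat) : (0 < d)%N ->
  ~~ ((2 : F) ^+ 0%N - 2 ^ (0%N%:Z - 3) <= (d%:R : F) <= 2 ^+ 0%N + 2 ^ (0%N%:Z - 2)) -> (1 < d)%N.
Proof.
move=> d0; apply: contraR; rewrite -leqNgt => d1.
have -> : d = 1%N by lia.
by rewrite expr0 gerBl lerDl !exprz_ge0.
Qed.

End Reals.

Lemma enum_card_II (J : choiceType) (A : set J) n : A #= `I_n -> exists l : seq J,
  size l = n /\ forall i, A i <-> i \in l.
Proof.
move=> h; have fA : finite_set A by apply/finite_setP; exists n.
exists (fset_set A : seq J); split; first exact: card_fset_set h.
by move=> i; rewrite in_fset_set // inE.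
Qed.

(** * Assembly of the algebra *)

Section Main.
Variables (F : realType) (K : fieldType) (J : countType) (f : J -> free_alg K)
  (d : J -> nat) (r : nat -> nat).
Hypotheses (f_homogeneous : forall i, homogeneous (d i) (f i))
  (d_gt0 : forall i, (0 < d i)%N)
  (rE : forall n, [set i : J | (2 ^ n < d i <= 2 ^ n.+1)%N] #= `I_(r n))
  (r_small : forall i, (i < 8)%N -> r i = 0%N)
  (gap : forall (n : nat) (i : J),
    ~~ ((2 : F) ^+ n - 2 ^ (n%:Z - 3) <= ((d i)%:R : F) <= 2 ^+ n + 2 ^ (n%:Z - 2)))
  (r_half : forall n, r n != 0 -> (r n < 2 ^ (2 ^ (n./2 - 3)))%N)
  (r_grow : forall m n, r m != 0 -> r n != 0 -> (m < n)%N ->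
     (2 ^ (3 * n + 4) * r m ^ 33 < r n)%N /\ (r n < 2 ^ (2 ^ (n - m - 3)))%N).

Lemma exists_relations : exists fs : nat -> seq (nat * seq (K * seq 'I_2)),
  [/\ forall n, size (fs n) = r n, forall n, allp (level_rel n) (fs n) &
      forall i, exists n, (d i, coeff_words (f i)) \in fs n].
Proof.
have [l hl] := choice (fun n => enum_card_II (rE n)).
exists (fun n => [seq (d i, coeff_words (f i)) | i <- l n]); split=> [n|n|i].
- by rewrite size_map; case: (hl n).
- apply/allp_map/allp_mem => i il; have [sl hln] := hl n.
  have dn : (2 ^ n < d i <= 2 ^ n.+1)%N by apply/hln.
  split; first exact (homogeneous_coeff_words (@f_homogeneous i)).
  apply: (gap_range _ dn (gap^~ i)); rewrite leqNgt; apply/negP => n2.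
  by move: il; rewrite (size0nil (etrans sl (r_small _))) //; lia.
have d1 := gap_not1 (d_gt0 i) (gap 0 i).
(* The levels are intervals open on the left, hence the logarithm of [d i - 1]. *)
have /andP[n1 n2] := @trunc_log_bounds 2 (d i).-1 isT ltac:(lia).
exists (trunc_log 2 (d i).-1); apply/mapP; exists i => //.
have [_ h] := hl (trunc_log 2 (d i).-1); apply/h => /=; lia.
Qed.

Lemma exists_algebra : exists (R : algType K) (G : nat -> R -> Prop),
  [/\ grading G, infinite_dim R,
    exists phi : {rmorphism quot_alg f -> R},
      [/\ scalable phi,
          forall u : R, exists x : quot_alg f, phi x = u &
          forall k (a : free_alg K), homogeneous k a -> G k (phi (quot_proj f a))],
    forall n k, (0 < n)%N -> r k != 0 -> (2 ^ k <= n ^ 2)%N ->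
      (forall k', r k' != 0 -> (2 ^ k' <= n ^ 2)%N -> (k' <= k)%N) ->
      exists D, has_dim (degree_le G n) D /\ (D <= 8 * n ^ 4 * r k ^ 33)%N &
    forall n j, (0 < n)%N -> r j != 0 -> (2 ^ j <= n)%N ->
      exists D, has_dim (degree_le G n) D /\ (r j ^ 4 <= 2 * D)%N].
Proof.
have [fs [fs_size fs_rel fs_all]] := exists_relations.
have [st hst] := exists_chain fs_size fs_rel r_small r_half r_grow.
have vst := chain_valid hst; have mst := chain_extends hst.
pose E := vanishing st.
have [R [p [pZ psurj pE]]] := exists_quotient (vanishingP mst) (vanishing0 st)
  (fun a b => @vanishingMl K st a b) (fun a b => @vanishingMr K st a b) (@vanishing1 K st).
have Ehom := vanishing_homogeneous vst.
have pf i : p (f i) = 0.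
  apply/pE; have [n fin] := fs_all i; exists n.
  by have /allp_mem/(_ _ fin) := chain_kills fs_size r_small hst (leqnn n).
exists R, (graded_part p); split.
- exact: (quotient_grading pZ psurj pE Ehom).
- apply: (quotient_infinite pZ psurj pE) => N.
  have [n hn] := chain_len hst N; have v := vst n.
  have [w hw] : exists w, word_of (letter0 (st n)) w != 0.
    apply: contrapT => h0.
    have := word_indep v (e := fun a => (a == letter0 (st n))%:R).
    move=> /(_ _ (letter0 (st n))); rewrite eqxx => h1.
    suff : (1 : K) = 0 by move/eqP; rewrite oner_eq0.
    apply: h1 => w; rewrite (bigD1 (letter0 (st n))) //= eqxx mul1r big1 ?addr0.
      by apply/eqP; apply: contrapT => /negP hw; apply: h0; exists w.
    by move=> a /negPf ->; rewrite mul0r.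
  exists (word_of (letter0 (st n))), (len (st n)), w; split=> //.
    exact: word_supp.
  by move=> a Ea; apply: (vanishing_letter vst mst (j := n) _ [::] v (extends_refl _) Ea).
- have [phi [phiZ phiE]] := exists_descend pZ pf.
  exists phi; split=> //.
    by move=> u; have [a <-] := psurj u; exists (quot_proj f a).
  by move=> k a ha; rewrite phiE; exists a.
- move=> n k n0 rk kn kmax.
  have [n' hw] := chain_span hst n0 rk kn kmax.
  have [Fs sF hF] := window_span_vanishing vst hw.
  have [D hD DN] := dim_upper pZ pE sF hF.
  by exists D.
move=> n j n0 rj jn.
have [D hD] := dim_exists pZ pE n.
exists D; split=> //.
have [st0 l0 e0] := chain_level hst rj.
apply: leq_trans (level_many l0) _; rewrite leq_mul2l /=.
have v0 := level_valid l0.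
have [_ [Q [Qi [z [u0 su0 zu0] hz]]]] := level_half l0.
(* Translating by [u0], where the common left factor [z] is nonzero, turns the letters of level [j]
   into their independent right factors of degree [2 ^ j <= n]. *)
apply: (dim_lower pZ psurj pE (m := (2 ^ j)%N)
  (Q := fun b w => (z u0)^-1 * word_of b (u0 ++ w)) jn _ _ hD).
  by move=> b a Ea; rewrite lin_scale (vanishing_letter vst mst _ _ v0 e0 Ea) mulr0.
move=> e he; apply: Qi => w sw; rewrite -[RHS](he w sw).
by apply: eq_bigr => b _; rewrite hz // [in RHS](mulrA _^-1) mulVf // mul1r.
Qed.

End Main.

Theorem theorem0p1 (F : realType) (K : closedFieldType)
    (J : countType) (f : J -> free_alg K) (d : J -> nat) (r : nat -> nat)
    (f_homogeneous : forall i, homogeneous (d i) (f i))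
    (d_gt0 : forall i, (0 < d i)%N)
    (rE : forall n, [set i : J | (2 ^ n < d i <= 2 ^ n.+1)%N] #= `I_(r n))
    (r_small : forall i, (i < 8)%N -> r i = 0%N)
    (gap : forall (n : nat) (i : J),
      ~~ ((2 : F) ^+ n - 2 ^ (n%:Z - 3) <= ((d i)%:R : F) <= 2 ^+ n + 2 ^ (n%:Z - 2)))
    (r_growth : forall m n : nat,
      (r m != 0%N \/ m = 0%N) -> (r n != 0%N \/ n = 0%N) -> (m < n)%N ->
      [/\ (2 ^ (3 * n + 4) * r m ^ 33 < r n)%N,
          (r n)%:R < 2 `^ (2 `^ (n%:R - m%:R - 3)) :> F &
          (r n)%:R < 2 `^ (2 `^ (n%:R / 2 - 4)) :> F]) :
  exists (R : algType K) (G : nat -> R -> Prop),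
    [/\ grading G,
        infinite_dim R,
        exists phi : {rmorphism quot_alg f -> R},
          [/\ scalable phi,
              forall u : R, exists x : quot_alg f, phi x = u &
              forall k (a : free_alg K),
                homogeneous k a -> G k (phi (quot_proj f a))],
        forall n k : nat, (0 < n)%N ->
          r k != 0%N -> k%:R <= 2 * log2 n%:R :> F ->
          (forall k' : nat, r k' != 0%N -> k'%:R <= 2 * log2 n%:R :> F ->
            (k' <= k)%N) ->
          exists D : nat, has_dim (degree_le G n) D /\
            (D <= 8 * n ^ 4 * r k ^ 33)%N &
        forall n j : nat, (0 < n)%N ->
          r j != 0%N -> j%:R <= log2 n%:R :> F ->
          exists D : nat, has_dim (degree_le G n) D /\
            1 / 2 * (r j)%:R ^+ 4 <= D%:R :> F].

Proof.
have r0 : r 0%N = 0%N by apply: r_small.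
(* Taking m = 0 in the growth hypothesis yields the bound for every n in Y, including the smallest
   one. *)
have growth n : r n != 0%N -> (r n < 2 ^ (2 ^ (n./2 - 3)))%N.
  move=> rn; have n0 : (0 < n)%N by rewrite lt0n; apply: contraNneq rn => ->; rewrite r0.
  have [_ _ h] := r_growth 0%N n (or_intror erefl) (or_introl rn) n0.
  exact: tower_bound (half_exponent F n) h.
have [m n rm rn mn|R [G [h1 h2 h3 h4 h5]]] :=
    @exists_algebra F K J f d r f_homogeneous d_gt0 rE r_small gap growth.
  have [h1 h2 _] := r_growth m n (or_introl rm) (or_introl rn) mn.
  split=> //; exact: tower_bound (diff_exponent F mn) h2.
exists R, G; split=> //.
  move=> n k n0 rk; rewrite -[2 : F]/(2%:R) le_log2 // => kn kmax.
  by apply: h4 => // k' rk' kn'; apply: kmax; rewrite // le_log2.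
move=> n j n0 rj; rewrite -[X in _ <= X]mul1r (le_log2 F 1) // expn1 => jn.
have [D [hD jD]] := h5 n j n0 rj jn; exists D; split=> //.
rewrite mul1r ler_pdivrMl // -[2 : F]/(2%:R) -natrX -natrM ler_nat //.
Qed.
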